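(* Let $d=(d_i)$ be smooth with $d_i(u)\ge c_0>0$ for all $u\in\overline{\mathbb{R}}_+^N$, $1\le i\le N$, and suppose that the symmetric matrix $P(u)=(p_{ij}(u))$, $$p_{ij}(u)=\left(\frac{\partial d_i}{\partial u_j}(u)+\frac{\partial d_j}{\partial u_i}(u)\right)u_iu_j+\left(\delta_{ij}d_i(u)u_j+\delta_{ji}d_j(u)u_i\right),$$ is positive semidefinite for every $u\in\overline{\mathbb{R}}_+^N$ (here $\delta_{ij}$ is the Kronecker delta). Assume that $d$ is of linear growth rate: there are constants $\delta,C>0$ such that $$\delta|u|^2\le d(u)\cdot u\le C(1+|u|^2),\qquad u\in\overline{\mathbb{R}}_+^N .$$ Let $f=(f_i):\overline{\mathbb{R}}_+^N\to\mathbb{R}^N$ be locally Lipschitz continuous and satisfy, for some constant $C>0$ and all $u=(u_i)\in\overline{\mathbb{R}}_+^N$, $1\le i\le N$: - (quasi-positivity) $f_i(u_1,\dots,u_{i-1},0,u_{i+1},\dots,u_N)\ge 0$; - (total mass dissipation) $\sum_{i} f_i(u)\le 0$; - (cubic growth) $|f_i(u)|\le C(1+|u|^3)$ and $\dfrac{\partial f_i}{\partial u_i}(u)\ge -C(1+|u|^2)$. Let $u=(u_i(x,t))$ be the positive classical solution on $\Omega\times[0,T)$, $0<T<\infty$, of the quasilinear reaction diffusion system $$\tau_i\frac{\partial u_i}{\partial t}-\Delta\left(d_i(u)u_i\right)=f_i(u)\ \text{ in }\Omega\times(0,T),\quad \frac{\partial}{\partial\nu}\left(d_i(u)u_i\right)=0\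 \text{ on }\partial\Omega\times(0,T),\quad u_i|_{t=0}=u_i^0\ \text{ in }\Omega,\qquad 1\le i\le N.$$ Then there is a constant $C_T<\infty$ such that $$\sup_{0\le t<T}\|u(\cdot,t)\|_{L\log L}\le C_T.$$
   Context: $\Omega\subset\mathbb{R}^n$ is a bounded domain with smooth boundary $\partial\Omega$, $\nu$ is the outer unit normal vector, $\tau=(\tau_i)\in\mathbb{R}_+^N$ has positive entries, and $u_0=(u_i^0(x))\not\equiv 0$, $u_i^0\ge 0$, is a sufficiently smooth initial value. $\overline{\mathbb{R}}_+^N=\{u\in\mathbb{R}^N: u_i\ge 0,\ 1\le i\le N\}$, and $d(u)\cdot u=\sum_i d_i(u)u_i$. A unique positive classical solution exists locally in time; $T$ denotes the (finite) time up to which it is considered, and may be the maximal existence time. $\|\cdot\|_{L\log L}$ is the standard norm of the Zygmund space $L\log L(\Omega)$ (applied to vector-valued functions componentwise); a bound on it is equivalent to a bound on $\int_\Omega |u|\log(1+|u|)\,dx$. Since $f$ is only locally Lipschitz, $\partial f_i/\partial u_i$ is understood at the points where it exists. $C_T$ is a constant depending on $T$ (and on the data of the problem). *)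

(* Defs.v *)
From HB Require Import structures.
From mathcomp Require Import all_boot all_order all_algebra.
From mathcomp Require Import all_classical all_reals all_analysis.

Set Implicit Arguments.
Unset Strict Implicit.
Unset Printing Implicit Defensive.
Import Order.TTheory GRing.Theory Num.Theory.
Import numFieldNormedType.Exports.

Local Open Scope classical_set_scope.
Local Open Scope ring_scope.

(* Lebesgue measure on R^n.  The library puts the product sigma-algebra on
   n-tuples (not on row vectors), so the n-fold product of the Lebesgue measure
   of R is built there, along the identification R * R^n = R^(n+1). *)
Section lebesgue_measure_tuple.
Context {R : realType}.
Local Notation RT := (measurableTypeR R).

Definition cons_tuple n (p : RT * n.-tuple RT) : n.+1.-tuple RT :=
  [tuple of p.1 :: p.2].

Lemma measurable_cons_tuple n :
  measurable_fun [set: RT * n.-tuple RT] (@cons_tuple n).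
Proof. exact: measurable_cons. Qed.

Section step.
Variables (n : nat) (m : {sigma_finite_measure set (n.-tuple RT) -> \bar R}).

Definition lebesgue_step : set (n.+1.-tuple RT) -> \bar R :=
  pushforward (lebesgue_measure \x m)%E (@cons_tuple n).

Let mu : {measure set (n.+1.-tuple RT) -> \bar R} :=
  measure_function_pushforward__canonical__measure_function_Measure
    (lebesgue_measure \x m)%E (@measurable_cons_tuple n).

Let step0 : lebesgue_step set0 = 0%E.
Proof. exact: (measure0 mu). Qed.

Let step_ge0 A : (0 <= lebesgue_step A)%E.
Proof. exact: (measure_ge0 mu). Qed.

Let step_sigma_additive : semi_sigma_additive lebesgue_step.
Proof. exact: (@measure_semi_sigma_additive _ _ _ mu). Qed.

HB.instance Definition _ := isMeasure.Build _ _ _ lebesgue_step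
  step0 step_ge0 step_sigma_additive.

Let step_sigma_finite : sigma_finite setT lebesgue_step.
Proof.
have /sigma_finiteP[F [FT ndF Foo]] := sigma_finiteT (@lebesgue_measure R).
have /sigma_finiteP[G [GT ndG Goo]] := sigma_finiteT m.
pose uncons (t : n.+1.-tuple RT) : RT * n.-tuple RT :=
  (thead t, [tuple of behead t]).
have unconsK p : uncons (cons_tuple p) = p.
  by case: p => x t; congr pair => //; exact: val_inj.
have muncons : measurable_fun [set: n.+1.-tuple RT] uncons.
  by apply/measurable_fun_pair; [exact: measurable_tnth|exact: measurable_behead].
exists (fun k => uncons @^-1` (F k `*` G k)) => [|k].
  apply/esym; rewrite -subTset => t _.
  have [i _ Fi] : (\bigcup_i F i) (uncons t).1 by rewrite -FT.
  have [j _ Gj] : (\bigcup_j G j) (uncons t).2 by rewrite -GT.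
  exists (maxn i j) => //; split.
    by move: Fi; exact/subsetPset/ndF/leq_maxl.
  by move: Gj; exact/subsetPset/ndG/leq_maxr.
have [mF F_oo] := Foo k; have [mG G_oo] := Goo k.
split; first by rewrite -[X in measurable X]setTI; apply: muncons => //; exact: measurableX.
rewrite /lebesgue_step /pushforward -comp_preimage.
rewrite (_ : uncons \o _ = id); last by apply/funext => p; exact: unconsK.
by rewrite preimage_id product_measure1E// lte_mul_pinfty// ge0_fin_numE.
Qed.

HB.instance Definition _ := Measure_isSigmaFinite.Build _ _ _ lebesgue_step
  step_sigma_finite.

End step.

Fixpoint lebesgue_tuple n : {sigma_finite_measure set (n.-tuple RT) -> \bar R} :=
  match n with
  | 0 => \d_([tuple] : 0.-tuple RT)
  | n.+1 => lebesgue_step (lebesgue_tuple n)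
  end.

End lebesgue_measure_tuple.

Section definitions.
Context {R : realType}.

Definition integral_rV n (D : set 'rV[R]_n) (g : 'rV[R]_n -> \bar R) : \bar R :=
  let row_of (z : n.-tuple (measurableTypeR R)) : 'rV[R]_n :=
    \row_(i < n) tnth z i in
  (\int[lebesgue_tuple n]_(z in row_of @^-1` D) g (row_of z))%E.

(* The library norm of a row vector is the sup norm; this is the Euclidean one. *)
Definition enorm n (x : 'rV[R]_n) : R := Num.sqrt (\sum_i x 0 i ^+ 2).

(* C^k and C^infinity on an open set U. *)
Fixpoint Ck_on n (k : nat) (U : set 'rV[R]_n) (g : 'rV[R]_n -> R) : Prop :=
  match k with
  | 0 => forall x, U x -> {for x, continuous g}
  | k.+1 => (forall x, U x -> {for x, continuous g}) /\
      forall j, (forall x, U x -> derivable g x 'e_j) /\ Ck_on k U ('D_('e_j) g)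
  end.

Definition smooth_on n (U : set 'rV[R]_n) (g : 'rV[R]_n -> R) : Prop :=
  forall k, Ck_on k U g.

(* Derivative of g at x in direction v, taken relative to A: the increments h
   are restricted to x + h v \in A, so that only the values of g on A matter
   (one-sided derivative when x lies on the boundary of A). *)
Definition diff_quotient_in n (A : set 'rV[R]_n) (g : 'rV[R]_n -> R)
    (x v : 'rV[R]_n) : set_system R :=
  (fun h : R => h^-1 * (g (x + h *: v) - g x)) @
    within [set h : R | A (x + h *: v)] 0^'.

Definition is_derive_in n (A : set 'rV[R]_n) (g : 'rV[R]_n -> R)
    (x v : 'rV[R]_n) (l : R) : Prop :=
  diff_quotient_in A g x v --> l.

Definition derive_in n (A : set 'rV[R]_n) (g : 'rV[R]_n -> R)
    (x v : 'rV[R]_n) : R :=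
  lim (diff_quotient_in A g x v).

Definition gradient n (g : 'rV[R]_n -> R) (x : 'rV[R]_n) : 'rV[R]_n :=
  \row_j 'D_('e_j) g x.

Definition laplacian n (g : 'rV[R]_n -> R) (x : 'rV[R]_n) : R :=
  \sum_j 'D_('e_j) ('D_('e_j) g) x.

Definition bounded_domain n (Omega : set 'rV[R]_n) : Prop :=
  [/\ open Omega, connected Omega, Omega !=set0 & bounded_set Omega].

Definition boundary n (Omega : set 'rV[R]_n) : set 'rV[R]_n :=
  closure Omega `\` interior Omega.

Definition local_defining_function n (Omega U : set 'rV[R]_n)
    (rho : 'rV[R]_n -> R) (x : 'rV[R]_n) : Prop :=
  [/\ open U, U x, smooth_on U rho,
      forall y, U y -> gradient rho y != 0
    & forall y, U y -> (Omega y <-> rho y < 0)].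

Definition smooth_boundary n (Omega : set 'rV[R]_n) : Prop :=
  forall x, boundary Omega x ->
    exists U rho, local_defining_function Omega U rho x.

(* Independent of the choice of rho, since Omega lies on the side rho < 0. *)
Definition outer_unit_normal n (Omega : set 'rV[R]_n) (x nu : 'rV[R]_n) : Prop :=
  boundary Omega x /\
  exists U rho, local_defining_function Omega U rho x /\
    nu = (enorm (gradient rho x))^-1 *: gradient rho x.

Definition orthant N : set 'rV[R]_N := [set u | forall i, 0 <= u 0 i].

(* Smoothness up to the boundary of the closed orthant: g is there the restriction
   of a smooth function on R^N; its values outside the orthant play no role. *)
Definition smooth_on_orthant N (g : 'rV[R]_N -> R) : Prop :=
  exists2 G, smooth_on [set: 'rV[R]_N] G & forall u, orthant u -> G u = g u.

(* p_ij(u); the partial derivatives are relative to the closed orthant. *)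
Definition structure_matrix N (d : 'rV[R]_N -> 'rV[R]_N) (u : 'rV[R]_N) : 'M[R]_N :=
  let pd i j := derive_in (@orthant N) (fun v => d v 0 i) u 'e_j in
  \matrix_(i, j)
    ((pd i j + pd j i) * (u 0 i * u 0 j)
     + ((i == j)%:R * d u 0 i * u 0 j + (j == i)%:R * d u 0 j * u 0 i)).

Definition positive_semidefinite N (P : 'M[R]_N) : Prop :=
  forall xi : 'rV[R]_N, 0 <= (xi *m P *m xi^T) 0 0.

(* g, defined on Omega x (0, T), is the restriction of a continuous function on
   closure(Omega) x (0, T). *)
Definition continuous_up_to_boundary n (T : R) (Omega : set 'rV[R]_n)
    (g : R -> 'rV[R]_n -> R) : Prop :=
  exists2 G : R * 'rV[R]_n -> R,
    {within `]0, T[%classic `*` closure Omega, continuous G} &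
    forall t x, 0 < t < T -> Omega x -> G (t, x) = g t x.

(* g is of class C^{2,1} on closure(Omega) x (0, T): the derivatives
   g_t, g_{x_j}, g_{x_j x_k} exist in Omega x (0, T) and they are, together with g,
   continuous up to the boundary of Omega. *)
Definition C21 n (T : R) (Omega : set 'rV[R]_n) (g : R -> 'rV[R]_n -> R) : Prop :=
  [/\ forall t x, 0 < t < T -> Omega x ->
        derivable (g^~ x) t 1 /\
        forall j, derivable (g t) x 'e_j /\
          forall k, derivable ('D_('e_j) (g t)) x 'e_k,
      continuous_up_to_boundary T Omega g,
      continuous_up_to_boundary T Omega (fun t x => derive1 (g^~ x) t),
      forall j, continuous_up_to_boundary T Omega (fun t => 'D_('e_j) (g t))
    & forall j k,
        continuous_up_to_boundary T Omega (fun t => 'D_('e_k) ('D_('e_j) (g t)))].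

(* Nonnegative classical solutions, u t x being the value at time t and point x;
   the normal derivative is taken from inside closure(Omega). *)
Record positive_classical_solution n N (Omega : set 'rV[R]_n) (tau : 'rV[R]_N)
    (d f : 'rV[R]_N -> 'rV[R]_N) (u0 : 'rV[R]_n -> 'rV[R]_N) (T : R)
    (u : R -> 'rV[R]_n -> 'rV[R]_N) : Prop := PositiveClassicalSolution {
  sol_continuous : {within `[0, T[%classic `*` closure Omega,
    continuous (fun p : R * 'rV[R]_n => u p.1 p.2)} ;
  sol_C21 : forall i, C21 T Omega (fun t x => u t x 0 i) ;
  sol_ge0 : forall t x, 0 <= t < T -> closure Omega x -> orthant (u t x) ;
  sol_equation : forall t x i, 0 < t < T -> Omega x ->
    tau 0 i * derive1 (fun s => u s x 0 i) t
      - laplacian (fun y => d (u t y) 0 i * u t y 0 i) x = f (u t x) 0 i ;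
  sol_neumann : forall t x nu i, 0 < t < T -> outer_unit_normal Omega x nu ->
    is_derive_in (closure Omega) (fun y => d (u t y) 0 i * u t y 0 i) x nu 0 ;
  sol_initial : forall x, Omega x -> u 0 x = u0 x
}.

Definition LlogL_young (s : R) : R := s * ln (1 + s).

(* Luxemburg norm of L log L(Omega) for the Young function s log(1 + s). *)
Definition LlogL_norm n (Omega : set 'rV[R]_n) (g : 'rV[R]_n -> R) : \bar R :=
  ereal_inf [set l%:E | l in [set l : R | 0 < l /\
    (integral_rV Omega (fun x => (LlogL_young (`|g x| / l))%:E) <= 1)%E]].

Definition LlogL_norm_rV n N (Omega : set 'rV[R]_n)
    (g : 'rV[R]_n -> 'rV[R]_N) : \bar R :=
  (\sum_(i < N) LlogL_norm Omega (fun x => g x 0 i)%R)%E.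

End definitions.

(* Main.v *)
From HB Require Import structures.
Require Import Defs.
From mathcomp Require Import all_boot all_order all_algebra.
From mathcomp Require Import all_classical all_reals all_analysis.
From mathcomp Require Import measurable_realfun.
From mathcomp Require Import ring lra.

Set Implicit Arguments.
Unset Strict Implicit.
Unset Printing Implicit Defensive.
Import Order.TTheory GRing.Theory Num.Theory.
Import numFieldNormedType.Exports.

Local Open Scope classical_set_scope.
Local Open Scope ring_scope.

(** The bound is an entropy estimate. Let z be the sum of the d_i(u) u_i and v the sum of the
    tau_i u_i. The cubic growth of the reactions is absorbed by the integral of z v, which is at
    least of order |u|^3 because z grows quadratically and v linearly.

    Summing the equations and using mass dissipation, v_t <= Laplacian z, and the gradient of z has
    no flux through the boundary. Let W(t) be the integral of grad z from a small time eps to t.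
    Integrating the inequality in time and then against z(t) >= 0, the integral of z (v - v(eps)) is
    at most that of - W . grad z, which is minus half the time derivative of the integral of |W|^2
    (flux_dissipation).

    Let y_i = u_i + eta, and let E be the integral of the sum of tau_i y_i ln y_i. Its derivative
    has two parts. The diffusion part is minus the integral of grad u_i . grad (d_i(u) u_i) / y_i.
    Up to factors u_k / y_k this is half the quadratic form of the structure matrix at
    xi_i = (partial_j u_i) / y_i, hence it is nonpositive up to an error (diffusion_entropy_ge).
    The error tends to 0 with eta, because the gradient of u_k vanishes at the interior zeros of
    u_k (degenerate_gradient_small). The reaction part is the integral of f_i (ln y_i + 1).
    Quasi-positivity and the derivative bound give f_i >= - C (1 + |u|^2) u_i
    (reaction_lower_bound); with mass dissipation this bounds the reaction part by a multiple of
    (1 + |u|)^3, without a logarithm (reaction_entropy_le).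

    For lambda large, E plus lambda / 2 times the integral of |W|^2 therefore grows at a bounded rate
    (entropy_growth), and E controls the integral of u ln (1 + u). For small eps the entropy at eps
    is bounded in terms of max u0, so the constant does not depend on the solution.

    Two facts of analysis carry these computations. The divergence theorem (green) is proved for
    fields tangent to the boundary, as the Neumann condition makes the gradients of the flows: the
    field is cut off in a strip of width e along the boundary, the volume of the strip is O(e), and
    the gradient of the cutoff, of size 1 / e, is normal and meets a field whose normal component is
    small there. The reactions are only Lipschitz, with a derivative bound at the points of
    differentiability; a Lipschitz function is the integral of its almost everywhere derivative,
    by the theorems of Radon-Nikodym and Lebesgue (lipschitz_derivative_ge). *)

(** * Tonelli's theorem along a chosen coordinate *)

Section insertion.
Context {R : realType}.
Local Notation RT := (measurableTypeR R).

(** The measure on R^(n+1) is built by consing the first coordinate; inserting at position j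
    lets a line in direction j be integrated first, whatever j is. *)
Definition insert_tuple n (j : 'I_n.+1) (s : RT) (t : n.-tuple RT) : n.+1.-tuple RT :=
  [tuple (if unlift j i is Some k then tnth t k else s) | i < n.+1].

Lemma insert_tuple0 n (s : RT) (t : n.-tuple RT) :
  insert_tuple ord0 s t = Defs.cons_tuple (s, t).
Proof.
apply: eq_from_tnth => i; rewrite tnth_mktuple.
case: unliftP => [k ->|->] /=; first by rewrite tnthS.
by rewrite tnth0.
Qed.

Lemma insert_tuple_lift n (j : 'I_n.+1) (s x : RT) (t : n.-tuple RT) :
  insert_tuple (lift ord0 j) s (Defs.cons_tuple (x, t)) = Defs.cons_tuple (x, insert_tuple j s t).
Proof.
apply: eq_from_tnth => i; rewrite tnth_mktuple.
case: (unliftP ord0 i) => [i' ->|->].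
  rewrite [RHS]tnthS tnth_mktuple.
  case: (unliftP j i') => [k ->|->].
    have -> : lift ord0 (lift j k) = lift (lift ord0 j) (lift ord0 k).
      by apply: val_inj; rewrite /= /bump /= !add1n ltnS; case: (j <= k)%N.
    by rewrite liftK tnthS.
  by rewrite unlift_none.
rewrite tnth0; case: (unliftP (lift ord0 j) ord0) => [k|/eqP]; last by rewrite -val_eqE.
move=> /(congr1 val); rewrite /= /bump /= add1n => k0.
have {}k0 : val k = 0%N by case: (j < k)%N k0.
by rewrite (_ : tnth _ k = x)// (tnth_nth x) k0.
Qed.

Lemma measurable_insert_tuple n (j : 'I_n.+1) :
  measurable_fun [set: n.-tuple RT * RT] (fun p => insert_tuple j p.2 p.1).
Proof.
apply/measurable_fun_tnthP => i /=.
rewrite [X in measurable_fun _ X](_ : _ = fun p =>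
   if unlift j i is Some k then tnth p.1 k else p.2); last first.
  by apply/funext => p /=; rewrite tnth_mktuple.
case: unliftP => [k _|_] //.
  by apply: (measurableT_comp (measurable_tnth k)).
exact: measurable_snd.
Qed.

Lemma measurable_insert_tuple1 n (j : 'I_n.+1) (t : n.-tuple RT) :
  measurable_fun [set: RT] (fun s => insert_tuple j s t).
Proof.
have := measurableT_comp (measurable_insert_tuple j) (pair1_measurable t).
exact.
Qed.

Lemma measurable_cons_tuple2 n (s : RT) :
  measurable_fun [set: n.-tuple RT] (fun t => Defs.cons_tuple (s, t)).
Proof. exact: (measurableT_comp (@measurable_cons_tuple R n) (pair1_measurable s)). Qed.

Local Open Scope ereal_scope.

Lemma tonelli_insert0 n (f : n.+1.-tuple RT -> \bar R) :
  measurable_fun [set: n.+1.-tuple RT] f -> (forall t, 0 <= f t) ->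
  \int[lebesgue_tuple n.+1]_t f t =
  \int[lebesgue_measure]_s \int[lebesgue_tuple n]_t f (Defs.cons_tuple (s, t)).
Proof.
move=> mf f0.
rewrite [LHS](@ge0_integral_pushforward _ _ _ _ _ _ (@measurable_cons_tuple R n))//.
rewrite preimage_setT fubini_tonelli1//.
exact: (measurableT_comp mf (@measurable_cons_tuple R _)).
by move=> p; exact: f0.
Qed.

(** Induction on the dimension. For j = 0 this is Tonelli's theorem for the two factors of the
    measure; otherwise the first coordinate stays outermost on both sides, and the induction
    hypothesis applies to the others. *)
Lemma tonelli_insert n (j : 'I_n.+1) (f : n.+1.-tuple RT -> \bar R) :
  measurable_fun [set: n.+1.-tuple RT] f -> (forall t, 0 <= f t) ->
  \int[lebesgue_tuple n.+1]_t f t =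
  \int[lebesgue_tuple n]_t \int[lebesgue_measure]_s f (insert_tuple j s t).
Proof.
elim: n j f => [|n IHn] j f mf f0.
  rewrite tonelli_insert0//= integral_dirac//; last first.
    apply: (measurable_fun_fubini_tonelli_F (fun p => f (insert_tuple j p.2 p.1))) => //.
    exact: (measurableT_comp mf (measurable_insert_tuple _)).
  rewrite diracT mul1e; apply: eq_integral => s _.
  rewrite integral_dirac// ?diracT ?mul1e ?ord1 ?insert_tuple0//.
  exact: (measurableT_comp mf (measurable_cons_tuple2 _)).
have mfc : measurable_fun [set: RT * n.+1.-tuple RT] (f \o @Defs.cons_tuple R n.+1).
  exact: (measurableT_comp mf (@measurable_cons_tuple R _)).
rewrite tonelli_insert0//.
case: (unliftP ord0 j) => [j' ->|->]; last first.
  under [RHS]eq_integral do under eq_integral do rewrite insert_tuple0.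
  rewrite (fubini_tonelli (m1 := lebesgue_measure) (m2 := lebesgue_tuple n.+1)
    (f \o @Defs.cons_tuple R n.+1) mfc)//.
  by move=> p; exact: f0.
rewrite tonelli_insert0//; last 2 first.
- apply: (measurable_fun_fubini_tonelli_F
    (fun p => f (insert_tuple (lift ord0 j') p.2 p.1))) => //.
  exact: (measurableT_comp mf (measurable_insert_tuple _)).
- by move=> t; exact: integral_ge0.
apply: eq_integral => s _.
rewrite (IHn j')//; last first.
  exact: (measurableT_comp mf (measurable_cons_tuple2 _)).
apply: eq_integral => t _; apply: eq_integral => x _.
by rewrite insert_tuple_lift.
Qed.

End insertion.

(** * Borel measurability of open sets of row vectors *)

Section row_measure.
Context {R : realType}.
Local Notation RT := (measurableTypeR R).

Definition row_of n (z : n.-tuple RT) : 'rV[R]_n := \row_(i < n) tnth z i.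

Lemma row_of_insert n (j : 'I_n.+1) (s : RT) (t : n.-tuple RT) :
  row_of (insert_tuple j s t) = row_of (insert_tuple j 0 t) + (s : R) *: 'e_j.
Proof.
apply/rowP => i; rewrite !mxE !tnth_mktuple eqxx andTb.
have [->|ij] := eqVneq i j; first by rewrite !unlift_none mulr1 add0r.
rewrite mulr0 addr0; case: unliftP => // ijE.
by rewrite ijE eqxx in ij.
Qed.

Lemma ball_rowP n (x y : 'rV[R]_n) (e : R) : 0 < e ->
  ball x e y <-> forall i, `|x 0 i - y 0 i| < e.
Proof.
move=> e0; split=> [[_ xy] i|xy]; first exact: xy.
by split=> // i j; rewrite ord1; exact: xy.
Qed.

Lemma measurable_row_ball n (x : 'rV[R]_n) (e : R) :
  measurable (@row_of n @^-1` ball x e).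
Proof.
have [e0|e0] := leP e 0.
  rewrite (_ : _ @^-1` _ = set0)//; apply/seteqP; split => // z /=.
  by case=> /lt_geF; rewrite e0.
rewrite (_ : _ @^-1` _ = \bigcap_(i in [set: 'I_n])
  ((@tnth n RT ^~ i) @^-1` ball (x 0 i : R) e)); last first.
  apply/seteqP; split => z /=.
    by move=> /(ball_rowP _ _ e0) h i _; have := h i; rewrite mxE.
  by move=> h; apply/ball_rowP => // i; rewrite mxE; exact: (h i).
apply: fin_bigcap_measurable => [|i _]; first exact: finite_finset.
rewrite -[X in measurable X]setTI; apply: measurable_tnth => //.
exact: measurable_ball.
Qed.

Definition rat_row n (q : 'rV[rat]_n) : 'rV[R]_n := map_mx (ratr : rat -> R) q.

Lemma rat_row_approx n (x : 'rV[R]_n) (e : R) : 0 < e ->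
  exists q : 'rV[rat]_n, ball x e (rat_row q).
Proof.
move=> e0.
have h i : exists q : rat, `|x 0 i - ratr q| < e.
  have ne : ball (x 0 i : R) e !=set0 by exists (x 0 i); exact: ballxx.
  have [r [Hr [q _ qr]]] := dense_rat ne (ball_open _ _).
  by exists q; rewrite qr.
have [q hq] := choice h.
exists (\row_i q i); apply/ball_rowP => // i.
by rewrite !mxE.
Qed.

(** The product sigma-algebra of tuples is generated by boxes, and an open set of row vectors
    is a countable union of rational boxes. *)
Lemma measurable_row_open n (U : set 'rV[R]_n) : open U ->
  measurable (@row_of n @^-1` U).
Proof.
move=> oU.
pose F (k : nat) : set 'rV[R]_n :=
  if (unpickle k : option ('rV[rat]_n * nat)) is Some p then
    if `[< ball (rat_row p.1) (p.2.+1%:R^-1) `<=` U >]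
    then ball (rat_row p.1) (p.2.+1%:R^-1) else set0
  else set0.
rewrite (_ : U = \bigcup_k F k).
  rewrite preimage_bigcup; apply: bigcupT_measurable => k.
  rewrite /F; case: unpickle => [p|]; last by rewrite preimage_set0.
  case: ifPn => _; last by rewrite preimage_set0.
  exact: measurable_row_ball.
apply/seteqP; split => x; last first.
  move=> [k _]; rewrite /F; case: unpickle => [p|]//.
  by case: ifPn => // /asboolP; exact.
move=> Ux; have /nbhs_ballP[e /= e0 eU] : nbhs x U by exact: open_nbhs_nbhs.
pose m := Num.truncn (2 / e).
have me : m.+1%:R^-1 * 2 < e :> R.
  by rewrite mulrC ltr_pdivrMr// mulrC -ltr_pdivrMr// truncnS_gt.
have m0 : 0 < m.+1%:R^-1 :> R by rewrite invr_gt0.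
have [q hq] := rat_row_approx x m0.
exists (pickle (q, m)) => //; rewrite /F pickleK /=.
rewrite asboolT.
  exact: ball_sym.
move=> y qy; apply: eU; apply: (@le_ball _ _ _ (m.+1%:R^-1 + m.+1%:R^-1)).
  by rewrite (_ : _ + _ = m.+1%:R^-1 * 2) ?ltW// mulrDr mulr1.
exact: ball_triangle qy.
Qed.

Lemma measurable_row_continuous n (U : set 'rV[R]_n) (g : 'rV[R]_n -> R) :
  open U -> (forall x, U x -> {for x, continuous g}) ->
  measurable_fun (@row_of n @^-1` U) (g \o @row_of n).
Proof.
move=> oU cg; apply: (measurability _ (RGenOpens.measurableE R)).
move=> /= _ [_ [a [b ->] <-]].
rewrite [X in measurable X](_ : _ = @row_of n @^-1` (U `&` g @^-1` `]a, b[%classic))//.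
apply: measurable_row_open.
rewrite openE => x [Ux gx]; apply/filterI.
  exact: open_nbhs_nbhs.
apply: cg => //; apply: open_nbhs_nbhs; split => //.
Qed.

End row_measure.

(** * Measure of sets with short slices *)

Section slices.
Context {R : realType}.
Local Notation RT := (measurableTypeR R).
Local Open Scope ereal_scope.

Lemma row_ball_insert n (j : 'I_n.+1) (s : RT) (t : n.-tuple RT) (M : R) :
  ball 0%R M (row_of (insert_tuple j s t)) ->
  ball 0%R M (row_of t) /\ (`|s : R| < M)%R.
Proof.
move=> h; have M0 : (0 < M)%R by case: h.
move/(ball_rowP _ _ M0) : h => h; split.
  apply/ball_rowP => // i; have := h (lift j i).
  by rewrite !mxE tnth_mktuple liftK.
by have := h j; rewrite !mxE tnth_mktuple unlift_none sub0r normrN.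
Qed.

(** Integrate the indicator first along the coordinate j, where it lives in an interval of
    length m, whose position may vary arbitrarily with the line. *)
Lemma slice_measure_le n (j : 'I_n.+1) (A : set (n.+1.-tuple RT)) (M m : R) :
  measurable A -> (0 <= m)%R -> A `<=` @row_of R n.+1 @^-1` ball 0%R M ->
  (forall t, exists a : R, forall s, A (insert_tuple j s t) -> (a <= s <= a + m)%R) ->
  lebesgue_tuple n.+1 A <= m%:E * lebesgue_tuple n (@row_of R n @^-1` ball 0%R M).
Proof.
move=> mA m0 AM hA.
have mball := @measurable_row_ball R n 0%R M.
have -> : lebesgue_tuple n.+1 A = \int[lebesgue_tuple n.+1]_t (\1_A t)%:E.
  by rewrite integral_indic// setIT.
rewrite (tonelli_insert j)//; last first.
  by apply/measurable_EFinP; exact: measurable_indic.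
have -> : lebesgue_tuple n (@row_of R n @^-1` ball 0%R M) =
    \int[lebesgue_tuple n]_t (\1_(@row_of R n @^-1` ball 0%R M) t)%:E.
  by rewrite integral_indic// setIT.
rewrite -ge0_integralZl//; last first.
  by apply/measurable_EFinP; exact: measurable_indic.
apply: ge0_le_integral => //.
- by move=> t _; apply: integral_ge0 => s _; rewrite lee_fin.
- apply: (measurable_fun_fubini_tonelli_F (m2 := lebesgue_measure)
    (fun p => (\1_A (insert_tuple j p.2 p.1))%:E)) => //.
  apply/measurable_EFinP.
  by apply: (measurableT_comp (measurable_indic mA) (measurable_insert_tuple _)).
- apply: measurable_funeM; apply/measurable_EFinP; exact: measurable_indic.
move=> t _.
have mS : measurable ((fun s => insert_tuple j s t) @^-1` A).
  by rewrite -[X in measurable X]setTI; exact: measurable_insert_tuple1.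
rewrite (_ : \int[_]_s _ = lebesgue_measure ((fun s => insert_tuple j s t) @^-1` A)); last first.
  by rewrite -(setIT (_ @^-1` A)) -integral_indic.
have [tM|tM] := pselect (ball 0%R M (row_of t)); last first.
  rewrite (_ : _ @^-1` A = set0) ?measure0 ?mule_ge0 ?lee_fin//.
  by apply/seteqP; split => // s /AM /row_ball_insert[].
rewrite indicE mem_set// mule1.
have [a ha] := hA t.
have mle : lebesgue_measure ((insert_tuple j)^~ t @^-1` A) <=
    lebesgue_measure (`[a, (a + m)%R]%classic : set RT).
  by apply: le_measure; rewrite ?inE//= => s /ha; rewrite /= in_itv.
apply: (le_trans mle).
rewrite lebesgue_measure_itv/= lte_fin ltrDl; case: ifPn => [_|].
  by rewrite -EFinD addrAC subrr add0r.
by rewrite lee_fin.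
Qed.

Lemma lebesgue_tuple_ball n (M : R) :
  lebesgue_tuple n (@row_of R n @^-1` ball 0%R M) < +oo.
Proof.
elim: n => [|n IHn].
  by rewrite /= diracE; case: (_ \in _); rewrite ltry.
have [M0|M0] := ltP 0%R M; last first.
  rewrite (_ : _ @^-1` _ = set0) ?measure0//.
  by apply/seteqP; split => // t; case => /lt_geF; rewrite M0.
apply: le_lt_trans (@slice_measure_le n ord0 _ M (M + M)%R _ _ _ _) _ => //.
- exact: measurable_row_ball.
- by rewrite addr_ge0// ltW.
- move=> t; exists (- M)%R => s /row_ball_insert[_].
  by rewrite ltr_norml addKr => /andP[/ltW -> /ltW].
- by rewrite lte_mul_pinfty// ?lee_fin ?addr_ge0// ltW.
Qed.

End slices.

(** * Compactly supported derivatives have zero integral *)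

Section line_derivative.
Context {R : realType} {V : normedModType R}.

(** Directional derivatives are reduced to derivatives on R, where the mean value theorem and
    the chain rule are available. *)
Lemma is_derive_lineE (H : V -> R) (x v : V) (s l : R) :
  is_derive (x + s *: v) v H l <-> is_derive s 1 (fun s : R => H (x + s *: v)) l.
Proof.
have E : (fun h : R => h^-1 *: ((H \o shift (x + s *: v)) (h *: v) - H (x + s *: v))) =
  (fun h : R => h^-1 *: (((fun s : R => H (x + s *: v)) \o shift s) (h *: 1) - H (x + s *: v))).
  apply/funext => h /=; congr (_ *: (H _ - _)).
  by rewrite scalerDl addrCA [h *: 1]mulr1.
split => -[d e]; split.
- by move: d; rewrite /derivable E.
- by rewrite -e /derive E.
- by move: d; rewrite /derivable E.
- by rewrite -e /derive E.
Qed.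

End line_derivative.

Section compactness.
Context {R : realType}.

Lemma compact_normr_le (T : topologicalType) (K : set T) (g : T -> R) :
  compact K -> {within K, continuous g} ->
  exists2 C, 0 <= C & forall x, K x -> `|g x| <= C.
Proof.
move=> cK cg; have [M [Mr HM]] := compact_bounded (continuous_compact cg cK).
exists (Num.max 0 (M + 1)); first by rewrite le_max lexx.
move=> x Kx; rewrite le_max; apply/orP; right.
by apply: HM; [rewrite ltrDl|exists x].
Qed.

Lemma compact_closed_ball_rV n (x : 'rV[R]_n) (e : R) : 0 < e -> compact (closed_ball x e).
Proof.
move=> e0; apply: bounded_closed_compact; last exact: closed_ball_closed.
exists (`|x| + e); split; first exact: num_real.
move=> r hr y; rewrite closed_ballE// => /= xy.
rewrite (le_trans _ (ltW hr))// -[y in `|y|](subKr x).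
by rewrite (le_trans (ler_normB _ _))// lerD2l.
Qed.

End compactness.

Section whole_space.
Context {R : realType}.
Local Notation RT := (measurableTypeR R).

(** The fundamental theorem of calculus between two points outside the support. *)
Lemma derive_R_integral0 (phi dphi : R -> R) (M : R) : 0 < M ->
  (forall s, is_derive s (1 : R) phi (dphi s)) -> continuous dphi ->
  (forall s, M <= `|s| -> phi s = 0 /\ dphi s = 0) ->
  (lebesgue_measure : {measure set RT -> \bar R}).-integrable setT (EFin \o dphi) /\
  (\int[lebesgue_measure]_s (dphi s)%:E = 0)%E.
Proof.
move=> M0 dphiP cdphi phi0.
have MM : - M < M by rewrite (lt_trans _ M0)// oppr_lt0.
have rphi : (EFin \o dphi) = ((EFin \o dphi) \_ (`[- M, M]%classic : set RT)).
  apply/funext => s; rewrite patchE; case: ifPn => // /negP sM /=.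
  have [_ ->//] : phi s = 0 /\ dphi s = 0.
  apply: phi0; rewrite leNgt; apply/negP => sM'; apply: sM.
  by rewrite inE/= in_itv/= -ler_norml ltW.
have cont := continuous_subspaceT cdphi.
have intM : (lebesgue_measure : {measure set RT -> \bar R}).-integrable `[- M, M] (EFin \o dphi).
  by apply: continuous_compact_integrable => //; exact: segment_compact.
split.
  by rewrite rphi -integrable_mkcond.
rewrite -[X in integral _ _ X]/(EFin \o dphi) rphi -integral_mkcond.
rewrite (continuous_FTC2 MM _ (F := phi)).
- by rewrite (phi0 M _).1 ?(phi0 (- M) _).1 ?normrN ?subee// ger0_norm// ltW.
- exact: cont.
- have cphi : continuous phi.
    move=> s; apply: differentiable_continuous; apply/derivable1_diffP.
    by case: (dphiP s).
  split => //.
  + by apply: cvg_at_right_filter; exact: cphi.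
  + by apply: cvg_at_left_filter; exact: cphi.
- by move=> s _; rewrite derive1E; case: (dphiP s).
Qed.

(** By Tonelli's theorem the positive and negative parts are integrated first along lines in
    direction j, on each of which they have the same integral. *)
Lemma integral_derive_compact n (j : 'I_n.+1) (H h : 'rV[R]_n.+1 -> R) (M : R) :
  0 < M -> (forall x, is_derive x 'e_j H (h x)) -> continuous h ->
  (forall x, ~ ball 0 M x -> H x = 0 /\ h x = 0) ->
  (\int[lebesgue_tuple n.+1]_z (h (row_of z))%:E = 0)%E.
Proof.
move=> M0 dH ch H0.
have mh : measurable_fun [set: n.+1.-tuple RT] (fun z => (h (row_of z))%:E).
  apply/measurable_EFinP.
  have := @measurable_row_continuous R n.+1 setT h openT (fun x _ => ch x).
  by rewrite preimage_setT.
have [C C0 hC] : exists2 C, 0 <= C & forall x, `|h x| <= C * \1_(ball 0 M) x.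
  have [C C0 hC] := compact_normr_le (@compact_closed_ball_rV R n.+1 0 M M0) (continuous_subspaceT ch).
  exists C => // x; rewrite indicE; have [xM|/negP xM] := boolP (x \in _).
    by rewrite mulr1; apply: hC; move: xM; rewrite inE => xM; exact: (subset_closed_ball xM).
  by rewrite (H0 _ _).2 ?normr0 ?mulr0// => xM'; apply: xM; rewrite inE.
have fin (f : n.+1.-tuple RT -> \bar R) : measurable_fun [set: n.+1.-tuple RT] f ->
    (forall z, 0 <= f z <= `|h (row_of z)|%:E)%E ->
    (\int[lebesgue_tuple n.+1]_z f z < +oo)%E.
  move=> mf hf.
  have mb := measurable_row_ball (0 : 'rV[R]_n.+1) M.
  have := lebesgue_tuple_ball n.+1 M => hb.
  apply: (@le_lt_trans _ _ (C%:E * lebesgue_tuple n.+1 (@row_of R n.+1 @^-1` ball 0%R M))%E).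
    have -> : lebesgue_tuple n.+1 (@row_of R n.+1 @^-1` ball 0%R M) =
        (\int[lebesgue_tuple n.+1]_t (\1_(@row_of R n.+1 @^-1` ball 0%R M) t)%:E)%E.
      by rewrite integral_indic// setIT.
    rewrite -ge0_integralZl//; last first.
      by apply/measurable_EFinP; exact: measurable_indic.
    apply: ge0_le_integral => //.
    - by move=> z _; case/andP: (hf z).
    - by apply: measurable_funeM; apply/measurable_EFinP; exact: measurable_indic.
    - move=> z _; case/andP: (hf z) => _ /le_trans; apply.
      by rewrite lee_fin (le_trans (hC _)).
  by rewrite lte_mul_pinfty.
pose f : n.+1.-tuple RT -> \bar R := fun z => (h (row_of z))%:E.
rewrite integralE -[X in integral _ _ (X^\+)%E]/f -[X in integral _ _ (X^\-)%E]/f.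
have mp : measurable_fun [set: n.+1.-tuple RT] (f^\+)%E by apply: measurable_funepos; exact: mh.
have mn : measurable_fun [set: n.+1.-tuple RT] (f^\-)%E by apply: measurable_funeneg; exact: mh.
suff E : (\int[lebesgue_tuple n.+1]_z f^\+ z = \int[lebesgue_tuple n.+1]_z f^\- z)%E.
  rewrite E subee// ge0_fin_numE; last first.
    by apply: integral_ge0 => z _; exact: funeneg_ge0.
  apply: fin => // z; rewrite funeneg_ge0/= /f funenegE /=.
  by rewrite -EFin_max lee_fin ge_max normr_ge0 -normrN ler_norm.
(* Only nonnegative functions can be integrated line by line without integrability. *)
rewrite !(tonelli_insert j)//.
apply: eq_integral => t _.
pose line := fun s : R => H (row_of (insert_tuple j 0 t) + s *: 'e_j).
pose dline := fun s : R => h (row_of (insert_tuple j 0 t) + s *: 'e_j).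
have dlineP s : is_derive s (1 : R) line (dline s).
  exact: ((is_derive_lineE H _ 'e_j s _).1 (dH _)).
have cline : continuous dline.
  move=> s; apply: continuous_comp; last exact: ch.
  by apply: cvgD; [exact: cvg_cst|apply: cvgZl; exact: cvg_id].
have line0 s : M <= `|s| -> line s = 0 /\ dline s = 0.
  move=> Ms; apply: H0; rewrite -row_of_insert => /row_ball_insert[_].
  by rewrite ltNge Ms.
have [il i0] := derive_R_integral0 M0 dlineP cline line0.
have fE (s : RT) : f (insert_tuple j s t) = (dline s)%:E by rewrite /f row_of_insert.
have -> : (\int[lebesgue_measure]_s (f^\+ (insert_tuple j s t)) =
    \int[lebesgue_measure]_s ((EFin \o dline)^\+ s))%E.
  by apply: eq_integral => s _; rewrite !funeposE fE.
have -> : (\int[lebesgue_measure]_s (f^\- (insert_tuple j s t)) =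
    \int[lebesgue_measure]_s ((EFin \o dline)^\- s))%E.
  by apply: eq_integral => s _; rewrite !funenegE fE.
have fp := integrable_pos_fin_num measurableT il.
have fn := integrable_neg_fin_num measurableT il.
move: i0; rewrite integralE => /eqP; rewrite sube_eq// ?add0e; first by move/eqP.
Qed.

End whole_space.

(** * Integrals of bounded continuous functions *)

Section bounded_continuous.
Context {R : realType} {n : nat}.
Implicit Types (Omega : set 'rV[R]_n) (g h : 'rV[R]_n -> R).

(** The class of integrands used throughout: on a bounded open set it is stable under the
    algebraic operations and integrable, so that no further integrability condition appears. *)
Definition bounded_continuous Omega g :=
  (forall x, Omega x -> {for x, continuous g}) /\
  exists2 C, 0 <= C & forall x, Omega x -> `|g x| <= C.

Lemma bounded_continuous_cst Omega (c : R) : bounded_continuous Omega (fun=> c).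
Proof. by split=> [x _|]; [exact: cst_continuous|exists `|c|]. Qed.

Lemma bounded_continuousD Omega g h : bounded_continuous Omega g ->
  bounded_continuous Omega h -> bounded_continuous Omega (fun x => g x + h x).
Proof.
move=> [cg [C C0 gC]] [ch [D D0 hD]]; split=> [x Ox|].
  exact: (cvgD (cg _ Ox) (ch _ Ox)).
exists (C + D); first exact: addr_ge0.
by move=> x Ox; rewrite (le_trans (ler_normD _ _))// lerD ?gC ?hD.
Qed.

Lemma bounded_continuousM Omega g h : bounded_continuous Omega g ->
  bounded_continuous Omega h -> bounded_continuous Omega (fun x => g x * h x).
Proof.
move=> [cg [C C0 gC]] [ch [D D0 hD]]; split=> [x Ox|].
  exact: (cvgM (cg _ Ox) (ch _ Ox)).
exists (C * D); first exact: mulr_ge0.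
by move=> x Ox; rewrite normrM ler_pM ?gC ?hD.
Qed.

Lemma bounded_continuousZ Omega (c : R) g : bounded_continuous Omega g ->
  bounded_continuous Omega (fun x => c * g x).
Proof. by move=> ?; apply: bounded_continuousM => //; exact: bounded_continuous_cst. Qed.

Lemma bounded_continuousN Omega g : bounded_continuous Omega g ->
  bounded_continuous Omega (fun x => - g x).
Proof.
move=> /(bounded_continuousZ (-1)); congr bounded_continuous.
by apply/funext => x; rewrite mulN1r.
Qed.

Lemma bounded_continuousB Omega g h : bounded_continuous Omega g ->
  bounded_continuous Omega h -> bounded_continuous Omega (fun x => g x - h x).
Proof. by move=> ? ?; apply: bounded_continuousD => //; exact: bounded_continuousN. Qed.

Lemma bounded_continuous_sum Omega I (r : seq I) (P : pred I) (g : I -> 'rV[R]_n -> R) :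
  (forall i, P i -> bounded_continuous Omega (g i)) ->
  bounded_continuous Omega (fun x => \sum_(i <- r | P i) g i x).
Proof.
move=> bg; elim: r => [|i r IHr].
  by under eq_fun do rewrite big_nil; exact: bounded_continuous_cst.
have [Pi|/negbTE Pi] := boolP (P i).
  by under eq_fun do rewrite big_cons Pi; apply: bounded_continuousD => //; exact: bg.
by under eq_fun do rewrite big_cons Pi.
Qed.

Lemma eq_bounded_continuous Omega g h : open Omega -> (forall x, Omega x -> g x = h x) ->
  bounded_continuous Omega g -> bounded_continuous Omega h.
Proof.
move=> oO gh [cg [C C0 gC]]; split=> [x Ox|]; last first.
  by exists C => // x Ox; rewrite -gh// gC.
rewrite /prop_for /continuous_at -(gh _ Ox); have gxh : {near x, g =1 h}.
  by apply: (filterS gh); exact: open_nbhs_nbhs.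
exact: cvg_trans (near_eq_cvg gxh) (cg _ Ox).
Qed.

End bounded_continuous.

Section integral_on.
Context {R : realType} {n : nat}.
Local Notation RT := (measurableTypeR R).
Implicit Types (Omega : set 'rV[R]_n) (g h : 'rV[R]_n -> R).

Definition volume Omega : R := fine (lebesgue_tuple n (@row_of R n @^-1` Omega)).

Definition integral_on Omega g : R :=
  \int[lebesgue_tuple n]_(z in @row_of R n @^-1` Omega) g (row_of z).

Lemma bounded_set_ball Omega : bounded_set Omega ->
  exists2 M : R, 0 < M & Omega `<=` ball 0 M.
Proof.
move=> [M [Mr HM]]; exists (Num.max 0 (M + 1) + 1).
  by rewrite ltr_pwDr// le_max lexx.
move=> x Ox; rewrite mx_norm_ball /ball_ /= sub0r normrN.
rewrite (@le_lt_trans _ _ (M + 1))//; first by apply: HM => //; rewrite ltrDl.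
by rewrite (@le_lt_trans _ _ (Num.max 0 (M + 1)))// ?ltrDl// le_max lexx orbT.
Qed.

Lemma volume_lty Omega : open Omega -> bounded_set Omega ->
  (lebesgue_tuple n (@row_of R n @^-1` Omega) < +oo)%E.
Proof.
move=> oO /bounded_set_ball[M M0 OM].
apply: le_lt_trans (lebesgue_tuple_ball n M).
apply: le_measure; rewrite ?inE.
- exact: measurable_row_open.
- exact: measurable_row_ball.
- by move=> z /OM.
Qed.

Lemma volumeE Omega : open Omega -> bounded_set Omega ->
  ((volume Omega)%:E = lebesgue_tuple n (@row_of R n @^-1` Omega))%E.
Proof. by move=> oO bO; rewrite fineK// ge0_fin_numE// volume_lty. Qed.

Lemma volume_ge0 Omega : 0 <= volume Omega.
Proof. exact: fine_ge0. Qed.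

Lemma integrable_bounded_continuous Omega g : open Omega -> bounded_set Omega ->
  bounded_continuous Omega g ->
  (lebesgue_tuple n).-integrable (@row_of R n @^-1` Omega) (EFin \o (g \o @row_of R n)).
Proof.
move=> oO bO [cg [C C0 gC]].
apply: measurable_bounded_integrable.
- exact: measurable_row_open.
- exact: volume_lty.
- exact: measurable_row_continuous.
- by exists C; split; [exact: num_real|move=> r Cr z Oz /=; rewrite (le_trans (gC _ Oz))// ltW].
Qed.

Section bounded_open.
Variables (Omega : set 'rV[R]_n) (oO : open Omega) (bO : bounded_set Omega).

Let mO : measurable (@row_of R n @^-1` Omega) := measurable_row_open oO.

Lemma integral_onD g h : bounded_continuous Omega g -> bounded_continuous Omega h ->
  integral_on Omega (fun x => g x + h x) = integral_on Omega g + integral_on Omega h.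
Proof. by move=> bg bh; rewrite /integral_on -RintegralD//; exact: integrable_bounded_continuous. Qed.

Lemma integral_onZ (c : R) g : bounded_continuous Omega g ->
  integral_on Omega (fun x => c * g x) = c * integral_on Omega g.
Proof. by move=> bg; rewrite /integral_on -RintegralZl//; exact: integrable_bounded_continuous. Qed.

Lemma eq_integral_on g h : (forall x, Omega x -> g x = h x) ->
  integral_on Omega g = integral_on Omega h.
Proof. by move=> gh; apply: eq_Rintegral => z; rewrite inE => /gh. Qed.

Lemma integral_on_cst (c : R) : integral_on Omega (fun=> c) = c * volume Omega.
Proof. by rewrite /integral_on Rintegral_cst. Qed.

Lemma le_integral_on g h : bounded_continuous Omega g -> bounded_continuous Omega h ->
  (forall x, Omega x -> g x <= h x) -> integral_on Omega g <= integral_on Omega h.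
Proof.
move=> bg bh gh; apply: le_Rintegral => //.
- exact: integrable_bounded_continuous.
- exact: integrable_bounded_continuous.
- by move=> z /gh.
Qed.

Lemma integral_onN g : bounded_continuous Omega g ->
  integral_on Omega (fun x => - g x) = - integral_on Omega g.
Proof.
move=> bg; rewrite -mulN1r -integral_onZ//.
by apply: eq_integral_on => x _; rewrite mulN1r.
Qed.

Lemma integral_onB g h : bounded_continuous Omega g -> bounded_continuous Omega h ->
  integral_on Omega (fun x => g x - h x) = integral_on Omega g - integral_on Omega h.
Proof.
by move=> bg bh; rewrite integral_onD ?integral_onN//; exact: bounded_continuousN.
Qed.

Lemma integral_on_sum I (r : seq I) (g : I -> 'rV[R]_n -> R) :
  (forall i, bounded_continuous Omega (g i)) ->
  integral_on Omega (fun x => \sum_(i <- r) g i x) = \sum_(i <- r) integral_on Omega (g i).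
Proof.
move=> bg; elim: r => [|i r IHr].
  rewrite big_nil (_ : (fun _ => _) = fun=> 0) ?integral_on_cst ?mul0r//.
  by apply/funext => x; rewrite big_nil.
rewrite big_cons -IHr -integral_onD//; last exact: bounded_continuous_sum.
by congr integral_on; apply/funext => x; rewrite big_cons.
Qed.

(** Separates a small exceptional set A, on which only a crude bound C is known, from the rest of
    the domain, where the integrand is below e. *)
Lemma norm_integral_on_le A g (C e : R) : open A -> A `<=` Omega -> 0 <= C -> 0 <= e ->
  bounded_continuous Omega g ->
  (forall x, A x -> `|g x| <= C) -> (forall x, Omega x -> ~ A x -> `|g x| <= e) ->
  `|integral_on Omega g| <= C * volume A + e * volume Omega.
Proof.
move=> oA AO C0 e0 bg gC ge.
have mA : measurable (@row_of R n @^-1` A) by exact: measurable_row_open.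
have ig := integrable_bounded_continuous oO bO bg.
apply: (le_trans (le_normr_Rintegral mO ig)).
have mg := measurable_row_continuous oO bg.1.
rewrite -lee_fin /Rintegral fineK; last first.
  rewrite ge0_fin_numE; last by apply: integral_ge0 => z _; rewrite lee_fin.
  by move/integrableP : ig => [_].
rewrite EFinD !EFinM !volumeE//.
have -> : lebesgue_tuple n (@row_of R n @^-1` A) =
    (\int[lebesgue_tuple n]_(z in @row_of R n @^-1` Omega) (\1_(@row_of R n @^-1` A) z)%:E)%E.
  rewrite integral_indic//; congr (lebesgue_tuple n _); apply/seteqP; split => z /=.
    by move=> Az; split => //; exact: AO.
  by case.
have mi : measurable_fun (@row_of R n @^-1` Omega) (fun z => (\1_(@row_of R n @^-1` A) z)%:E : \bar R).
  apply/measurable_EFinP; apply: measurable_funTS; exact: measurable_indic.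
rewrite -integral_cst// -ge0_integralZl//.
rewrite -ge0_integralD//.
- apply: ge0_le_integral => //.
  + apply/measurable_EFinP.
    exact: (measurableT_comp (@normr_measurable R setT)).
  + apply: emeasurable_funD; last exact: measurable_cst.
    exact: measurable_funeM.
  + move=> z Oz; rewrite -EFinM -EFinD lee_fin indicE.
    have [zA|/negP zA] := boolP (_ \in _).
      by rewrite mulr1 ler_wpDr// gC//; move: zA; rewrite inE.
    by rewrite mulr0 add0r ge// => zA'; apply: zA; rewrite inE.
- by move=> z _; rewrite mule_ge0// lee_fin.
- exact: measurable_funeM.
by move: bO => [M [Mr HM]]; exists M; split=> // r Mr' x /AO; exact: HM.
Qed.

End bounded_open.
End integral_on.

(** * Gradients and the chain rule along curves *)

Section scalar_derivative.
Context {R : realType}.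
Implicit Types (phi : R -> R) (s l : R).

Lemma is_derive_quotP phi s l : is_derive s (1 : R) phi l <->
  (fun h : R => h^-1 * (phi (s + h) - phi s)) @ 0^' --> l.
Proof.
have E : (fun h : R => h^-1 *: ((phi \o shift s) (h *: 1) - phi s)) =
  (fun h : R => h^-1 * (phi (s + h) - phi s)).
  by apply/funext => h /=; rewrite [h *: 1]mulr1 [h + s]addrC.
split=> [[d <-]|c].
  by rewrite /derive E; move: d; rewrite /derivable E.
split; first by rewrite /derivable E; apply/cvg_ex; exists l.
by rewrite /derive E; exact: cvg_lim.
Qed.

Lemma dnbhs0_neq0 : \forall h \near (0 : R)^', h != 0.
Proof. exact: nbhs_dnbhs_neq. Qed.

Lemma is_derive_continuous phi s l : is_derive s (1 : R) phi l -> {for s, continuous phi}.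
Proof. by case=> d _; apply: differentiable_continuous; apply/derivable1_diffP. Qed.

Lemma mean_value0 phi (dphi : R -> R) (b : R) :
  (forall s, `|s| <= `|b| -> is_derive s (1 : R) phi (dphi s)) ->
  exists2 c, `|c| <= `|b| & phi b - phi 0 = dphi c * b.
Proof.
move=> dP.
have cphi s : `|s| <= `|b| -> {for s, continuous phi} by move/dP; exact: is_derive_continuous.
have [b0|b0|->] := ltgtP b 0; last by exists 0; rewrite ?normr0// subrr mulr0.
- have [||c] := @MVT R phi dphi b 0 b0.
  + move=> s; rewrite in_itv/= => /andP[bs s0]; apply: dP.
    by rewrite !ltr0_norm// lerN2 ltW.
  + apply: derivable_within_continuous => s; rewrite in_itv/= => /andP[bs s0].
    by have [] := dP s; rewrite // !ler0_norm ?lerN2// ltW.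
  + rewrite in_itv/= => /andP[bc c0] e; exists c; first by rewrite !ltr0_norm// lerN2 ltW.
    by apply/eqP; rewrite -eqr_opp opprB e sub0r mulrN.
- have [||c] := @MVT R phi dphi 0 b b0.
  + move=> s; rewrite in_itv/= => /andP[bs s0]; apply: dP.
    by rewrite !gtr0_norm// ltW.
  + apply: derivable_within_continuous => s; rewrite in_itv/= => /andP[bs s0].
    by have [] := dP s; rewrite // !ger0_norm// ltW.
  + rewrite in_itv/= => /andP[bc c0] e; exists c; first by rewrite !gtr0_norm// ltW.
    by rewrite e subr0.
Qed.

Lemma cvg_sum_real T (F : set_system T) {FF : Filter F} I (r : seq I)
    (f : I -> T -> R) (l : I -> R) : (forall i, f i @ F --> l i) ->
  (fun x => \sum_(i <- r) f i x) @ F --> \sum_(i <- r) l i.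
Proof.
move=> fl; elim: r => [|i r IHr].
  by rewrite big_nil; under eq_fun do rewrite big_nil; exact: cvg_cst.
by rewrite big_cons; under eq_fun do rewrite big_cons; exact: cvgD.
Qed.

End scalar_derivative.

Section gradient.
Context {R : realType} {n : nat}.
Implicit Types (g : 'rV[R]_n -> R) (x v : 'rV[R]_n).

Lemma rV_norm_le v (e : R) : 0 <= e -> (forall i, `|v 0 i| <= e) -> `|v| <= e.
Proof.
move=> e0 ve; rewrite [leLHS]mx_normrE; apply: (big_ind (fun z => z <= e)) => //.
- by move=> a b ? ?; rewrite ge_max; apply/andP.
- by move=> [i j] _ /=; rewrite ord1.
Qed.

Lemma rV_coord_le v i : `|v 0 i| <= `|v|.
Proof.
rewrite [leRHS]mx_normrE; exact: (@le_bigmax _ _ _ 0 (fun ij : 'I_1 * 'I_n => `|v ij.1 ij.2|) (0, i)).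
Qed.

(** Differentiability at x, with the differential given by its coordinates. *)
Definition has_gradient g x (G : 'I_n -> R) :=
  forall e : R, 0 < e -> \forall v \near (0 : 'rV[R]_n),
    `|g (x + v) - g x - \sum_j v 0 j * G j| <= e * `|v|.

(** The increment along v is split into steps along the coordinate axes; the mean value theorem
    applies to each step, and the partial derivatives vary by at most e / (n + 1) near x. *)
Lemma has_gradient_C1 (U : set 'rV[R]_n) g (dg : 'I_n -> 'rV[R]_n -> R) x :
  open U -> U x -> (forall y j, U y -> is_derive y 'e_j g (dg j y)) ->
  (forall j, {for x, continuous (dg j)}) ->
  has_gradient g x (fun j => dg j x).
Proof.
move=> oU Ux dP cdg e e0.
have e'0 : 0 < e / n.+1%:R by rewrite divr_gt0.
have near1 j : \forall y \near x, `|dg j y - dg j x| <= e / n.+1%:R.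
  have /cvgrPdist_le /(_ _ e'0) := cdg j.
  by apply: filterS => y; rewrite distrC.
have : \forall y \near x, U y /\ forall j, `|dg j y - dg j x| <= e / n.+1%:R.
  apply: filterI; first exact: open_nbhs_nbhs.
  exact: (filter_forall _ near1).
move=> /nbhs_ballP[r /= r0 Hr].
near=> v.
have vr : `|v| < r.
  near: v; have := @nbhsx_ballx R 'rV[R]_n 0 r r0.
  by apply: filterS => v; rewrite mx_norm_ball /ball_ /= sub0r normrN.
(* p k keeps the first k coordinates of v; the path runs through p 0, p 1, up to p n = v. *)
pose p (k : nat) : 'rV[R]_n := \row_i (if (i < k)%N then v 0 i else 0).
have pS (k : 'I_n) : p k.+1 = p k + v 0 k *: 'e_k.
  apply/rowP => i; rewrite !mxE eqxx andTb ltnS.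
  have [->|ik] := eqVneq i k; first by rewrite leqnn ltnn mulr1 add0r.
  by rewrite mulr0 addr0 leq_eqVlt val_eqE (negbTE ik).
have near_p (k : 'I_n) s : `|s| <= `|v 0 k| -> ball x r (x + p k + s *: 'e_k).
  move=> sv; rewrite mx_norm_ball /ball_ /= -addrA opprD addNKr normrN.
  apply: le_lt_trans vr; apply: rV_norm_le => // i; rewrite !mxE eqxx andTb.
  have [->|ik] := eqVneq i k.
    by rewrite ltnn add0r mulr1 (le_trans sv)// rV_coord_le.
  rewrite mulr0 addr0; case: ifPn => _; [exact: rV_coord_le|by rewrite normr0].
have step (k : 'I_n) : `|g (x + p k.+1) - g (x + p k) - v 0 k * dg k x| <= e / n.+1%:R * `|v|.
  have [s sv] := @mean_value0 R (fun s => g (x + p k + s *: 'e_k))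
    (fun s => dg k (x + p k + s *: 'e_k)) (v 0 k)
    (fun s sv => (is_derive_lineE g _ _ s _).1 (dP _ _ (Hr _ (near_p k s sv)).1)).
  rewrite scale0r addr0 -addrA -pS => ->.
  rewrite [v 0 k * _]mulrC -mulrBl normrM ler_pM//; last exact: rV_coord_le.
  by have [_] := Hr _ (near_p k s sv); apply.
have tele : g (x + v) - g x = \sum_(k < n) (g (x + p k.+1) - g (x + p k)).
  rewrite -(big_mkord xpredT (fun k => g (x + p k.+1) - g (x + p k))) telescope_sumr//.
  congr (g _ - g _).
    by congr (x + _); apply/rowP => i; rewrite !mxE ltn_ord.
  by rewrite -[LHS]addr0; congr (x + _); apply/rowP => i; rewrite !mxE.
rewrite tele -sumrB (le_trans (ler_norm_sum _ _ _))//.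
apply: (le_trans (ler_sum _ (fun k _ => step k))).
rewrite sumr_const card_ord -[_ *+ n]mulr_natr.
have -> : e / n.+1%:R * `|v| * n%:R = e * `|v| * (n%:R / n.+1%:R).
  by rewrite -!mulrA; congr (_ * _); rewrite mulrC mulrA.
by rewrite ler_piMr ?mulr_ge0// ?ltW// ltr_pdivrMr ?mul1r// ltr_nat.
Unshelve. all: by end_near. Qed.

(** Chain rule along a curve known only through its coordinates: the remainder in the expansion
    of g is o(|c (s + h) - c s|), and the increment of c is O(|h|). *)
Lemma is_derive_curve g x G (c : R -> 'rV[R]_n) (dc : 'I_n -> R) (s : R) :
  has_gradient g x G -> c s = x ->
  (forall i, is_derive s (1 : R) (fun s => c s 0 i) (dc i)) ->
  is_derive s (1 : R) (g \o c) (\sum_i dc i * G i).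
Proof.
move=> gG csx dcP; apply/is_derive_quotP.
pose B : R := \sum_i (`|dc i| + 1).
have B0 : 0 <= B by apply: sumr_ge0 => i _; rewrite addr_ge0.
have BB : B / (B + 1) <= 1 by rewrite ler_pdivrMr ?ltr_wpDl// mul1r lerDl.
have cv i : (fun h => h^-1 * (c (s + h) 0 i - c s 0 i)) @ 0^' --> dc i by apply/is_derive_quotP.
have main : (fun h => \sum_i (h^-1 * (c (s + h) 0 i - c s 0 i)) * G i) @ 0^' --> \sum_i dc i * G i.
  by apply: cvg_sum_real => i; apply: cvgMr_tmp; exact: cv.
suff err : (fun h => h^-1 * (g (c (s + h)) - g (c s)) -
    \sum_i (h^-1 * (c (s + h) 0 i - c s 0 i)) * G i) @ 0^' --> (0 : R).
  rewrite -[X in _ --> X]add0r.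
  rewrite (_ : (fun _ => _) = (fun h => (h^-1 * (g (c (s + h)) - g (c s)) -
    \sum_i (h^-1 * (c (s + h) 0 i - c s 0 i)) * G i) + \sum_i (h^-1 * (c (s + h) 0 i - c s 0 i)) * G i)).
    exact: cvgD.
  by apply/funext => h; rewrite subrK.
have bnd : \forall h \near 0^', `|c (s + h) - c s| <= B * `|h|.
  have near1 i : \forall h \near 0^', `|dc i - h^-1 * (c (s + h) 0 i - c s 0 i)| <= 1.
    by have /cvgrPdist_le := cv i; apply.
  have near2 : \forall h \near 0^', forall i, `|dc i - h^-1 * (c (s + h) 0 i - c s 0 i)| <= 1.
    exact: (filter_forall _ near1).
  move: near2 (@dnbhs0_neq0 R); apply: filterS2 => h H h0.
  apply: rV_norm_le => [|i]; first by rewrite mulr_ge0.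
  have hE : c (s + h) 0 i - c s 0 i = h * (h^-1 * (c (s + h) 0 i - c s 0 i)) by rewrite mulVKf.
  rewrite !mxE hE normrM mulrC ler_wpM2r//.
  apply: (@le_trans _ _ (`|dc i| + 1)).
    by rewrite -lerBlDl (le_trans _ (H i))// (le_trans (lerB_dist _ _))// distrC.
  by rewrite /B (bigD1 i)//= lerDl; apply: sumr_ge0 => k _; rewrite addr_ge0.
have small : (fun h => c (s + h) - c s) @ 0^' --> (0 : 'rV[R]_n).
  apply/cvgr0Pnorm_le => e e0; near=> h.
  have H : `|c (s + h) - c s| <= B * `|h| by near: h.
  have h1 : `|h| <= e / (B + 1) by near: h; apply: dnbhs0_le; rewrite divr_gt0// ltr_wpDl.
  apply: (le_trans H); apply: (le_trans (ler_wpM2l B0 h1)).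
  by rewrite mulrCA ler_piMr// ltW.
apply/cvgr0Pnorm_le => e e0.
have e'0 : 0 < e / (B + 1) by rewrite divr_gt0// ltr_wpDl.
have exp : \forall h \near 0^', `|g (c (s + h)) - g (c s) -
    \sum_j (c (s + h) - c s) 0 j * G j| <= e / (B + 1) * `|c (s + h) - c s|.
  have H0 : (0 : R)^' ((fun h => c (s + h) - c s) @^-1` _) := small _ (gG _ e'0).
  apply: filterS H0 => h /=; rewrite -csx subrKC; exact.
move: exp bnd (@dnbhs0_neq0 R).
apply: filterS3 => h H Hb h0.
have -> : h^-1 * (g (c (s + h)) - g (c s)) - \sum_i h^-1 * (c (s + h) 0 i - c s 0 i) * G i =
  h^-1 * (g (c (s + h)) - g (c s) - \sum_j (c (s + h) - c s) 0 j * G j).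
  rewrite [RHS]mulrBr; congr (_ - _); rewrite mulr_sumr; apply: eq_bigr => i _.
  by rewrite !mxE mulrA.
rewrite normrM normfV mulrC ler_pdivrMr ?normr_gt0//.
apply: (le_trans H); apply: (le_trans (ler_wpM2l (ltW e'0) Hb)).
by rewrite mulrA ler_wpM2r// mulrAC -mulrA ler_piMr// ltW.
Unshelve. all: by end_near. Qed.

Lemma has_gradient_dir g x G v :
  has_gradient g x G -> is_derive x v g (\sum_i v 0 i * G i).
Proof.
move=> gG; rewrite -[x in is_derive x](addr0 x) -(scale0r v); apply/is_derive_lineE.
apply: (is_derive_curve (c := fun s : R => x + s *: v) gG); first by rewrite scale0r addr0.
move=> i; apply/is_derive_quotP.
rewrite (_ : (fun _ => _) = fun h : R => h^-1 * (h * v 0 i)); last first.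
  by apply/funext => h; rewrite !mxE mul0r addr0 add0r addrAC subrr add0r.
apply: (@cvg_trans _ (v 0 i @[_ --> 0^'])); last exact: cvg_cst.
apply: near_eq_cvg; move: (@dnbhs0_neq0 R); apply: filterS => h h0.
by rewrite mulKf.
Qed.

End gradient.

(** * Pointwise derivatives, cutoff functions, compactness *)

Section pointwise_derivatives.
Context {R : realType} {V : normedModType R}.
Implicit Types (f g : V -> R) (x v : V).

Lemma is_deriveD_fun f g x v df dg : is_derive x v f df -> is_derive x v g dg ->
  is_derive x v (fun y => f y + g y) (df + dg).
Proof. by move=> fP gP; exact: is_deriveD. Qed.

Lemma is_deriveM_fun f g x v df dg : is_derive x v f df -> is_derive x v g dg ->
  is_derive x v (fun y => f y * g y) (df * g x + f x * dg).
Proof.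
move=> fP gP; have := is_deriveM fP gP; congr is_derive.
by rewrite addrC; congr (_ + _); rewrite mulrC.
Qed.

Lemma is_deriveZ_fun f x v (c df : R) : is_derive x v f df ->
  is_derive x v (fun y => c * f y) (c * df).
Proof. by move=> fP; exact: is_deriveZ. Qed.

Lemma is_deriveB_fun f g x v df dg : is_derive x v f df -> is_derive x v g dg ->
  is_derive x v (fun y => f y - g y) (df - dg).
Proof. by move=> fP gP; exact: is_deriveB. Qed.

Lemma is_derive_sum_fun I (r : seq I) (f : I -> V -> R) x v (df : I -> R) :
  (forall i, is_derive x v (f i) (df i)) ->
  is_derive x v (fun y => \sum_(i <- r) f i y) (\sum_(i <- r) df i).
Proof.
move=> fP; elim: r => [|i r IHr].
  rewrite big_nil (_ : (fun _ => _) = cst 0); first exact: is_derive_cst.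
  by apply/funext => y; rewrite big_nil.
rewrite big_cons (_ : (fun _ => _) = fun y => f i y + \sum_(j <- r) f j y).
  exact: is_deriveD_fun.
by apply/funext => y; rewrite big_cons.
Qed.

Lemma is_derive_comp_real (phi : R -> R) f x v df l :
  is_derive (f x) (1 : R) phi l -> is_derive x v f df ->
  is_derive x v (fun y => phi (f y)) (df * l).
Proof.
move=> phiP fP.
have x0 : x = x + (0 : R) *: v by rewrite scale0r addr0.
rewrite [x in is_derive x]x0; apply: (is_derive_lineE (phi \o f) x v 0 _).2.
have {fP} : is_derive 0 (1 : R) (fun s : R => f (x + s *: v)) df.
  by apply: (is_derive_lineE f x v 0 _).1; rewrite -x0.
rewrite [x in f x]x0 in phiP.
case: phiP => dphi <-; case => df' <-.
split; first by apply/derivable1_diffP/(@differentiable_comp _ _ _ _ (fun s : R => f (x + s *: v)) phi); apply/derivable1_diffP.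
rewrite -derive1E (@derive1_comp _ (fun s : R => f (x + s *: v)) phi)//.
by rewrite !derive1E mulrC.
Qed.

End pointwise_derivatives.

Section cutoff.
Context {R : realType}.

Definition pos_sqr (s : R) : R := Num.max s 0 ^+ 2.

Lemma pos_sqr_expand (s h : R) :
  `|pos_sqr (s + h) - pos_sqr s - 2 * Num.max s 0 * h| <= h ^+ 2.
Proof.
rewrite /pos_sqr ler_norml.
have [s0|s0] := leP s 0; have [sh|sh] := leP (s + h) 0; apply/andP; split; nra.
Qed.

Lemma is_derive_pos_sqr (s : R) : is_derive s (1 : R) pos_sqr (2 * Num.max s 0).
Proof.
apply/is_derive_quotP/cvgrPdist_le => e e0.
have near1 : \forall h \near (0 : R)^', `|h| <= e by exact: dnbhs0_le.
move: near1 (@dnbhs0_neq0 R); apply: filterS2 => h he h0.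
apply: le_trans he; rewrite distrC.
have -> : h^-1 * (pos_sqr (s + h) - pos_sqr s) - 2 * Num.max s 0 =
    h^-1 * (pos_sqr (s + h) - pos_sqr s - 2 * Num.max s 0 * h).
  by rewrite [RHS]mulrBr [h^-1 * (_ * h)]mulrC mulfK.
rewrite normrM normfV mulrC ler_pdivrMr ?normr_gt0//.
by rewrite (le_trans (pos_sqr_expand _ _))// -normrM -expr2 ger0_norm ?sqr_ge0.
Qed.

(** A C^1 step from 0 to 1 with derivative at most 2: it is obtained by integrating twice the
    piecewise constant function equal to 4 on ]0, 1/2[ and to -4 on ]1/2, 1[. *)
Definition smoothstep (s : R) : R :=
  2 * pos_sqr s - 4 * pos_sqr (s - 2^-1) + 2 * pos_sqr (s - 1).

Definition dsmoothstep (s : R) : R :=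
  4 * Num.max s 0 - 8 * Num.max (s - 2^-1) 0 + 4 * Num.max (s - 1) 0.

Lemma smoothstep0 (s : R) : s <= 0 -> smoothstep s = 0.
Proof.
by move=> s0; rewrite /smoothstep /pos_sqr !max_r ?expr0n ?mulr0 ?subr0 ?addr0//; lra.
Qed.

Lemma smoothstep1 (s : R) : 1 <= s -> smoothstep s = 1.
Proof. by move=> s1; rewrite /smoothstep /pos_sqr !max_l; [field|lra..]. Qed.

Lemma dsmoothstep0 (s : R) : s <= 0 -> dsmoothstep s = 0.
Proof. by move=> s0; rewrite /dsmoothstep !max_r ?mulr0 ?subr0 ?addr0//; lra. Qed.

Lemma dsmoothstep1 (s : R) : 1 <= s -> dsmoothstep s = 0.
Proof. by move=> s1; rewrite /dsmoothstep !max_l; [field|lra..]. Qed.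

Lemma smoothstep_le1 (s : R) : `|smoothstep s| <= 1.
Proof.
rewrite /smoothstep /pos_sqr ler_norml.
have [s0|s0] := leP s 0; have [s1|s1] := leP (s - 2^-1) 0;
  have [s2|s2] := leP (s - 1) 0; apply/andP; split; nra.
Qed.

Lemma dsmoothstep_le2 (s : R) : `|dsmoothstep s| <= 2.
Proof.
rewrite /dsmoothstep ler_norml.
have [s0|s0] := leP s 0; have [s1|s1] := leP (s - 2^-1) 0;
  have [s2|s2] := leP (s - 1) 0; apply/andP; split; nra.
Qed.

Lemma is_derive_smoothstep (s : R) : is_derive s (1 : R) smoothstep (dsmoothstep s).
Proof.
have d c : is_derive s (1 : R) (fun s => pos_sqr (s - c)) (2 * Num.max (s - c) 0).
  rewrite -[2 * _]mul1r; apply: is_derive_comp_real; first exact: is_derive_pos_sqr.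
  have := is_deriveB_fun (is_derive_id s (1 : R)) (is_derive_cst c s (1 : R)).
  by rewrite subr0.
have -> : dsmoothstep s = 2 * (2 * Num.max s 0) - 4 * (2 * Num.max (s - 2^-1) 0) +
  2 * (2 * Num.max (s - 1) 0) by rewrite /dsmoothstep; ring.
exact: (is_deriveD_fun (is_deriveB_fun (is_deriveZ_fun 2 (is_derive_pos_sqr s))
  (is_deriveZ_fun _ (d _))) (is_deriveZ_fun _ (d _))).
Qed.

Lemma continuous_dsmoothstep : continuous dsmoothstep.
Proof.
have cmax (c : R) : continuous (fun s : R => Num.max (s - c) 0).
  move=> s; apply: (@continuous_max _ _ (fun s : R => s - c) (cst 0)); last exact: cst_continuous.
  by apply: cvgB; [exact: cvg_id|exact: cvg_cst].
have c0 : continuous (fun s : R => Num.max s 0).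
  by have := cmax 0; under eq_fun do rewrite subr0.
by move=> s; apply: cvgD; [apply: cvgB|]; apply: cvgMl_tmp; [exact: c0|exact: cmax|exact: cmax].
Qed.

End cutoff.

Section compact_vanishing.
Context {R : realType}.

(** The function |g| + max (th - |f|) 0 is positive on K, hence it has a positive minimum, which
    serves as e. *)
Lemma compact_vanish (T : topologicalType) (K : set T) (f g : T -> R) :
  compact K -> {within K, continuous f} -> {within K, continuous g} ->
  (forall x, K x -> g x = 0 -> f x = 0) ->
  forall th : R, 0 < th -> exists2 e : R, 0 < e &
    forall x, K x -> `|g x| < e -> `|f x| < th.
Proof.
move=> cK cf cg fg th th0.
have [K0|/set0P/negP/negPn/eqP K0] := pselect (K !=set0); last first.
  by exists 1 => // x; rewrite K0.
pose m x := `|g x| + Num.max (th - `|f x|) 0.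
have cm : {within K, continuous m}.
  move=> x; apply: cvgD; first by apply: cvg_norm; exact: cg.
  apply: (@continuous_max _ (subspace K) (fun x => th - `|f x|) (cst 0)); last exact: cst_continuous.
  by apply: cvgB; [exact: cvg_cst|apply: cvg_norm; exact: cf].
have [c Kc cmin] := compact_EVT_min K0 cK cm.
have mc : 0 < m c.
  rewrite inE in Kc; rewrite /m lt_neqAle addr_ge0 ?le_max ?lexx ?orbT// andbT eq_sym.
  rewrite paddr_eq0 ?le_max ?lexx ?orbT// normr_eq0; apply/negP => /andP[/eqP gc].
  by rewrite (fg c Kc gc) normr0 subr0 max_l ?ltW// gt_eqF.
exists (m c) => // x Kx gx.
have := cmin x; rewrite inE => /(_ Kx) mx.
rewrite ltNge; apply/negP => thf.
have : m x < m c by rewrite /m max_r ?addr0// subr_le0.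
by rewrite ltNge mx.
Qed.

Lemma closure_compact n (Omega : set 'rV[R]_n) : bounded_set Omega -> compact (closure Omega).
Proof.
move=> /bounded_set_ball[M M0 OM].
apply: (@subclosed_compact _ _ (closed_ball 0 M)); first exact: closed_closure.
  exact: compact_closed_ball_rV.
exact: closure_subset.
Qed.

End compact_vanishing.

(** * Derivatives of functions vanishing near the complement of the domain *)

Section divergence.
Context {R : realType} {n : nat}.
Variables (Omega : set 'rV[R]_n.+1) (oO : open Omega) (bO : bounded_set Omega).

Lemma near_Omega x : Omega x -> \forall y \near x, Omega y.
Proof. by move=> Ox; exact: open_nbhs_nbhs. Qed.

(** Extended by 0, Phi is differentiable on the whole space with compact support: near a point
    outside the domain the extension is identically 0, so it has no jump. *)
Lemma integral_on_derive0 (j : 'I_n.+1) (Phi phi : 'rV[R]_n.+1 -> R) :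
  (forall x, Omega x -> is_derive x 'e_j Phi (phi x)) ->
  (forall x, Omega x -> {for x, continuous phi}) ->
  (forall x, ~ Omega x -> \forall y \near x, Omega y -> Phi y = 0) ->
  integral_on Omega phi = 0.
Proof.
move=> dPhi cphi Phi0.
pose H x := if `[< Omega x >] then Phi x else 0.
pose h x := if `[< Omega x >] then phi x else 0.
have [M M0 OM] := bounded_set_ball bO.
have nOH x : ~ Omega x -> \forall y \near x, H y = 0.
  move=> /Phi0; apply: filterS => y Hy; rewrite /H.
  by case: asboolP => // /Hy.
(* A neighbourhood of x may meet the domain: there phi is the derivative of a function that is
   locally 0. *)
have nOh x : ~ Omega x -> \forall y \near x, h y = 0.
  move=> /nOH /near_join; apply: filterS => y Hy; rewrite /h.
  case: asboolP => // Oy.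
  have dy : is_derive y 'e_j H (phi y).
    apply: near_eq_is_derive (dPhi _ Oy).
    by apply: filterS (near_Omega Oy) => z Oz; rewrite /H asboolT.
  have d0 : is_derive y 'e_j H 0.
    apply: near_eq_is_derive (is_derive_cst 0 y 'e_j).
    by apply: filterS Hy => z ->.
  by case: dy => _ <-; case: d0.
have dH x : is_derive x 'e_j H (h x).
  rewrite /h; case: asboolP => Ox.
    apply: near_eq_is_derive (dPhi _ Ox).
    by apply: filterS (near_Omega Ox) => z Oz; rewrite /H asboolT.
  apply: near_eq_is_derive (is_derive_cst 0 x 'e_j).
  by apply: filterS (nOH _ Ox) => z ->.
have ch : continuous h.
  move=> x; have [Ox|Ox] := pselect (Omega x).
    have e : {near x, phi =1 h}.
      by apply: filterS (near_Omega Ox) => z Oz; rewrite /h asboolT.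
    have hx : h x = phi x by rewrite /h asboolT.
    rewrite /continuous_at hx.
    exact: cvg_trans (near_eq_cvg e) (cphi _ Ox).
  have e : {near x, cst 0 =1 h} by apply: filterS (nOh _ Ox) => z ->.
  have hx : h x = 0 by rewrite /h asboolF.
  rewrite /continuous_at hx.
  exact: cvg_trans (near_eq_cvg e) (cvg_cst _).
have H0 x : ~ ball 0 M x -> H x = 0 /\ h x = 0.
  by move=> Bx; rewrite /H /h asboolF// => /OM.
have := integral_derive_compact M0 dH ch H0.
rewrite /integral_on /Rintegral integral_mkcond => I0.
transitivity (fine (\int[lebesgue_tuple n.+1]_z (h (row_of z))%:E)%E); last by rewrite I0.
congr fine; apply: eq_integral => z _.
rewrite patchE /h; case: asboolP => Oz; first by rewrite mem_set.
by rewrite memNset.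
Qed.

End divergence.

(** * Fields without normal flux *)

Section no_flux_fields.
Context {R : realType} {n : nat}.
Implicit Types (Omega : set 'rV[R]_n) (g : 'rV[R]_n -> R).

Lemma within_closure_at Omega g x : open Omega -> {within closure Omega, continuous g} ->
  Omega x -> {for x, continuous g}.
Proof.
move=> oO cg Ox.
have cO := continuous_subspaceW (@subset_closure _ Omega) cg.
move: cO; rewrite continuous_open_subspace// => cO.
by apply: cO; rewrite inE.
Qed.

Lemma bounded_continuous_closure Omega g : open Omega -> bounded_set Omega ->
  {within closure Omega, continuous g} -> bounded_continuous Omega g.
Proof.
move=> oO bO cg; split=> [x Ox|]; first exact: within_closure_at cg Ox.
have [C C0 gC] := compact_normr_le (closure_compact bO) cg.
by exists C => // x Ox; apply: gC; exact: subset_closure.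
Qed.

(** Tangency to the boundary replaces the boundary integral in the divergence theorem, so that no
    surface measure has to be defined. dF j is the j-th term of the divergence. *)
Record no_flux Omega (F dF : 'I_n -> 'rV[R]_n -> R) : Prop := NoFlux {
  no_flux_derive : forall j x, Omega x -> is_derive x 'e_j (F j) (dF j x) ;
  no_flux_div : forall j, bounded_continuous Omega (dF j) ;
  no_flux_continuous : forall j, {within closure Omega, continuous (F j)} ;
  no_flux_normal : forall x nu, outer_unit_normal Omega x nu ->
    \sum_j F j x * nu 0 j = 0 }.

Record C1_fun (psi : 'rV[R]_n -> R) (dpsi : 'I_n -> 'rV[R]_n -> R) : Prop := C1Fun {
  C1_fun_derive : forall j x, is_derive x 'e_j psi (dpsi j x) ;
  C1_fun_continuous : continuous psi ;
  C1_fun_dcontinuous : forall j, continuous (dpsi j) }.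

(** The multipliers that preserve the absence of flux. *)
Record C1_on Omega (psi : 'rV[R]_n -> R) (dpsi : 'I_n -> 'rV[R]_n -> R) : Prop := C1On {
  C1_on_derive : forall j x, Omega x -> is_derive x 'e_j psi (dpsi j x) ;
  C1_on_continuous : {within closure Omega, continuous psi} ;
  C1_on_dbounded : forall j, bounded_continuous Omega (dpsi j) }.

Lemma C1_fun_on Omega psi dpsi : open Omega -> bounded_set Omega ->
  C1_fun psi dpsi -> C1_on Omega psi dpsi.
Proof.
move=> oO bO [dP cp cdp]; split => //.
- exact: continuous_subspaceT.
- by move=> j; apply: bounded_continuous_closure => //; exact: continuous_subspaceT.
Qed.

(** The normal component of psi F is psi times that of F, so a scalar multiple stays tangent. *)
Lemma no_fluxM Omega F dF psi dpsi : open Omega -> bounded_set Omega ->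
  no_flux Omega F dF -> C1_on Omega psi dpsi ->
  no_flux Omega (fun j x => psi x * F j x)
    (fun j x => dpsi j x * F j x + psi x * dF j x).
Proof.
move=> oO bO [dFP bF cF nF] [dpP cp bdp]; split.
- by move=> j x Ox; apply: is_deriveM_fun => //; [exact: dpP|exact: dFP].
- move=> j; apply: bounded_continuousD; apply: bounded_continuousM => //.
  + exact: bounded_continuous_closure.
  + exact: bounded_continuous_closure.
- by move=> j x; apply: cvgM; [exact: cp|exact: cF].
- move=> x nu xnu; under eq_bigr do rewrite -mulrA.
  by rewrite -mulr_sumr (nF _ _ xnu) mulr0.
Qed.

Lemma no_flux_sum Omega I (r : seq I) (F dF : I -> 'I_n -> 'rV[R]_n -> R) :
  (forall i, no_flux Omega (F i) (dF i)) ->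
  no_flux Omega (fun j x => \sum_(i <- r) F i j x) (fun j x => \sum_(i <- r) dF i j x).
Proof.
move=> H; split.
- by move=> j x Ox; apply: is_derive_sum_fun => i; exact: no_flux_derive (H i) j x Ox.
- by move=> j; apply: bounded_continuous_sum => i _; exact: no_flux_div (H i) j.
- move=> j x; apply: cvg_sum_real => i; exact: (no_flux_continuous (H i) (j := j)).
- move=> x nu xnu; under eq_bigr do rewrite mulr_suml.
  rewrite exchange_big/=; apply: big1 => i _; exact: no_flux_normal (H i) x nu xnu.
Qed.

Lemma is_derive_coord (x : 'rV[R]_n) i j :
  is_derive x 'e_j (fun y => y 0 i) ((i == j)%:R : R).
Proof.
have x0 : x = x + (0 : R) *: 'e_j by rewrite scale0r addr0.
rewrite [x in is_derive x]x0. apply: (is_derive_lineE (fun y : 'rV[R]_n => y 0 i : R) x 'e_j 0 _).2.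
have := is_deriveD_fun (is_derive_cst (x 0 i) (0 : R) (1 : R))
  (is_deriveZ_fun ((i == j)%:R) (is_derive_id (0 : R) (1 : R))).
rewrite mulr1 add0r; congr is_derive; apply/funext => s.
by rewrite !mxE mulrC.
Qed.

(** The squared Euclidean distance is used because it is a polynomial, unlike the sup norm. *)
Definition dist2 (c x : 'rV[R]_n) : R := \sum_i (x 0 i - c 0 i) ^+ 2.

(** Equal to 1 for |x - c| <= r and to 0 for |x - c| >= sqrt 2 r, in Euclidean distance. *)
Definition plateau (c : 'rV[R]_n) (r : R) (x : 'rV[R]_n) : R :=
  smoothstep (2 - r ^- 2 * dist2 c x).

Definition dplateau (c : 'rV[R]_n) (r : R) (j : 'I_n) (x : 'rV[R]_n) : R :=
  - (r ^- 2 * (2 * (x 0 j - c 0 j))) * dsmoothstep (2 - r ^- 2 * dist2 c x).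

Lemma is_derive_dist2 c x j : is_derive x 'e_j (dist2 c) (2 * (x 0 j - c 0 j)).
Proof.
rewrite (_ : 2 * _ = \sum_i (2 * (x 0 i - c 0 i)) * (i == j)%:R); last first.
  rewrite (bigD1 j)//= eqxx mulr1 big1 ?addr0// => i /negbTE ->.
  by rewrite mulr0.
rewrite /dist2; apply: is_derive_sum_fun => i.
have dB := is_deriveB_fun (is_derive_coord x i j) (is_derive_cst (c 0 i) x 'e_j).
have := is_deriveM_fun dB dB; rewrite subr0.
have -> : (i == j)%:R * (x 0 i - c 0 i) + (x 0 i - c 0 i) * (i == j)%:R =
  2 * (x 0 i - c 0 i) * (i == j)%:R by ring.
exact.
Qed.

Lemma continuous_dist2 c : continuous (dist2 c).
Proof.
move=> x; apply: (@cvg_sum_real R _ (nbhs x) _ _ _ (fun i (y : 'rV[R]_n) => (y 0 i - c 0 i) ^+ 2)) => i.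
have h : (fun y : 'rV[R]_n => y 0 i - c 0 i) @ x --> x 0 i - c 0 i.
  exact: (cvgB (@coord_continuous R _ _ 0 _ x) (cvg_cst _)).
exact: (cvgM h h).
Qed.

Lemma C1_plateau c r : C1_fun (plateau c r) (dplateau c r).
Proof.
have carg : continuous (fun x => 2 - r ^- 2 * dist2 c x).
  move=> x; exact: (cvgB (cvg_cst _) (cvgM (cvg_cst _) (@continuous_dist2 c x))).
split.
- move=> j x; apply: is_derive_comp_real; first exact: is_derive_smoothstep.
  have := is_deriveB_fun (is_derive_cst (2 : R) x 'e_j)
    (is_deriveZ_fun (r ^- 2) (is_derive_dist2 c x j)).
  by rewrite sub0r.
- move=> x; apply: (continuous_comp (carg x)).
  exact: is_derive_continuous (is_derive_smoothstep _).
- move=> j x.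
  have cds := continuous_comp (carg x) (@continuous_dsmoothstep R _).
  have cj : {for x, continuous (fun y : 'rV[R]_n => y 0 j - c 0 j)}.
    exact: (cvgB (@coord_continuous R _ _ 0 _ x) (cvg_cst _)).
  have c2 : {for x, continuous (fun y : 'rV[R]_n => - (r ^- 2 * (2 * (y 0 j - c 0 j))))}.
    exact: (cvgN (cvgM (cvg_cst _) (cvgM (cvg_cst _) cj))).
  exact: (cvgM c2 cds).
Qed.

Lemma plateau_eq1 c r : 0 < r -> \forall x \near c, plateau c r x = 1.
Proof.
move=> r0.
have near1 : \forall x \near c, dist2 c x < r ^+ 2.
  have d0 : dist2 c c = 0 by apply: big1 => i _; rewrite subrr expr0n.
  have := @continuous_dist2 c c; rewrite /continuous_at d0 => /cvgr_lt; apply.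
  exact: exprn_gt0.
apply: filterS near1 => x xr; apply: smoothstep1.
have : r ^- 2 * dist2 c x <= 1 by rewrite mulrC ler_pdivrMr ?exprn_gt0// mul1r ltW.
by lra.
Qed.

Lemma plateau_eq0 c r x : 0 < r -> ~ ball c (2 * r) x ->
  plateau c r x = 0 /\ forall j, dplateau c r j x = 0.
Proof.
move=> r0 xc.
have h : 2 - r ^- 2 * dist2 c x <= 0.
  have [i hi] : exists i, 2 * r <= `|c 0 i - x 0 i|.
    apply/not_existsP => H; apply: xc; apply/ball_rowP; first by rewrite mulr_gt0.
    by move=> i; rewrite ltNge; apply/negP; exact: H.
  have : (2 * r) ^+ 2 <= dist2 c x.
    rewrite /dist2 (bigD1 i)//= ler_wpDr ?sumr_ge0//; first by move=> k _; exact: sqr_ge0.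
    by rewrite -[leRHS]real_normK ?num_real// distrC ler_pXn2r ?nnegrE// mulr_ge0// ltW.
  move=> hd; rewrite subr_le0 mulrC ler_pdivlMr ?exprn_gt0//; apply: le_trans hd.
  by rewrite exprMn ler_wpM2r ?sqr_ge0//; lra.
split; first exact: smoothstep0.
by move=> j; rewrite /dplateau dsmoothstep0// mulr0.
Qed.

Lemma plateau_le1 c r x : `|plateau c r x| <= 1.
Proof. exact: smoothstep_le1. Qed.

End no_flux_fields.

(** * Localization of the divergence theorem *)

(** An e-independent quantity bounded by every multiple e B is nonpositive. *)
Lemma ler_all_pos {R : realType} (a B : R) : 0 <= B ->
  (forall e, 0 < e -> a <= e * B) -> a <= 0.
Proof.
move=> B0 H; rewrite leNgt; apply/negP => a0.
have e0 : 0 < a / (B + 1) / 2 by rewrite !divr_gt0// ltr_wpDl.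
have := H _ e0; rewrite leNgt => /negP; apply.
rewrite mulrAC ltr_pdivrMr// mulrAC ltr_pdivrMr ?ltr_wpDl//.
nra.
Qed.

Section local_green.
Context {R : realType} {n : nat}.
Variables (Omega : set 'rV[R]_n.+1) (oO : open Omega) (bO : bounded_set Omega).

Lemma plateau_near0 (c : 'rV[R]_n.+1) r x : 0 < r -> ~ ball c (3 * r) x ->
  \forall y \near x, plateau c r y = 0 /\ forall j, dplateau c r j y = 0.
Proof.
move=> r0 xc; apply: filterS (nbhsx_ballx x r r0) => y xy.
apply: plateau_eq0 => // yc; apply: xc.
have -> : 3 * r = 2 * r + r by ring.
exact: ball_triangle yc (ball_sym xy).
Qed.

(** A field localized by a plateau supported inside the domain vanishes near the complement, so
    each of its partial derivatives has integral 0. *)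
Lemma interior_green x0 : Omega x0 -> exists2 r : R, 0 < r &
  forall F dF, no_flux Omega F dF ->
  integral_on Omega (fun x => \sum_j (dplateau x0 r j x * F j x + plateau x0 r x * dF j x)) = 0.
Proof.
move=> Ox0; have /nbhs_ballP[s /= s0 sO] := near_Omega oO Ox0.
exists (s / 3); first by rewrite divr_gt0.
have r0 : 0 < s / 3 by rewrite divr_gt0.
move=> F dF HF.
have HG := no_fluxM oO bO HF (C1_fun_on oO bO (C1_plateau x0 (s / 3))).
rewrite (integral_on_sum oO bO) => [|j]; last exact: no_flux_div HG j.
apply: big1 => j _; apply: (integral_on_derive0 oO bO (j := j) (no_flux_derive HG j)).
  exact: (no_flux_div HG j).1.
move=> x Ox; have : ~ ball x0 (3 * (s / 3)) x.
  by rewrite mulrC divfK// => /sO.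
by move=> /(plateau_near0 r0); apply: filterS => y [-> _] _; rewrite mul0r.
Qed.

Section boundary.
Variables (U : set 'rV[R]_n.+1) (rho : 'rV[R]_n.+1 -> R) (x0 : 'rV[R]_n.+1).
Hypothesis Urho : local_defining_function Omega U rho x0.
Let D j := 'D_('e_j) rho.

Let oU : open U. Proof. by case: Urho. Qed.

Lemma defining_is_derive x j : U x -> is_derive x 'e_j rho (D j x).
Proof.
move=> Ux; case: Urho => _ _ /(_ 1%N) [_ /(_ j) [dr _]] _ _.
by have := dr x Ux => /derivableP.
Qed.

Lemma defining_continuous x : U x -> {for x, continuous rho}.
Proof. by move=> Ux; case: Urho => _ _ /(_ 0%N) /(_ _ Ux). Qed.

Lemma defining_dcontinuous j x : U x -> {for x, continuous (D j)}.
Proof. by move=> Ux; case: Urho => _ _ /(_ 1%N) [_ /(_ j) [_ /(_ _ Ux)]]. Qed.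

(** A nonzero gradient has a coordinate that stays away from 0 in a neighbourhood; the lines in
    this direction cross the boundary transversally. *)
Lemma defining_slope : exists j0, exists2 c : R, 0 < c &
  \forall y \near x0, U y /\ c <= `|D j0 y|.
Proof.
case: Urho => _ Ux0 _ /(_ _ Ux0) gn0 _.
have [j0 Dj0] : exists j, D j x0 != 0.
  apply/not_existsP => H; move/negP : gn0; apply; apply/eqP/rowP => j; rewrite !mxE.
  by apply/eqP/negPn/negP; exact: H.
exists j0, (`|D j0 x0| / 2); first by rewrite divr_gt0// normr_gt0.
apply: filterI; first exact: open_nbhs_nbhs.
have cD : (fun y => `|D j0 y|) @ x0 --> `|D j0 x0|.
  exact: (cvg_norm (defining_dcontinuous (j := j0) Ux0)).
move/cvgr_ge : cD; apply.
by rewrite ltr_pdivrMr// ltr_pMr ?normr_gt0// ltr1n.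
Qed.

(** Along a line in direction j0 the defining function has slope at least c, so the line spends a
    length at most 4 e / c in the strip - 2 e < rho < 0. *)
Lemma strip_volume_le j0 (c r : R) : 0 < c -> 0 < r ->
  (forall y, ball x0 (10 * r) y -> U y /\ c <= `|D j0 y|) ->
  exists2 C2 : R, 0 <= C2 & forall A (e : R), open A -> 0 < e ->
    (forall x, A x -> [/\ Omega x, ball x0 (3 * r) x & - (2 * e) < rho x]) ->
    volume A <= C2 * e.
Proof.
move=> c0 r0 H.
have [M M0 OM] := bounded_set_ball bO.
pose m := lebesgue_tuple n (@row_of R n @^-1` ball 0 M).
have mfin : m \is a fin_num by rewrite ge0_fin_numE; [exact: lebesgue_tuple_ball|exact: measure_ge0].
exists (4 / c * fine m); first by rewrite mulr_ge0 ?fine_ge0 ?measure_ge0 ?divr_ge0 ?ltW.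
move=> A e oA e0 HA.
have e4 : 0 <= 4 * e / c by rewrite divr_ge0 ?mulr_ge0 ?ltW.
have AM : @row_of R n.+1 @^-1` A `<=` @row_of R n.+1 @^-1` ball 0 M.
  by move=> z /HA[/OM].
have bA : bounded_set A.
  by move: bO => [N [Nr HN]]; exists N; split=> // s Ns x /HA[Ox _ _]; exact: HN Ox.
rewrite -lee_fin volumeE//.
have -> : (4 / c * fine m * e)%:E = ((4 * e / c)%:E * m)%E.
  by rewrite -{2}(fineK mfin) -EFinM; congr EFin; ring.
apply: (slice_measure_le (j := j0)) => //; first exact: measurable_row_open.
move=> t; set p := row_of (insert_tuple j0 0 t).
have [[s0 As0]|nA] := pselect (exists s, A (p + s *: 'e_j0)); last first.
  by exists 0 => s; rewrite /preimage/= row_of_insert => As; exfalso; apply: nA; exists s.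
exists (s0 - 2 * e / c) => s; rewrite /preimage/= row_of_insert -/p => As.
suff : `|s - s0| <= 2 * e / c.
  rewrite ler_norml => /andP[h1 h2].
  have -> : 4 * e / c = 2 * e / c + 2 * e / c by field; rewrite gt_eqF.
  by apply/andP; split; lra.
have [Os0 Bs0 rs0] := HA _ As0; have [Os Bs rs] := HA _ As.
have r3 : 0 < 3 * r by rewrite mulr_gt0.
have ss0 : `|s - s0| < 6 * r.
  move/(ball_rowP _ _ r3)/(_ j0) : Bs0; move/(ball_rowP _ _ r3)/(_ j0) : Bs.
  rewrite !mxE !eqxx !mulr1 !ltr_norml => /andP[? ?] /andP[? ?].
  by apply/andP; split; lra.
(* The whole segment between two points of the slice stays in the larger ball, so the slope bound
   holds along it even outside the domain. *)
have inb s' : `|s'| <= `|s - s0| -> ball x0 (10 * r) (p + s0 *: 'e_j0 + s' *: 'e_j0).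
  move=> hs'; have -> : 10 * r = 3 * r + 7 * r by ring.
  apply: ball_triangle Bs0 _; rewrite mx_norm_ball /ball_ /= opprD addNKr normrN.
  apply: (@le_lt_trans _ _ `|s'|); last by nra.
  apply: rV_norm_le => // i; rewrite !mxE eqxx /= normrM.
  by case: (i == j0); rewrite ?normr1 ?mulr1// normr0 mulr0.
have [xi hxi] := @mean_value0 R (fun s' => rho (p + s0 *: 'e_j0 + s' *: 'e_j0))
    (fun s' => D j0 (p + s0 *: 'e_j0 + s' *: 'e_j0)) (s - s0)
    (fun s' hs' => (is_derive_lineE rho _ _ s' _).1
      (defining_is_derive j0 (H _ (inb _ hs')).1)).
rewrite scale0r addr0 -addrA -scalerDl subrKC => /(congr1 Num.norm).
rewrite normrM => E.
have [_ cD] := H _ (inb _ hxi).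
have UB y : ball x0 (3 * r) y -> U y.
  by move=> yb; apply: (H y _).1; apply: le_ball yb; nra.
have rlt x : Omega x -> U x -> rho x < 0 by move=> ? ?; case: Urho => _ _ _ _ /(_ x) <-.
have r1 := rlt _ Os0 (UB _ Bs0); have r2 := rlt _ Os (UB _ Bs).
have E2 : `|rho (p + s *: 'e_j0) - rho (p + s0 *: 'e_j0)| <= 2 * e.
  by rewrite ler_norml; apply/andP; split; lra.
rewrite ler_pdivlMr// mulrC; apply: le_trans E2; rewrite E.
by rewrite ler_wpM2r.
Qed.

End boundary.
End local_green.

(** * The divergence theorem near a boundary point *)

Section boundary_green.
Context {R : realType} {n : nat}.
Variables (Omega : set 'rV[R]_n.+1) (oO : open Omega) (bO : bounded_set Omega).
Variables (U : set 'rV[R]_n.+1) (rho : 'rV[R]_n.+1 -> R) (x0 : 'rV[R]_n.+1).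
Hypothesis Urho : local_defining_function Omega U rho x0.
Let D j := 'D_('e_j) rho.

Lemma enorm_gt0 m (v : 'rV[R]_m) : v != 0 -> 0 < enorm v.
Proof.
move=> v0; rewrite /enorm sqrtr_gt0 lt_neqAle sumr_ge0 ?andbT; last first.
  by move=> i _; exact: sqr_ge0.
rewrite eq_sym psumr_eq0; last by move=> i _; exact: sqr_ge0.
apply: contra v0 => /allP H; apply/eqP/rowP => i; rewrite mxE.
by have := H i (mem_index_enum _); rewrite sqrf_eq0 => /eqP.
Qed.

(** On the boundary the gradient of rho is a positive multiple of the outer normal. *)
Lemma defining_flux0 F dF x : no_flux Omega F dF -> U x -> closure Omega x ->
  rho x = 0 -> \sum_j D j x * F j x = 0.
Proof.
move=> HF Ux cOx rx.
have [oU _ sr gn0 UO] := Urho.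
have nOx : ~ Omega x by move=> /(UO x Ux).1; rewrite rx ltxx.
have Bx : boundary Omega x by split=> // /interior_subset.
have g0 := enorm_gt0 (gn0 _ Ux).
have nuP : outer_unit_normal Omega x ((enorm (gradient rho x))^-1 *: gradient rho x).
  by split => //; exists U, rho; split=> //; split.
have := no_flux_normal HF nuP.
have -> : \sum_j F j x * ((enorm (gradient rho x))^-1 *: gradient rho x) 0 j =
  (enorm (gradient rho x))^-1 * \sum_j D j x * F j x.
  by rewrite mulr_sumr; apply: eq_bigr => j _; rewrite !mxE mulrCA -/(D j x) [F j x * _]mulrC.
by move=> /eqP; rewrite mulf_eq0 invr_eq0 gt_eqF//= => /eqP.
Qed.

Variables (r : R) (r0 : 0 < r).
Hypothesis (BU : forall y, ball x0 (10 * r) y -> U y).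
Variable C2 : R.
Hypothesis (C20 : 0 <= C2).
Hypothesis (volC2 : forall A (e : R), open A -> 0 < e ->
    (forall x, A x -> [/\ Omega x, ball x0 (3 * r) x & - (2 * e) < rho x]) ->
    volume A <= C2 * e).

Let K := closure Omega `&` closed_ball x0 (3 * r).

Let KU x : K x -> U x.
Proof.
case=> _; rewrite closed_ballE ?mulr_gt0//= => xr; apply: BU.
by rewrite mx_norm_ball /ball_ /= (le_lt_trans xr)// ltr_pM2r// ltr_nat.
Qed.

Let cK : compact K.
Proof.
apply: (@subclosed_compact _ _ (closure Omega)).
- by apply: closedI; [exact: closed_closure|exact: closed_ball_closed].
- exact: closure_compact.
- by move=> x [].
Qed.

Let cKin (g : 'rV[R]_n.+1 -> R) : (forall x, U x -> {for x, continuous g}) ->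
  {within K, continuous g}.
Proof. by move=> cg; apply: continuous_in_subspaceT => x; rewrite inE => /KU /cg. Qed.

Section field.
Variables (F dF : 'I_n.+1 -> 'rV[R]_n.+1 -> R) (HF : no_flux Omega F dF).

Let G j x := plateau x0 r x * F j x.
Let dG j x := dplateau x0 r j x * F j x + plateau x0 r x * dF j x.

Let HG : no_flux Omega G dG.
Proof. exact: (no_fluxM oO bO HF (C1_fun_on oO bO (C1_plateau x0 r))). Qed.

Let cutoff (e : R) x := smoothstep (- e^-1 * rho x - 1).
Let dcutoff (e : R) x := dsmoothstep (- e^-1 * rho x - 1).
Let phi (e : R) j x := (- e^-1 * D j x) * dcutoff e x * G j x + cutoff e x * dG j x.

Let is_derive_cutoff (e : R) j x : U x ->
  is_derive x 'e_j (cutoff e) (- e^-1 * D j x * dcutoff e x).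
Proof.
move=> Ux; apply: is_derive_comp_real; first exact: is_derive_smoothstep.
have := is_deriveB_fun (is_deriveZ_fun (- e^-1) (defining_is_derive Urho j Ux))
  (is_derive_cst (1 : R) x 'e_j).
by rewrite subr0.
Qed.

Let cut_cont (e : R) x : U x -> {for x, continuous (cutoff e)} /\ {for x, continuous (dcutoff e)}.
Proof.
move=> Ux.
have carg : {for x, continuous (fun y => - e^-1 * rho y - 1)}.
  exact: (cvgB (cvgM (cvg_cst _) (defining_continuous Urho Ux)) (cvg_cst _)).
split; apply: (continuous_comp carg).
  exact: is_derive_continuous (is_derive_smoothstep _).
exact: continuous_dsmoothstep.
Qed.

Let outside x : ~ U x -> \forall y \near x,
  plateau x0 r y = 0 /\ forall j, dplateau x0 r j y = 0.
Proof.
move=> nUx; apply: plateau_near0 => // xb; apply: nUx; apply: BU.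
by apply: le_ball xb; rewrite ler_pM2r// ler_nat.
Qed.

Let phi_out (e : R) j x : plateau x0 r x = 0 /\ (forall j, dplateau x0 r j x = 0) ->
  phi e j x = 0 /\ dG j x = 0.
Proof. by move=> [p0 d0]; rewrite /phi /dG /G p0 d0 !(mul0r, mulr0, addr0). Qed.

Let phi_cont (e : R) j x : Omega x -> {for x, continuous (phi e j)}.
Proof.
move=> Ox; have [Ux|nUx] := pselect (U x).
  have [c1 c2] := cut_cont e Ux.
  have cG := within_closure_at oO (no_flux_continuous HG (j := j)) Ox.
  have cdG := (no_flux_div HG j).1 x Ox.
  have cD := defining_dcontinuous Urho (j := j) Ux.
  exact: (cvgD (cvgM (cvgM (cvgM (cvg_cst _) cD) c2) cG) (cvgM c1 cdG)).
have e1 : {near x, cst 0 =1 phi e j}.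
  by apply: filterS (outside nUx) => y /(@phi_out e j y)[->].
have -> : {for x, continuous (phi e j)} = (phi e j @ x --> phi e j x) by [].
rewrite (@phi_out e j _ (nbhs_singleton (outside nUx))).1.
exact: cvg_trans (near_eq_cvg e1) (cvg_cst _).
Qed.

Let phi_integral0 (e : R) j : 0 < e -> integral_on Omega (phi e j) = 0.
Proof.
move=> e0; apply: (integral_on_derive0 oO bO (j := j) (Phi := fun x => cutoff e x * G j x)).
- move=> x Ox; have [Ux|nUx] := pselect (U x).
    apply: is_deriveM_fun; first exact: is_derive_cutoff.
    exact: no_flux_derive HG j x Ox.
  rewrite (@phi_out e j _ (nbhs_singleton (outside nUx))).1.
  apply: near_eq_is_derive (is_derive_cst 0 x 'e_j).
  by apply: filterS (outside nUx) => y [p0 _]; rewrite /G p0 mul0r mulr0.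
- exact: phi_cont.
- move=> x nOx; have [Ux|nUx] := pselect (U x); last first.
    by apply: filterS (outside nUx) => y [p0 _] _; rewrite /G p0 mul0r mulr0.
  have rx : 0 <= rho x.
    by rewrite leNgt; apply/negP => rx; apply: nOx; case: Urho => _ _ _ _ /(_ x Ux)[_]; apply.
  have near1 : \forall y \near x, - e < rho y.
    have := defining_continuous Urho Ux => /cvgr_gt; apply.
    by rewrite (lt_le_trans _ rx)// oppr_lt0.
  apply: filterS near1 => y ry _; rewrite /cutoff smoothstep0 ?mul0r//.
  rewrite subr_le0 mulNr -mulrN mulrC ler_pdivrMr// mul1r; lra.
Qed.

Let D_bound : exists2 CD : R, 0 <= CD & forall j x, K x -> `|D j x| <= CD.
Proof.
have H j := compact_normr_le cK (cKin (fun x => defining_dcontinuous Urho (j := j) (x := x))).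
have /choice[C HC] : forall j, exists C : R, 0 <= C /\ forall x, K x -> `|D j x| <= C.
  by move=> j; have [C C0 hC] := H j; exists C.
exists (\sum_j C j); first by apply: sumr_ge0 => j _; case: (HC j).
move=> j x Kx; rewrite (bigD1 j)//= ler_wpDr; [by []| |by apply: (HC j).2].
by apply: sumr_ge0 => i _; case: (HC i).
Qed.

Let inK x : Omega x -> ball x0 (3 * r) x -> K x.
Proof. by move=> Ox xb; split; [exact: subset_closure|exact: subset_closed_ball]. Qed.

Let phi_bc (e : R) j : 0 < e -> bounded_continuous Omega (phi e j).
Proof.
move=> e0; split=> [x Ox|]; first exact: phi_cont.
have [CD CD0 HD] := D_bound.
have [_ [CG CG0 HCG]] := bounded_continuous_closure oO bO (no_flux_continuous HG (j := j)).
have [_ [CdG CdG0 HCdG]] := no_flux_div HG j.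
have ei0 : 0 <= e^-1 by rewrite invr_ge0 ltW.
exists (e^-1 * CD * 2 * CG + 1 * CdG); first by rewrite addr_ge0 ?mulr_ge0.
move=> x Ox; have [xb|nxb] := pselect (ball x0 (3 * r) x).
  rewrite (le_trans (ler_normD _ _))// lerD// !normrM.
    rewrite normrN (ger0_norm ei0) !ler_pM ?mulr_ge0//.
    - exact: HD (inK Ox xb).
    - exact: dsmoothstep_le2.
    - rewrite -normrM; exact: HCG.
  by rewrite ler_pM//; [exact: smoothstep_le1|exact: HCdG].
rewrite (@phi_out e j _ (nbhs_singleton (plateau_near0 r0 nxb))).1 normr0.
by rewrite addr_ge0 ?mulr_ge0.
Qed.

(** The field G is multiplied by a cutoff depending on rho / e, which vanishes near the boundary
    and equals 1 outside the strip - 2 e < rho < 0: the divergence of the product has integral 0.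
    The difference with the divergence of G lives in the strip, whose volume is O(e). It consists
    of (1 - cutoff) div G, which is bounded, and of e^-1 (grad rho . G) times a bounded factor,
    where grad rho . G is small in the strip because it vanishes on the boundary. *)
Lemma boundary_green_field :
  integral_on Omega (fun x => \sum_j dG j x) = 0.
Proof.
have bdG : bounded_continuous Omega (fun x => \sum_j dG j x).
  by apply: bounded_continuous_sum => j _; exact: no_flux_div HG j.
have [_ [C1 C10 HC1]] := bdG.
apply/eqP; rewrite -normr_le0.
apply: (@ler_all_pos _ _ (2 * C1 * C2 + 2 * C2)) => [|th th0].
  by rewrite addr_ge0 ?mulr_ge0.
have cN : {within K, continuous (fun x => \sum_j D j x * F j x)}.
  move=> x; apply: cvg_sum_real => j; apply: cvgM.
    exact: (cKin (fun x => defining_dcontinuous Urho (j := j) (x := x))).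
  by apply: (continuous_subspaceW _ (no_flux_continuous HF (j := j))) => y [].
have crho := cKin (defining_continuous Urho).
have [e0 e00 He0] := compact_vanish cK cN crho
  (fun x Kx => defining_flux0 HF (KU Kx) Kx.1) th0.
(* The strip - 2 e < rho < 0 lies where |grad rho . F| < th, and e <= th makes both errors O(th). *)
pose e := Num.min th (e0 / 2).
have e_gt0 : 0 < e by rewrite lt_min th0 divr_gt0.
have ei0 : 0 <= e^-1 by rewrite invr_ge0 ltW.
have th00 := ltW th0.
have e_th : e <= th by rewrite ge_min lexx.
have e_e0 : 2 * e <= e0 by rewrite mulrC -ler_pdivlMr// ge_min lexx orbT.
pose A : set 'rV[R]_n.+1 := [set x | [/\ Omega x, ball x0 (3 * r) x & - (2 * e) < rho x]].
have oA : open A.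
  rewrite openE => x [Ox xb rx]; apply: filterS3 (near_Omega oO Ox) _ _.
  - by move=> y Oy yb ry; split; [exact: Oy|exact: yb|exact: ry].
  - exact: (open_nbhs_nbhs (conj (ball_open x0 (3 * r)) xb)).
  - have := defining_continuous Urho (KU (inK Ox xb)) => /cvgr_gt; exact.
have eqI : integral_on Omega (fun x => \sum_j dG j x) =
    integral_on Omega (fun x => \sum_j (dG j x - phi e j x)).
  under [X in _ = integral_on _ X]eq_fun do rewrite sumrB.
  rewrite (integral_onB oO bO)//; last first.
    by apply: bounded_continuous_sum => j _; exact: phi_bc.
  rewrite (integral_on_sum oO bO _ (g := phi e)); last by move=> j; exact: phi_bc.
  by rewrite [X in _ - X]big1 ?subr0// => j _; exact: phi_integral0.
have bI : bounded_continuous Omega (fun x => \sum_j (dG j x - phi e j x)).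
  apply: bounded_continuous_sum => j _; apply: bounded_continuousB; last exact: phi_bc.
  exact: no_flux_div HG j.
have IE x : \sum_j (dG j x - phi e j x) = (1 - cutoff e x) * \sum_j dG j x +
    e^-1 * dcutoff e x * plateau x0 r x * \sum_j D j x * F j x.
  rewrite !mulr_sumr -big_split/=; apply: eq_bigr => j _.
  by rewrite /phi /G; ring.
rewrite eqI.
have C3 : 0 <= 2 * C1 + 2 * th / e by rewrite addr_ge0 ?mulr_ge0 ?invr_ge0//; exact: ltW.
have AO : A `<=` Omega by move=> x [].
have := norm_integral_on_le oO bO oA AO C3 (lexx 0) bI.
rewrite mul0r addr0 => H; apply: (le_trans (H _ _)).
- move=> x [Ox xb rx]; rewrite IE (le_trans (ler_normD _ _))// lerD//.
    rewrite normrM ler_pM//; last exact: HC1.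
    rewrite (le_trans (ler_normB _ _))// normr1.
    by have := smoothstep_le1 (- e^-1 * rho x - 1); rewrite -/(cutoff e x); lra.
  have Kx := inK Ox xb.
  have rx0 : rho x < 0 by case: Urho => _ _ _ _ /(_ x (KU Kx))[+ _]; exact.
  have hth : `|\sum_j D j x * F j x| <= th.
    by apply/ltW/He0 => //; rewrite ltr0_norm// (lt_le_trans _ e_e0)//; lra.
  rewrite !normrM (ger0_norm ei0).
  have -> : 2 * th / e = e^-1 * 2 * 1 * th by field; rewrite gt_eqF.
  rewrite !ler_pM ?mulr_ge0//.
    exact: dsmoothstep_le2.
  exact: plateau_le1.
- move=> x Ox nA; rewrite normr_le0; apply/eqP.
  have [xb|nxb] := pselect (ball x0 (3 * r) x); last first.
    apply: big1 => j _.
    by have [-> ->] := @phi_out e j x (nbhs_singleton (plateau_near0 r0 nxb)); rewrite subrr.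
  have rx : rho x <= - (2 * e) by rewrite leNgt; apply/negP => rx; apply: nA.
  have s1 : 1 <= - e^-1 * rho x - 1.
    rewrite lerBrDr mulNr -mulrN mulrC ler_pdivlMr//; lra.
  by rewrite IE /cutoff /dcutoff smoothstep1// dsmoothstep1// subrr !(mul0r, mulr0) addr0.
have vA : volume A <= C2 * e by apply: volC2.
apply: (le_trans (ler_wpM2l C3 vA)).
have -> : (2 * C1 + 2 * th / e) * (C2 * e) = 2 * C1 * C2 * e + 2 * C2 * th.
  by field; rewrite gt_eqF.
have : 2 * C1 * C2 * e <= 2 * C1 * C2 * th by rewrite ler_wpM2l ?mulr_ge0.
by lra.
Qed.

End field.
End boundary_green.

(** * The divergence theorem *)

Section green.
Context {R : realType} {n : nat}.
Variables (Omega : set 'rV[R]_n.+1) (oO : open Omega) (bO : bounded_set Omega).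
Hypothesis sO : smooth_boundary Omega.

(** The divergence theorem for fields multiplied by the plateau with centre p.1 and radius p.2. *)
Definition localizable (p : 'rV[R]_n.+1 * R) := forall F dF, no_flux Omega F dF ->
  integral_on Omega (fun x => \sum_j
    (dplateau p.1 p.2 j x * F j x + plateau p.1 p.2 x * dF j x)) = 0.

Lemma closure_localizable x0 : closure Omega x0 -> exists2 r : R, 0 < r & localizable (x0, r).
Proof.
move=> cx0; have [Ox0|nOx0] := pselect (Omega x0).
  exact: interior_green.
have bx0 : boundary Omega x0 by split=> // /interior_subset.
have [U [rho Urho]] := sO bx0.
have [j0 [c c0 near0]] := defining_slope Urho.
have /nbhs_ballP[s /= s0 sU] := near0.
have r0 : 0 < s / 10 by rewrite divr_gt0.
exists (s / 10) => // F dF HF.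
have H y : ball x0 (10 * (s / 10)) y -> U y /\ c <= `|'D_('e_j0) rho y|.
  by rewrite mulrC divfK// => /sU.
have [C2 C20 volC2] := strip_volume_le bO Urho c0 r0 H.
exact: (boundary_green_field oO bO Urho r0 (fun y hy => (H y hy).1) C20 volC2 HF).
Qed.

Lemma C1_onem psi dpsi : C1_fun psi dpsi ->
  @C1_fun R n.+1 (fun x => 1 - psi x) (fun j x => - dpsi j x).
Proof.
move=> [dP cp cdp]; split.
- move=> j x; rewrite -[- _]sub0r.
  exact: (is_deriveB_fun (is_derive_cst (1 : R) x 'e_j) (dP j x)).
- by move=> x; exact: (cvgB (cvg_cst _) (cp x)).
- by move=> j x; exact: (cvgN (cdp j x)).
Qed.

(** Induction on the list of plateaus: the field splits as b F + (1 - b) F, where the first part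
    is localized and the second vanishes near the points where b = 1. When the list is exhausted,
    F vanishes near every point. *)
Lemma green_localized (L : seq ('rV[R]_n.+1 * R)) :
  (forall p, p \in L -> localizable p) ->
  forall F dF, no_flux Omega F dF ->
  (forall x, Omega x -> (exists2 p, p \in L & \forall y \near x, plateau p.1 p.2 y = 1) \/
    \forall y \near x, forall j, F j y = 0) ->
  integral_on Omega (fun x => \sum_j dF j x) = 0.
Proof.
elim: L => [|p L IHL] locL F dF HF cov.
  rewrite -[RHS](mul0r (volume Omega)) -(integral_on_cst oO).
  apply: eq_integral_on => x Ox; apply: big1 => j _.
  have [[p]//|F0] := cov x Ox.
  have d0 : is_derive x 'e_j (F j) 0.
    apply: near_eq_is_derive (is_derive_cst 0 x 'e_j).
    by apply: filterS F0 => y ->.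
  by case: (no_flux_derive HF j Ox) => _ <-; case: d0.
have HbF := no_fluxM oO bO HF (C1_fun_on oO bO (C1_plateau p.1 p.2)).
have HF' := no_fluxM oO bO HF (C1_fun_on oO bO (C1_onem (C1_plateau p.1 p.2))).
have sumbc F1 dF1 : no_flux Omega F1 dF1 -> bounded_continuous Omega (fun x => \sum_j dF1 j x).
  by move=> H1; apply: bounded_continuous_sum => j _; exact: no_flux_div H1 j.
have pL : p \in p :: L by rewrite inE eqxx.
have I1 := locL p pL F dF HF.
have I2 : integral_on Omega (fun x => \sum_j
    (- dplateau p.1 p.2 j x * F j x + (1 - plateau p.1 p.2 x) * dF j x)) = 0.
  apply: (IHL _ _ _ HF') => [q qL|x Ox].
    by apply: locL; rewrite inE qL orbT.
  have [[q]|F0] := cov x Ox; last first.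
    by right; apply: filterS F0 => y Fy j; rewrite Fy mulr0.
  rewrite inE => /orP[/eqP ->|qL] q1; last by left; exists q.
  by right; apply: filterS q1 => y -> j; rewrite subrr mul0r.
have := integral_onD oO bO (sumbc _ _ HbF) (sumbc _ _ HF').
rewrite I1 I2 addr0; apply: etrans.
apply: eq_integral_on => x _; rewrite -big_split/=.
by apply: eq_bigr => j _; ring.
Qed.

(** The compact closure is covered by finitely many plateaus around interior or boundary points,
    which are peeled off one at a time. *)
Theorem green F dF : no_flux Omega F dF ->
  integral_on Omega (fun x => \sum_j dF j x) = 0.
Proof.
move=> HF.
have /choice[r Hr] : forall x, exists r : R, closure Omega x -> 0 < r /\ localizable (x, r).
  move=> x; have [cx|ncx] := pselect (closure Omega x); last by exists 0.
  by have [r r0 lr] := closure_localizable cx; exists r.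
have := closure_compact bO; rewrite compact_cover.
move=> /(_ _ (closure Omega) (fun x => interior [set y | plateau x (r x) y = 1])).
case=> [x _|x cx|D Dsub Dcov].
- exact: open_interior.
- exists x => //; apply: plateau_eq1; exact: (Hr x cx).1.
apply: (green_localized (L := [seq (x, r x) | x <- finmap.enum_fset D])) HF _.
  move=> p /mapP[x xD ->]; apply: (Hr x _).2.
  by have := Dsub x xD; rewrite inE.
move=> x Ox; left; have [y yD xy] := Dcov _ (@subset_closure _ Omega x Ox).
by exists (y, r y) => //; apply/mapP; exists y.
Qed.

End green.

(** * Lipschitz functions with a one-sided derivative bound *)

Section lipschitz_cumulative.
Context {R : realType}.
Local Notation RT := (measurableTypeR R).
Local Notation lam := (lebesgue_measure : {sigma_finite_measure set RT -> \bar R}).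
Variables (F : R -> R) (a b C : R).
Hypotheses (ab : a < b) (C0 : 0 < C).
Hypothesis Fnd : forall x y, x <= y -> 0 <= F y - F x <= C * (y - x).
Hypothesis Fa : forall x, x <= a -> F x = 0.
Hypothesis Fb : forall x, b <= x -> F x = 1.

Let F_nd : nondecreasing F.
Proof. by move=> x y xy; rewrite -subr_ge0; case/andP: (Fnd xy). Qed.

Let F_lip x y : `|F x - F y| <= C * `|x - y|.
Proof.
wlog xy : x y / x <= y => [H|].
  by have [/H//|/ltW/H] := leP x y; rewrite distrC [`|y - x|]distrC.
have /andP[h1 h2] := Fnd xy.
by rewrite distrC [`|x - y|]distrC !ger0_norm ?subr_ge0// -subr_ge0.
Qed.

Let F_cont : continuous F.
Proof.
move=> x; apply/cvgrPdist_le => e e0.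
have e'0 : 0 < e / C by rewrite divr_gt0.
apply: filterS (nbhsx_ballx x _ e'0) => y; rewrite /ball/= => /ltW xy.
by apply: le_trans (F_lip _ _) _; rewrite mulrC -ler_pdivlMr.
Qed.

Let F_rc : right_continuous F := right_continuousW F_cont.

Let FNy : F @ -oo --> (0 : R).
Proof.
apply: (@cvg_trans _ (cst (0 : R) @ -oo)); last exact: cvg_cst.
apply: near_eq_cvg; exists a; split; first exact: num_real.
by move=> x /ltW /Fa ->.
Qed.

Let Fy : F @ +oo --> (1 : R).
Proof.
apply: (@cvg_trans _ (cst (1 : R) @ +oo)); last exact: cvg_cst.
apply: near_eq_cvg; exists b; split; first exact: num_real.
by move=> x /ltW /Fb ->.
Qed.

Let F1 : cumulativeBounded (0 : R) (1 : R) :=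
  HB.pack F (isCumulative.Build R _ R F F_nd F_rc)
    (isCumulativeBounded.Build R 0 1 F FNy Fy).

Let nu : {finite_measure set RT -> \bar R} := lebesgue_stieltjes_measure F1.

Let nu_itv x y : x <= y -> nu `]x, y]%classic = (F y - F x)%:E.
Proof.
move=> xy; rewrite /nu /= /lebesgue_stieltjes_measure /measure_extension.
by rewrite measurable_mu_extE/=; [rewrite wlength_itv_bnd|exact: is_ocitv].
Qed.

Let nu_lam (A : set RT) : measurable A -> lam A = 0%E -> nu A = 0%E.
Proof.
move=> mA lA; apply/eqP; rewrite eq_le measure_ge0 andbT.
apply/lee_addgt0Pr => e e0; rewrite add0e.
have e'0 : (0 < (e / C)%:E)%E by rewrite lte_fin divr_gt0.
have : (lam A < (e / C)%:E)%E by rewrite lA.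
rewrite /= /lebesgue_measure /lebesgue_stieltjes_measure /measure_extension /mu_ext.
move=> /ereal_inf_lt[_ [V covV <-] Ve].
have [mV AV] := covV.
apply: (@le_trans _ _ (\sum_(k <oo) wlength F (V k))%E).
  by apply: ereal_inf_lbound; exists V.
apply: (@le_trans _ _ (\sum_(k <oo) (C%:E * wlength idfun (V k)))%E).
  apply: lee_nneseries => [k _ _|k _]; first exact: (wlength_ge0 F1).
  have [-> |[[x y] /= xy ->]] := (ocitvP _).1 (mV k).
    by rewrite !wlength0 mule0.
  have xy' := ltW xy.
  rewrite !wlength_itv_bnd// -EFinM lee_fin /=.
  by case/andP: (Fnd (ltW xy)).
rewrite nneseriesZl; last by move=> k _; exact: (wlength_ge0 (idfun : cumulative R R)).
have -> : (e%:E = C%:E * (e / C)%:E)%E by rewrite -EFinM mulrC divfK ?gt_eqF.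
by rewrite lee_pmul2l// ?lte_fin// ltW.
Qed.

(** The Lebesgue-Stieltjes measure of F is absolutely continuous because F is Lipschitz; its
    Radon-Nikodym density phi is almost everywhere the derivative of F by Lebesgue's
    differentiation theorem. *)
Lemma lipschitz_cumulative_density : exists phi : R -> R,
  [/\ lam.-integrable setT (EFin \o phi),
      \int[lam]_(x in `]a, b]) phi x = 1 &
      {ae lam, forall x, a < x -> is_derive x (1 : R) F (phi x)}].
Proof.
have dom : nu `<< lam by apply/null_content_dominatesP => A; exact: nu_lam.
pose f := Radon_Nikodym_SigmaFinite.f nu lam.
have ff := Radon_Nikodym_SigmaFinite.f_fin_num dom.
have fi := Radon_Nikodym_SigmaFinite.f_integrable dom.
have fI := Radon_Nikodym_SigmaFinite.f_integral dom.
pose phi x := fine (f x).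
have Ephi : EFin \o phi = f by apply/funext => x /=; rewrite fineK.
have iphi : lam.-integrable setT (EFin \o phi) by rewrite Ephi.
have Iphi y : a <= y -> \int[lam]_(x in `]a, y]) phi x = F y.
  move=> ay; rewrite /Rintegral.
  rewrite (_ : (fun x => (phi x)%:E) = f); last exact: Ephi.
  by rewrite -fI ?nu_itv//= (Fa (lexx a)) subr0.
exists phi; split => //; first by rewrite Iphi ?Fb// ltW.
have mphi : measurable_fun [set: RT] phi by apply/measurable_EFinP; exact: measurable_int iphi.
have lphi : locally_integrable [set: R] phi by apply: open_integrable_locally => //; exact: openT.
have iphiy y : lam.-integrable [set` Interval (BRight a) (BRight y)] (EFin \o phi).
  by apply: integrableS iphi => //; exact: measurable_itv.
have := FTC1 iphiy lphi.
apply: filterS; first exact: (ae_filter_ringOfSetsType lam).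
move=> x H ax.
have [d e] := H ax; rewrite derive1E in e.
have : is_derive x (1 : R) (fun y => \int[lam]_(t in `]a, y]) phi t) (phi x) by split.
apply: near_eq_is_derive; apply: filterS (lt_nbhsr ax) => y ay.
by rewrite Iphi// ltW.
Qed.

End lipschitz_cumulative.

Section lipschitz_derivative.
Context {R : realType}.
Local Notation RT := (measurableTypeR R).
Local Notation lam := (lebesgue_measure : {sigma_finite_measure set RT -> \bar R}).

(** Adding a large linear function makes h increasing; clamped to [a, b] and normalized, it becomes
    a distribution function, that is, the integral of its almost everywhere derivative. The bound
    is known only where the derivative exists, which is enough under the integral. *)
Lemma lipschitz_derivative_ge (h : R -> R) (a b L m : R) : a < b -> 0 <= L ->
  (forall x y, a <= x <= b -> a <= y <= b -> `|h x - h y| <= L * `|x - y|) ->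
  (forall x l, a < x < b -> is_derive x (1 : R) h l -> - m <= l) ->
  - m * (b - a) <= h b - h a.
Proof.
move=> ab L0 hL hm.
(* c clamps to [a, b]; k is then constant outside [a, b] and grows at least like c. *)
pose c x := Num.min (Num.max x a) b.
have cab x : a <= c x <= b by rewrite /c le_min le_max lexx orbT (ltW ab)/= ge_min lexx orbT.
have cnd x y : x <= y -> 0 <= c y - c x <= y - x.
  move=> xy; rewrite /c.
  have [|] := leP x a; have [|] := leP y a; move=> ? ?; do ?[have [|] := leP _ b => ?];
  by apply/andP; split; lra.
have ca x : x <= a -> c x = a by move=> xa; rewrite /c max_r// min_l// ltW.
have cb x : b <= x -> c x = b.
  by move=> bx; rewrite /c max_l ?min_r// (le_trans (ltW ab)).
have cx x : a < x < b -> c x = x.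
  by move=> /andP[/ltW ax /ltW xb]; rewrite /c max_l// min_l.
pose k x := (L + 1) * c x + h (c x).
have knd x y : x <= y -> 0 <= k y - k x <= (2 * L + 1) * (y - x) /\ c y - c x <= k y - k x.
  move=> /cnd/andP[c1 c2].
  have := hL _ _ (cab y) (cab x); rewrite (ger0_norm c1) ler_norml => /andP[h1 h2].
  have Lc : L * (c y - c x) <= L * (y - x) by rewrite ler_wpM2l.
  by rewrite /k; split; [apply/andP; split|]; nra.
have kap0 : 0 < k b - k a.
  have [_ ] := knd _ _ (ltW ab); rewrite (cb b (lexx b)) (ca a (lexx a)); apply: lt_le_trans.
  by rewrite subr_gt0.
pose F x := (k x - k a) / (k b - k a).
pose C := (2 * L + 1) / (k b - k a).
have C0 : 0 < C by rewrite divr_gt0// ltr_wpDl// mulr_ge0.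
have Fnd x y : x <= y -> 0 <= F y - F x <= C * (y - x).
  move=> /knd[/andP[k1 k2] _]; rewrite /F -mulrBl opprB addrA subrK.
  by rewrite divr_ge0 ?(ltW kap0)//= /C mulrAC ler_pM2r ?invr_gt0.
have Fa x : x <= a -> F x = 0.
  move=> xa; have kxa : k x = k a by rewrite /k (ca x xa) (ca a (lexx a)).
  by rewrite /F kxa subrr mul0r.
have Fb x : b <= x -> F x = 1.
  move=> bx; have kxb : k x = k b by rewrite /k (cb x bx) (cb b (lexx b)).
  by rewrite /F kxb divff// gt_eqF.
have [phi [iphi Iphi dphi]] := lipschitz_cumulative_density ab C0 Fnd Fa Fb.
(* Where F is differentiable, its derivative phi is at least c0 by the bound on h; c0 integrates to
   (L + 1 - m) (b - a) / (k b - k a), and phi to 1. *)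
pose c0 := (L + 1 - m) / (k b - k a).
have phige : {ae lam, forall x, `]a, b[%classic x -> (phi x - c0)%:E = (Num.max (phi x - c0) 0)%:E}.
  apply: filterS dphi; first exact: (ae_filter_ringOfSetsType lam).
  move=> x dF /=; rewrite in_itv/= => /andP[ax xb].
  congr EFin; apply/esym/max_idPl; rewrite subr_ge0.
  have dh : is_derive x (1 : R) h ((k b - k a) * phi x - (L + 1)).
    have d1 := is_deriveB_fun (is_deriveZ_fun (k b - k a) (dF ax))
      (is_deriveZ_fun (L + 1) (is_derive_id x (1 : R))).
    have d2 := is_deriveD_fun d1 (is_derive_cst (k a) x (1 : R)).
    rewrite mulr1 addr0 in d2.
    apply: near_eq_is_derive d2.
    near=> y.
    have ayb : a < y < b by apply/andP; split; near: y; [exact: lt_nbhsr|exact: lt_nbhsl].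
    have FE : (k b - k a) * F y = k y - k a by rewrite /F mulrC divfK ?gt_eqF.
    by rewrite FE /= {1}/k (cx y ayb); ring.
  have := hm x _ _ dh; rewrite ax xb => /(_ isT) hle.
  by rewrite /c0 ler_pdivrMr// mulrC; lra.
have mab : measurable (`]a, b[%classic : set RT) by exact: measurable_itv.
have iab : lam.-integrable `]a, b[ (EFin \o phi) by apply: integrableS iphi.
have mphi : measurable_fun (`]a, b[%classic : set RT) phi.
  by apply/measurable_EFinP; exact: measurable_int iab.
have vol : fine (lam (`]a, b[%classic : set RT)) = b - a.
  by rewrite /= lebesgue_measure_itv/= lte_fin ab -EFinB.
have icst : lam.-integrable `]a, b[ (EFin \o (fun _ => c0)).
  apply: measurable_bounded_integrable => //.
    by rewrite /= lebesgue_measure_itv/= lte_fin ab -EFinB ltry.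
  by exists `|c0|; split; [exact: num_real|move=> r hr x _ /=; exact: ltW].
have I1 : \int[lam]_(x in `]a, b[) phi x = 1.
  by rewrite -Iphi Rintegral_itv_bndo_bndc.
have : 0 <= \int[lam]_(x in `]a, b[) (phi x - c0).
  rewrite /Rintegral (ae_eq_integral (fun x : RT => (Num.max (phi x - c0) 0)%:E))//.
  - by apply: fine_ge0; apply: integral_ge0 => x _; rewrite lee_fin le_max lexx orbT.
  - by apply/measurable_EFinP; apply: measurable_funB.
  - by apply/measurable_EFinP; apply: measurable_maxr => //; apply: measurable_funB.
rewrite RintegralB// I1 Rintegral_cst// vol subr_ge0 /c0 mulrAC ler_pdivrMr// mul1r /k.
rewrite (cb b (lexx b)) (ca a (lexx a)) => H; lra.
Unshelve. all: by end_near. Qed.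
End lipschitz_derivative.

(** * Lower bound on the reaction terms *)

Section local_monotonicity.
Context {R : realType}.

(** Monotonicity near every point propagates from 0 to c by a supremum argument, so that local
    Lipschitz constants suffice. *)
Lemma local_nondecreasing (g : R -> R) (c : R) : 0 <= c ->
  (forall s, 0 <= s <= c -> exists2 del : R, 0 < del & forall x y,
     0 <= x -> x <= y -> y <= c -> `|x - s| < del -> `|y - s| < del -> g x <= g y) ->
  g 0 <= g c.
Proof.
move=> c0 loc.
pose S := [set s | 0 <= s <= c /\ g 0 <= g s].
have S0 : S 0 by rewrite /S/= lexx c0.
have hS : has_sup S by split; [exists 0|exists c => s [/andP[]]].
have [sup0 supc] : 0 <= sup S /\ sup S <= c.
  split; first exact: (ub_le_sup hS.2 S0).
  by apply: ge_sup => [|s [/andP[]]//]; exists 0.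
have [del del0 Hdel] := loc (sup S) (introT andP (conj sup0 supc)).
have [s Ss ss] := sup_adherent del0 hS.
have ssup : s <= sup S := ub_le_sup hS.2 Ss.
case: (Ss) => /andP[s0 sc] gs.
have gsup : g 0 <= g (sup S).
  apply: le_trans gs _; apply: Hdel => //.
    by rewrite ler0_norm ?subr_le0//; lra.
  by rewrite subrr normr0.
have [<-//|supc'] := eqVneq (sup S) c.
have slt : sup S < c by rewrite lt_neqAle supc'.
pose t := Num.min c (sup S + del / 2).
have st : sup S < t by rewrite lt_min slt/= ltrDl divr_gt0.
have tc : t <= c by rewrite ge_min lexx.
have tdel : t <= sup S + del / 2 by rewrite ge_min lexx orbT.
have St : S t.
  split; first by rewrite tc andbT (le_trans sup0)// ltW.
  apply: le_trans gsup _; apply: Hdel => //.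
  - exact: ltW.
  - by rewrite subrr normr0.
  - by rewrite ger0_norm ?subr_ge0 ?ltW//; lra.
by have := ub_le_sup hS.2 St; rewrite leNgt st.
Qed.

End local_monotonicity.

Section reaction.
Context {R : realType} {N : nat}.
Implicit Types u : 'rV[R]_N.

Lemma enorm_sqr u : enorm u ^+ 2 = \sum_i u 0 i ^+ 2.
Proof. by rewrite sqr_sqrtr//; apply: sumr_ge0 => i _; exact: sqr_ge0. Qed.

Lemma enorm_ge0 u : 0 <= enorm u.
Proof. exact: sqrtr_ge0. Qed.

Lemma locally_lipschitz_at (f : 'rV[R]_N -> 'rV[R]_N) (A : set 'rV[R]_N) x :
  [locally [lipschitz f u | u in A]] -> A x ->
  exists2 M : R, 0 <= M & exists2 del : R, 0 < del & forall y z, A y -> A z ->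
    ball x del y -> ball x del z -> `|f y - f z| <= M * `|y - z|.
Proof.
move=> H Ax; have := H (x, x) (conj Ax Ax).
move=> [M [Mr HM]]; exists (Num.max 0 (M + 1)); first by rewrite le_max lexx.
have := HM (Num.max 0 (M + 1)).
rewrite lt_max ltrDl ltr01 orbT => /(_ isT).
rewrite /dominated_by /= => -[[P Q] /= [/nbhs_ballP[d1 /= d10 B1] /nbhs_ballP[d2 /= d20 B2]]] PQ.
exists (Num.min d1 d2); first by rewrite lt_min d10.
move=> y z Ay Az xy xz.
have := PQ (y, z); apply; last by [].
split; [apply: B1|apply: B2] => /=.
  by apply: le_ball xy; rewrite ge_min lexx.
by apply: le_ball xz; rewrite ge_min lexx orbT.
Qed.

(** The point of the orthant that moves along the i-th axis, from the face u_i = 0 to u. *)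
Definition row_with u (i : 'I_N) (s : R) : 'rV[R]_N := \row_j (if j == i then s else u 0 j).

Lemma row_withD u i s h : row_with u i s + h *: 'e_i = row_with u i (s + h).
Proof.
apply/rowP => j; rewrite !mxE eqxx andTb; case: eqVneq => _ /=; first by rewrite mulr1.
by rewrite mulr0 addr0.
Qed.

Lemma row_with_id u i : row_with u i (u 0 i) = u.
Proof. by apply/rowP => j; rewrite mxE; case: eqVneq => // ->. Qed.

Lemma row_with_orthant u i s : orthant u -> 0 <= s -> orthant (row_with u i s).
Proof. by move=> ou s0 j; rewrite mxE; case: ifP. Qed.

Lemma row_with_enorm u i s : orthant u -> 0 <= s <= u 0 i ->
  enorm (row_with u i s) ^+ 2 <= enorm u ^+ 2.
Proof.
move=> ou /andP[s0 su]; rewrite !enorm_sqr; apply: ler_sum => j _; rewrite mxE.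
by case: eqVneq => [->|//]; rewrite ler_pXn2r// nnegrE.
Qed.

Variables (f : 'rV[R]_N -> 'rV[R]_N) (Cf : R).
Hypotheses (Cf0 : 0 < Cf) (flip : [locally [lipschitz f u | u in @orthant R N]]).
Hypothesis fqp : forall u i, orthant u ->
  0 <= f (\row_j (if j == i then 0 else u 0 j)) 0 i.
Hypothesis fder : forall u i l, orthant u ->
  is_derive_in (@orthant R N) (fun v => f v 0 i) u 'e_i l ->
  - (Cf * (1 + enorm u ^+ 2)) <= l.

(** On the face u_i = 0 quasi-positivity gives f_i >= 0; moving from the face to u along the i-th
    axis, f_i decreases at most at the rate Cf (1 + |u|^2). *)
Lemma reaction_lower_bound u i : orthant u ->
  - (Cf * (1 + enorm u ^+ 2) * u 0 i) <= f u 0 i.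
Proof.
move=> ou; set m := Cf * (1 + enorm u ^+ 2).
(* It is enough that s |-> f_i + m s does not decrease from the face s = 0 to s = u_i. *)
pose g s := f (row_with u i s) 0 i + m * s.
suff : g 0 <= g (u 0 i).
  rewrite /g row_with_id mulr0 addr0 => H.
  have := le_trans (fqp i ou) H; lra.
apply: local_nondecreasing; first exact: ou.
move=> s0 /andP[s00 s0u].
have [L L0 [del del0 Hdel]] := locally_lipschitz_at flip (row_with_orthant i ou s00).
have inball s : `|s - s0| < del -> ball (row_with u i s0) del (row_with u i s).
  move=> ss; apply/ball_rowP => // j; rewrite !mxE; case: ifP => _; last by rewrite subrr normr0.
  by rewrite distrC.
exists del => // x y x0 xy yu xs ys.
have [->//|xy'] := eqVneq x y.
have {xy'}xy' : x < y by rewrite lt_neqAle xy'.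
suff : - m * (y - x) <= f (row_with u i y) 0 i - f (row_with u i x) 0 i.
  by rewrite /g; lra.
have bt s : x <= s <= y -> [/\ 0 <= s, s <= u 0 i & `|s - s0| < del].
  move=> /andP[xs' sy]; split; [exact: le_trans xs'|exact: le_trans yu|].
  by move: xs ys; rewrite !ltr_norml => /andP[? ?] /andP[? ?]; apply/andP; split; lra.
apply: (lipschitz_derivative_ge (h := fun s => f (row_with u i s) 0 i) xy' L0).
- move=> s t /bt[p1 p2 p3] /bt[q1 q2 q3].
  have := Hdel _ _ (row_with_orthant i ou p1) (row_with_orthant i ou q1) (inball _ p3) (inball _ q3).
  move=> H; have := rV_coord_le (f (row_with u i s) - f (row_with u i t)) i.
  rewrite !mxE => /le_trans; apply; apply: (le_trans H); rewrite ler_wpM2l//.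
  apply: rV_norm_le => // j; rewrite !mxE; case: ifP => // _.
  by rewrite subrr normr0.
- move=> s l /andP[xs' sy] dl.
  have [s1 s2 _] := bt s (introT andP (conj (ltW xs') (ltW sy))).
  have os := row_with_orthant i ou s1.
  have := fder (i := i) (l := l) os.
  have : is_derive_in (@orthant R N) (fun v => f v 0 i) (row_with u i s) 'e_i l.
    rewrite /is_derive_in /diff_quotient_in; apply: cvg_within_filter.
    move/is_derive_quotP : dl; rewrite (_ : (fun h => _) = (fun h : R => h^-1 *
      (f (row_with u i s + h *: 'e_i) 0 i - f (row_with u i s) 0 i)))//.
    by apply/funext => h; rewrite row_withD.
  move=> H /(_ H); apply: le_trans.
  rewrite lerN2 /m ler_wpM2l ?(ltW Cf0)// lerD2l row_with_enorm//.
  by rewrite s1.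
Qed.

End reaction.

(** * Pointwise entropy estimates *)

Section pointwise_estimates.
Context {R : realType} {N : nat}.
Implicit Types u : 'rV[R]_N.

Lemma coord_le_enorm u i : orthant u -> u 0 i <= enorm u.
Proof.
move=> ou; rewrite -ler_sqr ?nnegrE ?enorm_ge0 ?ou// enorm_sqr (bigD1 i)//= lerDl.
by apply: sumr_ge0 => k _; exact: sqr_ge0.
Qed.

Lemma enorm_le_sum u : orthant u -> enorm u <= \sum_i u 0 i.
Proof.
move=> ou; have s0 : 0 <= \sum_i u 0 i by apply: sumr_ge0 => i _; exact: ou.
rewrite -ler_sqr ?nnegrE ?enorm_ge0// enorm_sqr [leRHS]expr2 mulr_suml.
apply: ler_sum => i _; rewrite expr2 ler_wpM2l ?ou// (bigD1 i)//= lerDl.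
by apply: sumr_ge0 => k _; exact: ou.
Qed.

Lemma ln_le_id (x : R) : 0 < x -> ln x <= x.
Proof. by move=> x0; rewrite ltW// ln_sublinear. Qed.

(** Write ln y_i = ln L - ln (L / y_i) with L = 1 + |u| >= y_i. The terms in ln L have a nonpositive
    sum by mass dissipation. In the others the factor - f_i is at most Cf (1 + |u|^2) u_i, and
    ln (L / y_i) <= L / y_i, so that the factor u_i compensates the singularity. *)
Lemma reaction_entropy_le (Cf eta : R) (fu : 'I_N -> R) u : orthant u -> 0 <= Cf ->
  0 < eta <= 1 -> \sum_i fu i <= 0 ->
  (forall i, - (Cf * (1 + enorm u ^+ 2) * u 0 i) <= fu i) ->
  \sum_i fu i * (ln (u 0 i + eta) + 1) <= N%:R * Cf * (1 + enorm u) ^+ 3.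
Proof.
move=> ou Cf0 /andP[eta0 eta1] mass low.
have e0 := enorm_ge0 u.
pose L := 1 + enorm u.
have L1 : 1 <= L by rewrite lerDl.
have L0 : 0 < L by exact: lt_le_trans L1.
have y0 i : 0 < u 0 i + eta by rewrite ltr_wpDl// ou.
have step i : fu i * (ln (u 0 i + eta) + 1) <= fu i * (ln L + 1) + Cf * L ^+ 3.
  have yL : u 0 i + eta <= L by rewrite addrC lerD// coord_le_enorm.
  have lnE : ln L - ln (u 0 i + eta) = ln (L / (u 0 i + eta)).
    by rewrite ln_div ?posrE.
  have q1 : 1 <= L / (u 0 i + eta) by rewrite ler_pdivlMr// mul1r.
  have l0 : 0 <= ln (L / (u 0 i + eta)) by rewrite ln_ge0.
  have l1 : ln (L / (u 0 i + eta)) <= L / (u 0 i + eta).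
    by apply: ln_le_id; exact: lt_le_trans q1.
  have main : - fu i * ln (L / (u 0 i + eta)) <= Cf * L ^+ 3.
    have c0 : 0 <= Cf * (1 + enorm u ^+ 2) by rewrite mulr_ge0// addr_ge0// sqr_ge0.
    apply: (@le_trans _ _ (Cf * (1 + enorm u ^+ 2) * u 0 i * ln (L / (u 0 i + eta)))).
      by rewrite ler_wpM2r// lerNl.
    apply: (@le_trans _ _ (Cf * (1 + enorm u ^+ 2) * u 0 i * (L / (u 0 i + eta)))).
      by rewrite ler_wpM2l// mulr_ge0// ou.
    have -> : Cf * (1 + enorm u ^+ 2) * u 0 i * (L / (u 0 i + eta)) =
      Cf * (1 + enorm u ^+ 2) * L * (u 0 i / (u 0 i + eta)) by field; rewrite gt_eqF.
    have q2 : u 0 i / (u 0 i + eta) <= 1 by rewrite ler_pdivrMr// mul1r lerDl ltW.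
    apply: (@le_trans _ _ (Cf * (1 + enorm u ^+ 2) * L)).
      by rewrite ler_piMr// mulr_ge0// ltW.
    rewrite -!mulrA ler_wpM2l// [L ^+ 3]exprSr ler_wpM2r ?(ltW L0)// /L.
    nra.
  move: main; rewrite -lnE => main; nra.
apply: (le_trans (ler_sum _ (fun i _ => step i))).
rewrite big_split/= -mulr_suml sumr_const card_ord -[X in _ + X]mulr_natl mulrA.
rewrite gerDr; apply: mulr_le0_ge0 => //.
by rewrite addr_ge0// ln_ge0.
Qed.

(** The product z v is at least delta tau0 r^3, which beats the cubic term once lambda is large; the
    remaining term lambda z M is only quadratic. *)
Lemma cubic_absorption (A delta Cd tau0 M : R) : 0 <= A -> 0 < delta -> 0 < Cd ->
  0 < tau0 -> 0 <= M -> exists2 lambda : R, 0 < lambda & exists2 C : R, 0 <= C &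
  forall r z v : R, 0 <= r -> delta * r ^+ 2 <= z -> z <= Cd * (1 + r ^+ 2) ->
    tau0 * r <= v -> A * (1 + r) ^+ 3 - lambda * (z * (v - M)) <= C.
Proof.
move=> A0 delta0 Cd0 tau00 M0.
(* (1 + r)^3 <= 4 (1 + r^3), so lambda delta tau0 = 4 A + 1 leaves a margin r^3
   for the quadratic term. *)
pose lambda := (4 * A + 1) / (delta * tau0).
have dt0 : 0 < delta * tau0 by rewrite mulr_gt0.
have lambda0 : 0 < lambda by rewrite divr_gt0// ltr_wpDl// mulr_ge0.
pose B := lambda * M * Cd.
have B0 : 0 <= B by apply: mulr_ge0; [apply: mulr_ge0 => //; exact: ltW|exact: ltW].
exists lambda => //; exists (4 * A + B + B ^+ 3).
  by apply: addr_ge0; [apply: addr_ge0 => //; exact: mulr_ge0|exact: exprn_ge0].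
move=> r z v r0 z1 z2 v1.
have z0 : 0 <= z by apply: le_trans z1; rewrite mulr_ge0 ?sqr_ge0 ?ltW.
have h1 : A * (1 + r) ^+ 3 <= 4 * A * (1 + r ^+ 3).
  rewrite [4 * A]mulrC -mulrA ler_wpM2l//.
  have : 0 <= (1 + r) * (1 - r) ^+ 2 by rewrite mulr_ge0 ?addr_ge0// sqr_ge0.
  nra.
have h2 : (4 * A + 1) * r ^+ 3 <= lambda * (z * v).
  have -> : (4 * A + 1) * r ^+ 3 = lambda * ((delta * r ^+ 2) * (tau0 * r)).
    by rewrite /lambda; field; rewrite !gt_eqF.
  have d1 := ltW delta0; have t1 := ltW tau00.
  by rewrite ler_wpM2l ?(ltW lambda0)// ler_pM// mulr_ge0// sqr_ge0.
have h3 : lambda * (z * M) <= B * (1 + r ^+ 2).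
  have -> : B * (1 + r ^+ 2) = lambda * (Cd * (1 + r ^+ 2) * M) by rewrite /B; ring.
  by rewrite ler_wpM2l ?(ltW lambda0)// ler_wpM2r.
have h4 : B * r ^+ 2 <= r ^+ 3 + B ^+ 3.
  have [rB|rB] := leP B r.
    have : B * r ^+ 2 <= r * r ^+ 2 by rewrite ler_wpM2r ?sqr_ge0.
    have : 0 <= B ^+ 3 by rewrite exprn_ge0.
    by rewrite [r ^+ 3]exprS; lra.
  have : B * r ^+ 2 <= B * B ^+ 2 by rewrite ler_wpM2l// ler_sqr ?nnegrE// ltW.
  have : 0 <= r ^+ 3 by rewrite exprn_ge0.
  by rewrite [B ^+ 3]exprS; lra.
have -> : lambda * (z * (v - M)) = lambda * (z * v) - lambda * (z * M) by ring.
lra.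
Qed.

Lemma quadratic_form_expand (P : 'M[R]_N) (xi : 'rV[R]_N) :
  (xi *m P *m xi^T) 0 0 = \sum_i \sum_j xi 0 i * P i j * xi 0 j.
Proof.
rewrite mxE exchange_big/=; apply: eq_bigr => j _.
by rewrite !mxE mulr_suml; apply: eq_bigr => i _.
Qed.

(** Without eta, the sum would be half the quadratic form of the structure matrix at xi_i = p_i / u_i.
    Taking xi_i = p_i / y_i instead, the defect 1 - u_k / y_k = eta / y_k appears in the off-diagonal
    terms, where it is estimated, and in the diagonal terms, where it has the right sign. *)
Lemma diffusion_entropy_ge (eta CD : R) u (D : 'I_N -> R) (DD : 'I_N -> 'I_N -> R)
    (p : 'I_N -> R) : orthant u -> 0 < eta -> 0 <= CD ->
  (forall i, 0 <= D i) -> (forall i k, `|DD i k| <= CD) ->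
  positive_semidefinite (\matrix_(i, j) ((DD i j + DD j i) * (u 0 i * u 0 j)
     + ((i == j)%:R * D i * u 0 j + (j == i)%:R * D j * u 0 i))) ->
  - (CD * \sum_i \sum_k `|p i| * (eta / (u 0 k + eta) * `|p k|)) <=
  \sum_i p i / (u 0 i + eta) * ((\sum_k DD i k * p k) * u 0 i + D i * p i).
Proof.
move=> ou eta0 CD0 D0 DDle psd.
pose y i := u 0 i + eta.
have y0 i : 0 < y i by rewrite ltr_wpDl// ou.
pose xi : 'rV[R]_N := \row_i (p i / y i).
pose S1 := \sum_i \sum_k DD i k * u 0 i * u 0 k * (p i / y i) * (p k / y k).
pose S2 := \sum_i D i * u 0 i * (p i / y i) ^+ 2.
have S_ge0 : 0 <= S1 + S2.
  have := psd xi; rewrite quadratic_form_expand.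
  have -> : \sum_i \sum_j xi 0 i * (\matrix_(i, j) ((DD i j + DD j i) * (u 0 i * u 0 j)
     + ((i == j)%:R * D i * u 0 j + (j == i)%:R * D j * u 0 i))) i j * xi 0 j =
     S1 + S1 + (S2 + S2).
    have E1 : S1 = \sum_i \sum_k DD k i * u 0 i * u 0 k * (p i / y i) * (p k / y k).
      rewrite /S1 exchange_big/=; apply: eq_bigr => i _; apply: eq_bigr => k _; ring.
    have E2 : S2 = \sum_i \sum_j (i == j)%:R * (D i * u 0 j * (p i / y i) * (p j / y j)).
      apply: eq_bigr => i _; rewrite (bigD1 i)//= eqxx big1 ?addr0; first by rewrite mul1r expr2 !mulrA.
      by move=> j; rewrite eq_sym => /negbTE ->; rewrite mul0r.
    have E3 : S2 = \sum_i \sum_j (j == i)%:R * (D j * u 0 i * (p i / y i) * (p j / y j)).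
      rewrite E2 exchange_big/=; apply: eq_bigr => i _; apply: eq_bigr => k _; ring.
    rewrite {2}E1 {1}E2 E3 /S1 -!big_split/=; apply: eq_bigr => i _.
    rewrite -!big_split/=; apply: eq_bigr => j _; rewrite !mxE; ring.
  lra.
have iy k : 0 <= (y k)^-1 by rewrite invr_ge0 ltW.
have e00 := ltW eta0.
have err : - (CD * \sum_i \sum_k `|p i| * (eta / y k * `|p k|)) <=
    \sum_i \sum_k DD i k * (u 0 i / y i) * p i * p k * (eta / y k).
  rewrite mulr_sumr -sumrN; apply: ler_sum => i _.
  rewrite mulr_sumr -sumrN; apply: ler_sum => k _.
  rewrite lerNl; apply: le_trans (ler_norm _) _; rewrite normrN.
  rewrite !normrM.
  have -> : `|eta| = eta by rewrite gtr0_norm.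
  rewrite !normfV (gtr0_norm (y0 i)) (gtr0_norm (y0 k)).
  have -> : `|DD i k| * (`|u 0 i| / y i) * `|p i| * `|p k| * (eta / y k) =
    `|DD i k| * (`|u 0 i| / y i) * (`|p i| * (eta / y k * `|p k|)) by ring.
  have w0 : 0 <= `|p i| * (eta / y k * `|p k|).
    by rewrite !mulr_ge0.
  rewrite ler_wpM2r// -[leRHS]mulr1 ler_pM//.
    by rewrite divr_ge0// ltW.
  by rewrite ger0_norm ?ou// ler_pdivrMr// mul1r lerDl ltW.
have pos : 0 <= \sum_i D i * p i ^+ 2 / y i * (eta / y i).
  apply: sumr_ge0 => i _; apply: mulr_ge0; last exact: mulr_ge0.
  by apply: mulr_ge0 => //; apply: mulr_ge0; [exact: D0|exact: sqr_ge0].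
have E : \sum_i p i / (u 0 i + eta) * ((\sum_k DD i k * p k) * u 0 i + D i * p i) =
    (S1 + S2) + \sum_i \sum_k DD i k * (u 0 i / y i) * p i * p k * (eta / y k)
    + \sum_i D i * p i ^+ 2 / y i * (eta / y i).
  rewrite /S1 /S2 -!big_split/=; apply: eq_bigr => i _.
  have -> : p i / (u 0 i + eta) * ((\sum_k DD i k * p k) * u 0 i + D i * p i) =
     \sum_k p i / y i * (DD i k * p k * u 0 i) + D i * p i ^+ 2 / y i.
    by rewrite mulrDr mulr_suml mulr_sumr /y; congr (_ + _); ring.
  have -> : \sum_k p i / y i * (DD i k * p k * u 0 i) =
     \sum_k DD i k * u 0 i * u 0 k * (p i / y i) * (p k / y k) +
     \sum_k DD i k * (u 0 i / y i) * p i * p k * (eta / y k).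
    rewrite -big_split/=; apply: eq_bigr => k _; rewrite /y.
    by field; rewrite !gt_eqF//; apply: y0.
  have Epos : D i * p i ^+ 2 / y i = D i * u 0 i * (p i / y i) ^+ 2 +
     D i * p i ^+ 2 / y i * (eta / y i).
    by rewrite /y; field; rewrite gt_eqF//; apply: y0.
  by rewrite {1}Epos; ring.
by rewrite E; lra.
Qed.

End pointwise_estimates.

(** * Calculus in time and continuity up to the boundary *)

Section calculus.
Context {R : realType}.
Local Notation RT := (measurableTypeR R).

Lemma mean_value_le (phi dphi : R -> R) (p q C : R) :
  (forall s, Num.min p q <= s <= Num.max p q ->
     is_derive s (1 : R) phi (dphi s) /\ `|dphi s| <= C) ->
  `|phi q - phi p| <= C * `|q - p|.
Proof.
wlog pq : p q / p <= q => [H|].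
  have [pq|/ltW qp] := leP p q.
    by have := H _ _ pq; rewrite (min_idPl pq) (max_idPr pq).
  have := H _ _ qp; rewrite (min_idPl qp) (max_idPr qp) => h hd.
  by rewrite distrC [`|q - p|]distrC; exact: h.
rewrite (min_idPl pq) (max_idPr pq) => H.
have [|c|c] := @MVT_segment R phi dphi p q pq.
- by move=> s; rewrite in_itv/= => /andP[/ltW ps /ltW sq]; apply: (H s _).1; rewrite ps.
- apply: derivable_within_continuous => s; rewrite in_itv/= => hs.
  by case: (H s hs) => -[].
- rewrite in_itv/= => hc ->; rewrite normrM ler_wpM2r//.
  exact: (H c hc).2.
Qed.

Lemma antiderivative (phi : R -> R) (a b : R) : a < b ->
  (forall s, a <= s <= b -> {for s, continuous phi}) ->
  exists Phi : R -> R, forall s, a < s < b -> is_derive s (1 : R) Phi (phi s).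
Proof.
move=> ab cphi.
have iphi : (lebesgue_measure : {measure set RT -> \bar R}).-integrable `[a, b] (EFin \o phi).
  apply: continuous_compact_integrable; first exact: segment_compact.
  by apply: continuous_in_subspaceT => s; rewrite inE/= in_itv/=; exact: cphi.
exists (fun x => \int[lebesgue_measure]_(t in `[a, x]) phi t) => s /andP[as_ sb].
have cs : {for s, continuous phi} by apply: cphi; rewrite !ltW.
have [d e] := continuous_FTC1_closed sb iphi as_ cs.
by split => //; rewrite -derive1E.
Qed.

Lemma mean_value_ub (phi dphi : R -> R) (p q : R) : p <= q ->
  (forall s, p <= s <= q -> is_derive s (1 : R) phi (dphi s)) ->
  forall C, (forall s, p <= s <= q -> dphi s <= C) -> phi q - phi p <= C * (q - p).
Proof.
move=> pq H C HC.
have [|c|c] := @MVT_segment R phi dphi p q pq.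
- by move=> s; rewrite in_itv/= => /andP[/ltW ps /ltW sq]; apply: H; rewrite ps.
- apply: derivable_within_continuous => s; rewrite in_itv/= => hs.
  by case: (H s hs).
- by rewrite in_itv/= => hc ->; rewrite ler_wpM2r ?subr_ge0// HC.
Qed.

End calculus.

Section integral_on_derivative.
Context {R : realType} {n : nat}.
Variables (Omega : set 'rV[R]_n) (oO : open Omega) (bO : bounded_set Omega).

(** Differentiation under the integral sign, dominated by the constant C on a bounded domain. *)
Lemma is_derive_integral_on (a b C : R) (h dh : R -> 'rV[R]_n -> R) :
  (forall t x, a < t < b -> Omega x -> is_derive t (1 : R) (h^~ x) (dh t x)) ->
  (forall t, a < t < b -> bounded_continuous Omega (h t)) ->
  0 <= C -> (forall t x, a < t < b -> Omega x -> `|dh t x| <= C) ->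
  forall t, a < t < b ->
    is_derive t (1 : R) (fun t => integral_on Omega (h t)) (integral_on Omega (dh t)).
Proof.
move=> hd hb C0 dhC t tab.
have mB := measurable_row_open oO.
have It : (`]a, b[%classic : set R) t by rewrite /= in_itv.
have intf s : (`]a, b[%classic : set R) s ->
    (lebesgue_tuple n).-integrable (@row_of R n @^-1` Omega) (EFin \o (fun z => h s (row_of z))).
  by rewrite /= in_itv/= => /hb; exact: integrable_bounded_continuous.
have derf s z : (`]a, b[%classic : set R) s -> (@row_of R n @^-1` Omega) z ->
    derivable ((fun s z => h s (row_of z)) ^~ z) s 1.
  by rewrite /= in_itv/= => sab Oz; case: (hd s _ sab Oz).
have intC : (lebesgue_tuple n).-integrable (@row_of R n @^-1` Omega) (EFin \o (fun=> C)).
  exact: integrable_bounded_continuous oO bO (bounded_continuous_cst Omega C).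
have pE s z : (`]a, b[%classic : set R) s -> (@row_of R n @^-1` Omega) z ->
    partial1of2 (fun s z => h s (row_of z)) s z = dh s (row_of z).
  rewrite /= in_itv/= => sab Oz; rewrite partial1of2E.
  by case: (hd s _ sab Oz).
have GC s z : (`]a, b[%classic : set R) s -> (@row_of R n @^-1` Omega) z ->
    `|partial1of2 (fun s z => h s (row_of z)) s z| <= C.
  by move=> sab Oz; rewrite pE//; apply: dhC => //; move: sab; rewrite /= in_itv.
split.
  exact: (derivable_under_integral mB It intf derf (fun=> C0) intC GC).
rewrite -derive1E.
rewrite [LHS](differentiation_under_integral mB It intf derf (fun=> C0) intC GC).
by apply: eq_Rintegral => z; rewrite inE => Oz; exact: pE.
Qed.

End integral_on_derivative.

Section up_to_boundary.
Context {R : realType} {n : nat}.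
Variables (T : R) (Omega : set 'rV[R]_n).
Hypotheses (oO : open Omega) (bO : bounded_set Omega).
Local Notation cub := (continuous_up_to_boundary T Omega).
Let Q := (`]0, T[%classic `*` closure Omega : set (R * 'rV[R]_n)).

Lemma eq_cub g h : (forall t x, 0 < t < T -> Omega x -> g t x = h t x) -> cub g -> cub h.
Proof. by move=> gh [G cG GE]; exists G => // t x tT Ox; rewrite GE// gh. Qed.

Lemma cub_cst c : cub (fun _ _ => c).
Proof. by exists (cst c) => // x; exact: cvg_cst. Qed.

Lemma cubD g h : cub g -> cub h -> cub (fun t x => g t x + h t x).
Proof.
move=> [G cG GE] [H cH HE]; exists (fun p => G p + H p).
  by move=> p; exact: (cvgD (cG p) (cH p)).
by move=> t x tT Ox; rewrite GE ?HE.
Qed.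

Lemma cubM g h : cub g -> cub h -> cub (fun t x => g t x * h t x).
Proof.
move=> [G cG GE] [H cH HE]; exists (fun p => G p * H p).
  by move=> p; exact: (cvgM (cG p) (cH p)).
by move=> t x tT Ox; rewrite GE ?HE.
Qed.

Lemma cub_sum I (r : seq I) (g : I -> R -> 'rV[R]_n -> R) : (forall i, cub (g i)) ->
  cub (fun t x => \sum_(i <- r) g i t x).
Proof.
move=> cg; elim: r => [|i r IHr].
  by apply: (eq_cub _ (cub_cst 0)) => t x _ _; rewrite big_nil.
by apply: (eq_cub _ (cubD (cg i) IHr)) => t x _ _; rewrite big_cons.
Qed.

Lemma cub_comp (phi : R -> R) g : continuous phi -> cub g -> cub (fun t x => phi (g t x)).
Proof.
move=> cphi [G cG GE]; exists (phi \o G).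
  move=> p; exact: (@continuous_comp _ _ _ (G : subspace Q -> R) phi p (cG p) (cphi (G p))).
by move=> t x tT Ox; rewrite /= GE.
Qed.

Lemma cvg_row N (S : Type) (F : set_system S) {FF : Filter F} (w : S -> 'rV[R]_N) (l : 'rV[R]_N) :
  (forall i, (fun s => w s 0 i) @ F --> l 0 i) -> w @ F --> l.
Proof.
move=> wl; apply/cvgrPdist_le => e e0.
have H i : \forall s \near F, `|l 0 i - w s 0 i| <= e by have /cvgrPdist_le := wl i; exact.
apply: filterS (filter_forall _ H) => s Hs; apply: rV_norm_le => [|i]; first exact: ltW.
by rewrite !mxE.
Qed.

(** Coordinatewise extensions assemble into an extension of w, since D is defined everywhere. *)
Lemma cub_rowcomp N (D : 'rV[R]_N -> R) (w : R -> 'rV[R]_n -> 'rV[R]_N) :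
  continuous D -> (forall i, cub (fun t x => w t x 0 i)) -> cub (fun t x => D (w t x)).
Proof.
move=> cD cw.
have /choice[G HG] : forall i, exists G : R * 'rV[R]_n -> R,
    {within Q, continuous G} /\ forall t x, 0 < t < T -> Omega x -> G (t, x) = w t x 0 i.
  by move=> i; have [G cG GE] := cw i; exists G.
exists (fun p => D (\row_i G i p)).
  move=> p; apply: (@continuous_comp _ _ _ ((fun p => \row_i G i p) : subspace Q -> _) D p _ (cD _)).
  apply: cvg_row => i; under eq_fun do rewrite mxE; rewrite mxE; exact: (HG i).1.
move=> t x tT Ox; congr D; apply/rowP => i; rewrite mxE.
exact: (HG i).2.
Qed.

(** At a fixed time a continuous extension to the closure is available: this is the form in which
    fields and multipliers enter the divergence theorem. *)
Lemma cub_slice g t : 0 < t < T -> cub g ->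
  exists2 G : 'rV[R]_n -> R, {within closure Omega, continuous G} &
    forall x, Omega x -> G x = g t x.
Proof.
move=> tT [G cG GE]; exists (fun x => G (t, x)); last by move=> x; exact: GE.
apply/subspace_continuousP => x cx.
have Qx : Q (t, x) by split => //=; rewrite in_itv.
move=> W GW.
have H : \forall p \near (t, x), Q p -> W (G p) := (subspace_continuousP _ _).1 cG _ Qx W GW.
have cp : (fun y : 'rV[R]_n => (t, y)) @ x --> (t, x).
  exact: (@cvg_pair _ _ _ (nbhs x) (nbhs t) (nbhs x) _ _ _ (cst t) id (cvg_cst t) cvg_id).
have H2 : \forall y \near x, Q (t, y) -> W (G (t, y)) := cp _ H.
apply: filterS H2 => y Hy cy; apply: Hy.
by split => //=; rewrite in_itv.
Qed.

(** On a compact time interval inside ]0, T[ the extension lives on a compact set. *)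
Lemma cub_bounded g a b : 0 < a -> b < T -> cub g ->
  exists2 C : R, 0 <= C & forall t x, a <= t <= b -> Omega x -> `|g t x| <= C.
Proof.
move=> a0 bT [G cG GE].
have cK : compact (`[a, b]%classic `*` closure Omega).
  by apply: compact_setX; [exact: segment_compact|exact: closure_compact].
have tin t : a <= t <= b -> 0 < t < T.
  by move=> /andP[a1 b1]; rewrite (lt_le_trans a0 a1) (le_lt_trans b1 bT).
have cG' : {within `[a, b]%classic `*` closure Omega, continuous G}.
  apply: continuous_subspaceW cG => -[t x] [/= + cx]; rewrite in_itv/= => /tin tT.
  by split => //=; rewrite in_itv.
have [C C0 HC] := compact_normr_le cK cG'.
exists C => // t x tab Ox; rewrite -(GE t x (tin _ tab) Ox); apply: HC.
by split; [rewrite /= in_itv|exact: subset_closure].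
Qed.

Lemma cub_continuous_at g t x : 0 < t < T -> Omega x -> cub g ->
  (fun p => g p.1 p.2) @ (t, x) --> g t x.
Proof.
move=> tT Ox [G cG GE].
have Qx : Q (t, x) by split => /=; [rewrite in_itv|exact: subset_closure].
move=> W; rewrite -(GE t x tT Ox) => GW.
have H : \forall p \near (t, x), Q p -> W (G p) := (subspace_continuousP _ _).1 cG _ Qx W GW.
have near1 : \forall p \near (t, x), (`]0, T[%classic `*` Omega) p.
  exists (`]0, T[%classic, Omega) => //=; split; last exact: (open_nbhs_nbhs (conj oO Ox)).
  by apply: open_nbhs_nbhs; split; [exact: interval_open|rewrite /= in_itv].
move: H near1; apply: filterS2 => -[s y] /= H [/= hs Oy].
rewrite in_itv/= in hs; rewrite -(GE s y hs Oy); apply: H.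
by split => /=; [rewrite in_itv|exact: subset_closure].
Qed.

Lemma cub_time_continuous g t x : 0 < t < T -> Omega x -> cub g -> {for t, continuous (g^~ x)}.
Proof.
move=> tT Ox cg W Wg.
have cp : (fun s : R => (s, x)) @ t --> (t, x).
  exact: (@cvg_pair _ _ _ (nbhs t) (nbhs t) (nbhs x) _ _ _ id (cst x) cvg_id (cvg_cst x)).
exact: (cp _ (cub_continuous_at tT Ox cg Wg)).
Qed.

Lemma cub_bounded_continuous g t : 0 < t < T -> cub g -> bounded_continuous Omega (g t).
Proof.
move=> tT /(cub_slice tT)[G cG GE].
apply: (eq_bounded_continuous oO GE); exact: bounded_continuous_closure.
Qed.

(** The primitive in time is continuous in space because g is continuous in x uniformly for t
    in [a, b]. *)
Lemma cub_antiderivative g a b t0 : 0 < a -> b < T -> a < t0 < b -> cub g ->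
  exists W : R -> 'rV[R]_n -> R,
    [/\ forall t x, a < t < b -> Omega x -> is_derive t (1 : R) (W^~ x) (g t x),
        forall x, W t0 x = 0,
        forall t, a < t < b -> bounded_continuous Omega (W t) &
        exists2 C : R, 0 <= C & forall t x, a < t < b -> Omega x -> `|W t x| <= C].
Proof.
move=> a0 bT /andP[at0 t0b] cg.
have ab : a < b := lt_trans at0 t0b.
have tin t : a <= t <= b -> 0 < t < T.
  by move=> /andP[a1 b1]; rewrite (lt_le_trans a0 a1) (le_lt_trans b1 bT).
have /choice[Phi HPhi] : forall x, exists P : R -> R, Omega x ->
    forall s, a < s < b -> is_derive s (1 : R) P (g s x).
  move=> x; have [Ox|nOx] := pselect (Omega x); last by exists (cst 0).
  have [P HP] := antiderivative ab (fun s hs => cub_time_continuous (tin _ hs) Ox cg).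
  by exists P.
pose W t x := Phi x t - Phi x t0.
have dW t x : a < t < b -> Omega x -> is_derive t (1 : R) (W^~ x) (g t x).
  move=> tab Ox; have := is_deriveB_fun (HPhi x Ox t tab) (is_derive_cst (Phi x t0) t (1 : R)).
  by rewrite subr0.
have W0 x : W t0 x = 0 by rewrite /W subrr.
have betw t s : a < t < b -> Num.min t0 t <= s <= Num.max t0 t -> a < s < b.
  move=> /andP[at_ tb] /andP[s1 s2]; apply/andP; split.
    by apply: lt_le_trans s1; rewrite lt_min at0.
  by apply: le_lt_trans s2 _; rewrite gt_max t0b.
have [C C0 HC] := cub_bounded a0 bT cg.
have WC t x : a < t < b -> Omega x -> `|W t x| <= C * (b - a).
  move=> tab Ox; rewrite -[W t x]subr0 -(W0 x).
  apply: (le_trans (@mean_value_le _ (W^~ x) (g^~ x) t0 t C _)).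
    move=> s /(betw t s tab) sab; split; first exact: dW.
    by apply: HC => //; case/andP: sab => ? ?; rewrite !ltW.
  rewrite ler_wpM2l// ler_norml; case/andP: tab => ? ?.
  by apply/andP; split; lra.
exists W; split => //; last first.
  by exists (C * (b - a)) => //; rewrite mulr_ge0// subr_ge0 ltW.
move=> t tab; split; last first.
  by exists (C * (b - a)); [rewrite mulr_ge0// subr_ge0 ltW|move=> x Ox; exact: WC].
move=> x Ox; apply: (@cvgrPdist_le _ _ _ (nbhs x) (nbhs_filter x) (W t) (W t x)).2 => e e0.
have e'0 : 0 < e / (b - a) / 2 by rewrite !divr_gt0// subr_gt0.
have unif : \forall y \near x, [set` `[a, b]] `<=`
    (fun s => Omega y -> `|g s y - g s x| <= e / (b - a)).
  apply: ((compact_near_coveringP _).1 (@segment_compact _ a b) _ (nbhs x)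
    (fun y s => Omega y -> `|g s y - g s x| <= e / (b - a)) (nbhs_filter x)).
  move=> s; rewrite /= in_itv/= => /tin sT.
  have := cub_continuous_at sT Ox cg => /cvgrPdist_le /(_ _ e'0) H1.
  have := cub_time_continuous sT Ox cg => /cvgrPdist_le /(_ _ e'0) H2.
  have H3 : \forall p \near (s, x), `|g s x - g p.1 x| <= e / (b - a) / 2.
    have c1 : (fun p : R * 'rV[R]_n => p.1) @ (s, x) --> s by exact: cvg_fst.
    exact: (c1 _ H2).
  move: H1 H3; apply: filterS2 => -[s' y] /= h1 h2 _.
  have -> : g s' y - g s' x = (g s x - g s' x) - (g s x - g s' y) by ring.
  rewrite (le_trans (ler_normB _ _))//.
  have -> : e / (b - a) = e / (b - a) / 2 + e / (b - a) / 2 by field; rewrite gt_eqF ?subr_gt0.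
  exact: lerD.
move: unif (open_nbhs_nbhs (conj oO Ox)); apply: filterS2 => y Hy Oy.
rewrite distrC -[W t y - W t x]subr0.
have w00 : W t0 y - W t0 x = 0 by rewrite !W0 subrr.
rewrite -[X in `|_ - X|]w00.
apply: (le_trans (@mean_value_le _ (fun s => W s y - W s x) (fun s => g s y - g s x) t0 t (e / (b - a)) _)).
  move=> s /(betw t s tab) sab; split.
    by apply: is_deriveB_fun; exact: dW.
  by apply: Hy => //=; rewrite in_itv/=; case/andP: sab => ? ?; rewrite !ltW.
rewrite mulrAC ler_pdivrMr ?subr_gt0// ler_wpM2l ?(ltW e0)// ler_norml.
case/andP: tab => ? ?; apply/andP; split; lra.
Qed.

End up_to_boundary.

(** * Derivatives of the solution and of its flows *)

Section smooth.
Context {R : realType}.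

(** Ck_on only speaks of partial derivatives; their continuity gives the first-order expansion. *)
Lemma Ck_on_has_gradient n (U : set 'rV[R]_n) (g : 'rV[R]_n -> R) x :
  open U -> U x -> Ck_on 1 U g -> has_gradient g x (fun j => 'D_('e_j) g x).
Proof.
move=> oU Ux [_ H]; apply: (has_gradient_C1 (dg := fun j => 'D_('e_j) g) oU Ux).
  by move=> y j Uy; have [dj _] := H j; exact/derivableP/dj.
by move=> j; have [_ cj] := H j; exact: cj.
Qed.

Lemma is_derive_comp_row (V : normedModType R) N (D : 'rV[R]_N -> R) (w : V -> 'rV[R]_N)
    (x v : V) (G dw : 'I_N -> R) : has_gradient D (w x) G ->
  (forall i, is_derive x v (fun y => w y 0 i) (dw i)) ->
  is_derive x v (fun y => D (w y)) (\sum_i dw i * G i).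
Proof.
move=> HD Hw.
have x0 : x = x + (0 : R) *: v by rewrite scale0r addr0.
rewrite [x in is_derive x]x0; apply: (is_derive_lineE (fun y => D (w y)) x v 0 _).2.
have w0 : w (x + (0 : R) *: v) = w x by rewrite -x0.
have dw0 i : is_derive (0 : R) (1 : R) (fun s : R => w (x + s *: v) 0 i) (dw i).
  by apply: (is_derive_lineE (fun y => w y 0 i) x v 0 _).1; rewrite -x0; exact: Hw.
exact: (is_derive_curve (c := fun s : R => w (x + s *: v)) HD w0 dw0).
Qed.

End smooth.

Section solution.
Context {R : realType} {n N : nat}.
Variables (Omega : set 'rV[R]_n.+1) (oO : open Omega) (bO : bounded_set Omega).
Variables (tau : 'rV[R]_N) (d f : 'rV[R]_N -> 'rV[R]_N) (u0 : 'rV[R]_n.+1 -> 'rV[R]_N).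
Variables (T : R) (u : R -> 'rV[R]_n.+1 -> 'rV[R]_N).
Hypothesis sol : positive_classical_solution Omega tau d f u0 T u.
Variable D : 'I_N -> 'rV[R]_N -> R.
Hypotheses (D_smooth : forall i, smooth_on [set: 'rV[R]_N] (D i))
  (D_d : forall i v, orthant v -> D i v = d v 0 i).
Local Notation cub := (continuous_up_to_boundary T Omega).

Definition comp_u i t x : R := u t x 0 i.
Definition dx_u i j t : 'rV[R]_n.+1 -> R := 'D_('e_j) (comp_u i t).
Definition dxx_u i j t : 'rV[R]_n.+1 -> R := 'D_('e_j) (dx_u i j t).
Definition dt_u i t x : R := derive1 (fun s => comp_u i s x) t.
Definition dD i k : 'rV[R]_N -> R := 'D_('e_k) (D i).
Definition ddD i k l : 'rV[R]_N -> R := 'D_('e_l) (dD i k).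

(** The function d_i(u) u_i whose Laplacian drives the equation, with d_i replaced by a smooth
    extension D i so that the chain rule applies also where u_i = 0. *)
Definition flow i t x : R := D i (u t x) * comp_u i t x.
Definition dflow i j t x : R :=
  (\sum_k dx_u k j t x * dD i k (u t x)) * comp_u i t x + D i (u t x) * dx_u i j t x.
Definition ddflow i j t x : R :=
  (\sum_k (dxx_u k j t x * dD i k (u t x) +
           dx_u k j t x * \sum_l dx_u l j t x * ddD i k l (u t x))) * comp_u i t x
  + (\sum_k dx_u k j t x * dD i k (u t x)) * dx_u i j t x
  + ((\sum_k dx_u k j t x * dD i k (u t x)) * dx_u i j t x + D i (u t x) * dxx_u i j t x).

Lemma continuous_D i : continuous (D i).
Proof. by move=> v; exact: (D_smooth i 0%N). Qed.

Lemma continuous_dD i k : continuous (dD i k).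
Proof. by move=> v; have [_ /(_ k)[_ H]] := D_smooth i 1%N; exact: H. Qed.

Lemma continuous_ddD i k l : continuous (ddD i k l).
Proof.
by move=> v; have [_ /(_ k)[_ [_ /(_ l)[_ H]]]] := D_smooth i 2%N; exact: H.
Qed.

Lemma gradient_D i v : has_gradient (D i) v (fun k => dD i k v).
Proof. by apply: (Ck_on_has_gradient openT) => //; exact: D_smooth. Qed.

Lemma gradient_dD i k v : has_gradient (dD i k) v (fun l => ddD i k l v).
Proof.
apply: (Ck_on_has_gradient openT) => //.
by have [_ /(_ k)[_ H]] := D_smooth i 2%N.
Qed.

Lemma is_derive_comp_u i j t x : 0 < t < T -> Omega x ->
  is_derive x 'e_j (comp_u i t) (dx_u i j t x).
Proof.
move=> tT Ox; have [H _ _ _ _] := sol_C21 sol i.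
by have [_ /(_ j)[dj _]] := H t x tT Ox; exact: derivableP.
Qed.

Lemma is_derive_dx_u i j t x : 0 < t < T -> Omega x ->
  is_derive x 'e_j (dx_u i j t) (dxx_u i j t x).
Proof.
move=> tT Ox; have [H _ _ _ _] := sol_C21 sol i.
by have [_ /(_ j)[_ /(_ j) dj]] := H t x tT Ox; exact: derivableP.
Qed.

Lemma is_derive_dt_u i t x : 0 < t < T -> Omega x ->
  is_derive t (1 : R) (fun s => comp_u i s x) (dt_u i t x).
Proof.
move=> tT Ox; have [H _ _ _ _] := sol_C21 sol i.
have [dt _] := H t x tT Ox; rewrite /dt_u derive1E; exact: derivableP.
Qed.

Lemma is_derive_flow i j t x : 0 < t < T -> Omega x ->
  is_derive x 'e_j (flow i t) (dflow i j t x).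
Proof.
move=> tT Ox; apply: is_deriveM_fun; last exact: is_derive_comp_u.
apply: is_derive_comp_row; first exact: gradient_D.
by move=> k; exact: is_derive_comp_u.
Qed.

Lemma is_derive_dflow i j t x : 0 < t < T -> Omega x ->
  is_derive x 'e_j (dflow i j t) (ddflow i j t x).
Proof.
move=> tT Ox.
have dDu k : is_derive x 'e_j (fun y => dD i k (u t y)) (\sum_l dx_u l j t x * ddD i k l (u t x)).
  apply: is_derive_comp_row; first exact: gradient_dD.
  by move=> l; exact: is_derive_comp_u.
have dDv : is_derive x 'e_j (fun y => D i (u t y)) (\sum_k dx_u k j t x * dD i k (u t x)).
  apply: is_derive_comp_row; first exact: gradient_D.
  by move=> k; exact: is_derive_comp_u.
have ddrift : is_derive x 'e_j (fun y => \sum_k dx_u k j t y * dD i k (u t y))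
    (\sum_k (dxx_u k j t x * dD i k (u t x) +
      dx_u k j t x * \sum_l dx_u l j t x * ddD i k l (u t x))).
  by apply: is_derive_sum_fun => k; exact: (is_deriveM_fun (is_derive_dx_u k j tT Ox) (dDu k)).
exact: (is_deriveD_fun (is_deriveM_fun ddrift (is_derive_comp_u i j tT Ox))
  (is_deriveM_fun dDv (is_derive_dx_u i j tT Ox))).
Qed.

Lemma u_orthant t x : 0 < t < T -> Omega x -> orthant (u t x).
Proof.
move=> /andP[t0 tT] Ox; apply: (sol_ge0 sol); first by rewrite ltW.
exact: subset_closure.
Qed.

Lemma cub_u i : cub (comp_u i).
Proof. by have [_ H _ _ _] := sol_C21 sol i. Qed.

Lemma cub_dx_u i j : cub (dx_u i j).
Proof. by have [_ _ _ H _] := sol_C21 sol i; exact: H. Qed.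

Lemma cub_dxx_u i j : cub (dxx_u i j).
Proof. by have [_ _ _ _ H] := sol_C21 sol i; exact: H. Qed.

Lemma cub_dt_u i : cub (dt_u i).
Proof. by have [_ _ H _ _] := sol_C21 sol i. Qed.

Lemma cub_D i : cub (fun t x => D i (u t x)).
Proof. exact: (cub_rowcomp (@continuous_D i) cub_u). Qed.

Lemma cub_dD i k : cub (fun t x => dD i k (u t x)).
Proof. exact: (cub_rowcomp (@continuous_dD i k) cub_u). Qed.

Lemma cub_ddD i k l : cub (fun t x => ddD i k l (u t x)).
Proof. exact: (cub_rowcomp (@continuous_ddD i k l) cub_u). Qed.

Lemma cub_flow i : cub (flow i).
Proof. by apply: cubM; [exact: cub_D|exact: cub_u]. Qed.

Lemma cub_drift i j : cub (fun t x => \sum_k dx_u k j t x * dD i k (u t x)).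
Proof. by apply: cub_sum => k; apply: cubM; [exact: cub_dx_u|exact: cub_dD]. Qed.

Lemma cub_dflow i j : cub (dflow i j).
Proof.
apply: cubD; apply: cubM; [exact: cub_drift|exact: cub_u|exact: cub_D|exact: cub_dx_u].
Qed.

Lemma cub_ddflow i j : cub (ddflow i j).
Proof.
apply: cubD; [apply: cubD|apply: cubD]; apply: cubM.
- apply: cub_sum => k; apply: cubD; apply: cubM.
  + exact: cub_dxx_u.
  + exact: cub_dD.
  + exact: cub_dx_u.
  + by apply: cub_sum => l; apply: cubM; [exact: cub_dx_u|exact: cub_ddD].
- exact: cub_u.
- exact: cub_drift.
- exact: cub_dx_u.
- exact: cub_drift.
- exact: cub_dx_u.
- exact: cub_D.
- exact: cub_dxx_u.
Qed.

(** The Laplacian of d_i(u) u_i is computed through the explicit formulas of the chain rule,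
    which are continuous up to the boundary. *)
Lemma solution_equation i t x : 0 < t < T -> Omega x ->
  f (u t x) 0 i = tau 0 i * dt_u i t x - \sum_j ddflow i j t x.
Proof.
move=> tT Ox; rewrite -(sol_equation sol i tT Ox); congr (_ - _).
have nearO y : Omega y -> \forall z \near y, d (u t z) 0 i * u t z 0 i = flow i t z.
  move=> Oy; apply: filterS (open_nbhs_nbhs (conj oO Oy)) => z Oz.
  by rewrite /flow D_d//; exact: u_orthant.
apply: eq_bigr => j _; apply/esym.
have near1 : \forall y \near x, dflow i j t y = 'D_('e_j) (fun y => d (u t y) 0 i * u t y 0 i) y.
  apply: filterS (open_nbhs_nbhs (conj oO Ox)) => y Oy.
  rewrite (near_eq_derive _ (nearO y Oy)).
  by case: (is_derive_flow i j tT Oy).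
have := near_eq_is_derive near1 (is_derive_dflow i j tT Ox).
by case=> _ <-.
Qed.

End solution.

(** * The Neumann condition *)

Section neumann.
Context {R : realType} {n : nat}.
Variable Omega : set 'rV[R]_n.+1.

(** Along the outer normal the defining function has derivative |grad rho| > 0. *)
Lemma inward_normal x nu : outer_unit_normal Omega x nu ->
  \forall s \near (0 : R), s < 0 -> Omega (x + s *: nu).
Proof.
move=> [[cx _] [U [rho [Urho nuE]]]].
have [oU Ux sr gn0 UO] := Urho.
have rx : rho x <= 0.
  rewrite leNgt; apply/negP => rx.
  have near1 : \forall y \near x, U y /\ 0 < rho y.
    apply: filterI; first exact: open_nbhs_nbhs.
    have := defining_continuous Urho Ux => /cvgr_gt; exact.
  have [y [Oy [Uy ry]]] := cx _ near1.
  by have := (UO y Uy).1 Oy; rewrite ltNge (ltW ry).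
pose L := \sum_i nu 0 i * 'D_('e_i) rho x.
have L0 : 0 < L.
  have g0 := enorm_gt0 (gn0 _ Ux).
  have -> : L = enorm (gradient rho x).
    rewrite /L nuE; apply: (@etrans _ _ ((enorm (gradient rho x))^-1 * enorm (gradient rho x) ^+ 2)).
      rewrite enorm_sqr mulr_sumr; apply: eq_bigr => i _; rewrite !mxE expr2 mulrA; ring.
    by rewrite expr2 mulKf// gt_eqF.
  by [].
have dr : is_derive x nu rho L.
  by apply: has_gradient_dir; apply: Ck_on_has_gradient oU Ux (sr 1%N).
have {}dr : is_derive (0 : R) (1 : R) (fun s : R => rho (x + s *: nu)) L.
  by apply: (is_derive_lineE rho x nu 0 _).1; rewrite scale0r addr0.
have cx0 : (fun s : R => x + s *: nu) @ (0 : R) --> x.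
  rewrite -[X in _ --> X]addr0 -[X in _ + X](scale0r nu).
  by apply: cvgD; [exact: cvg_cst|apply: cvgZl; exact: cvg_id].
have nU : \forall s \near (0 : R), U (x + s *: nu) := cx0 _ (open_nbhs_nbhs (conj oU Ux)).
move/is_derive_quotP : dr => /cvgr_gt /(_ _ L0); rewrite near_withinE => ng.
move: nU ng; apply: filterS2 => s Us hs s0.
have := hs (ltr0_neq0 s0); rewrite scale0r addr0 add0r => q.
apply/(UO _ Us); apply: lt_le_trans rx.
by rewrite -subr_lt0; rewrite nmulr_rgt0 ?invr_lt0 in q.
Qed.

(** The Neumann condition is a one-sided difference quotient at the boundary. By the mean value
    theorem on the inner half of the normal, this quotient is a value of F . nu at a nearby interior
    point, and F is continuous up to the boundary. *)
Lemma neumann_flux (phi : 'rV[R]_n.+1 -> R) (F : 'I_n.+1 -> 'rV[R]_n.+1 -> R) x nu :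
  outer_unit_normal Omega x nu -> {within closure Omega, continuous phi} ->
  (forall y, Omega y -> has_gradient phi y (fun j => F j y)) ->
  (forall j, {within closure Omega, continuous (F j)}) ->
  is_derive_in (closure Omega) phi x nu 0 -> \sum_j F j x * nu 0 j = 0.
Proof.
move=> xnu cphi gphi cF dphi.
have cx : closure Omega x by case: xnu => -[].
pose q y := \sum_j F j y * nu 0 j.
have cq : {within closure Omega, continuous q}.
  by move=> y; apply: cvg_sum_real => j; apply: cvgMr_tmp; exact: cF.
have cx0 : (fun s : R => x + s *: nu) @ (0 : R) --> x.
  rewrite -[X in _ --> X]addr0 -[X in _ + X](scale0r nu).
  by apply: cvgD; [exact: cvg_cst|apply: cvgZl; exact: cvg_id].
apply/eqP; rewrite -normr_le0; apply: (@ler_all_pos _ _ 2) => // e e0.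
have n1 : \forall s \near (0 : R), closure Omega (x + s *: nu) -> `|q x - q (x + s *: nu)| <= e.
  have := (subspace_continuousP _ _).1 cq x cx => /cvgrPdist_le /(_ _ e0) H.
  exact: cx0 _ H.
have n2 : \forall s \near (0 : R), s != 0 -> closure Omega (x + s *: nu) ->
    `|s^-1 * (phi (x + s *: nu) - phi x)| <= e.
  move: dphi => /cvgrPdist_le /(_ _ e0) H.
  have H2 : \forall s \near (0 : R), s != 0 -> closure Omega (x + s *: nu) ->
    `|0 - s^-1 * (phi (x + s *: nu) - phi x)| <= e := H.
  by apply: filterS H2 => s; rewrite sub0r normrN.
have n3 := inward_normal xnu.
have nall : \forall s \near (0 : R),
    (closure Omega (x + s *: nu) -> `|q x - q (x + s *: nu)| <= e) /\
    ((s != 0 -> closure Omega (x + s *: nu) ->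
      `|s^-1 * (phi (x + s *: nu) - phi x)| <= e) /\
     (s < 0 -> Omega (x + s *: nu))).
  by move: n1 n2 n3; apply: filterS3 => s.
have /nbhs_ballP[del /= del0 Hdel] := nall.
pose h := - (del / 2).
have h0 : h < 0 by rewrite oppr_lt0 divr_gt0.
have inb s : h <= s <= 0 -> ball 0 del s.
  move=> /andP[hs s0]; rewrite /ball/= sub0r normrN ler0_norm//.
  by rewrite /h in hs; lra.
have inO s : h <= s -> s < 0 -> Omega (x + s *: nu).
  by move=> hs s0; apply: (Hdel s _).2.2 => //; apply: inb; rewrite hs ltW.
have cl s : h <= s <= 0 -> closure Omega (x + s *: nu).
  move=> /andP[hs]; rewrite le_eqVlt => /orP[/eqP ->|s0]; first by rewrite scale0r addr0.
  by apply: subset_closure; exact: inO.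
have cline : {within `[h, 0], continuous (fun s : R => phi (x + s *: nu))}.
  apply/subspace_continuousP => s; rewrite /= in_itv/= => hs.
  move=> V HV; have H := (subspace_continuousP _ _).1 cphi _ (cl s hs) V HV.
  have cs : (fun s' : R => x + s' *: nu) @ s --> x + s *: nu.
    by apply: cvgD; [exact: cvg_cst|apply: cvgZl; exact: cvg_id].
  have H2 : \forall s' \near s, closure Omega (x + s' *: nu) -> V (phi (x + s' *: nu)) := cs _ H.
  by apply: filterS H2 => s' Hs'; rewrite /= in_itv/= => hs'; apply: Hs'; exact: cl.
have dline s : s \in `]h, 0[%R -> is_derive s (1 : R) (fun s : R => phi (x + s *: nu)) (q (x + s *: nu)).
  rewrite in_itv/= => /andP[/ltW hs s0].
  apply: (is_derive_lineE phi x nu s _).1.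
  have -> : q (x + s *: nu) = \sum_i nu 0 i * F i (x + s *: nu).
    by apply: eq_bigr => i _; rewrite mulrC.
  by apply: has_gradient_dir; apply: gphi; exact: inO.
have [c] := MVT h0 dline cline.
rewrite in_itv/= scale0r addr0 sub0r => /andP[/ltW hc c0] E.
have hh0 : h <= h <= 0 by rewrite lexx ltW.
have hc0 : h <= c <= 0 by rewrite hc ltW.
have e1 := (Hdel c (inb c hc0)).1 (cl c hc0).
have e2 := (Hdel h (inb h hh0)).2.1 (ltr0_neq0 h0) (cl h hh0).
have Eq : h^-1 * (phi (x + h *: nu) - phi x) = q (x + c *: nu).
  have -> : phi (x + h *: nu) - phi x = q (x + c *: nu) * h by move: E; rewrite mulrN; lra.
  by rewrite [LHS]mulrC mulfK// ltr0_neq0.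
rewrite Eq in e2.
rewrite -/(q x) -[q x](subrK (q (x + c *: nu))) (le_trans (ler_normD _ _))//.
by lra.
Qed.

End neumann.

Section flow_flux.
Context {R : realType} {n N : nat}.
Variables (Omega : set 'rV[R]_n.+1) (oO : open Omega) (bO : bounded_set Omega).
Variables (tau : 'rV[R]_N) (d f : 'rV[R]_N -> 'rV[R]_N) (u0 : 'rV[R]_n.+1 -> 'rV[R]_N).
Variables (T : R) (u : R -> 'rV[R]_n.+1 -> 'rV[R]_N).
Hypothesis sol : positive_classical_solution Omega tau d f u0 T u.
Variable D : 'I_N -> 'rV[R]_N -> R.
Hypotheses (D_smooth : forall i, smooth_on [set: 'rV[R]_N] (D i))
  (D_d : forall i v, orthant v -> D i v = d v 0 i).

Lemma u_slice_continuous t : 0 <= t < T -> {within closure Omega, continuous (u t)}.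
Proof.
move=> tT; apply/subspace_continuousP => x cx W GW.
have Qx : (`[0, T[%classic `*` closure Omega) (t, x) by split => //=; rewrite in_itv.
have H := (subspace_continuousP _ _).1 (sol_continuous sol) _ Qx W GW.
have cp : (fun y : 'rV[R]_n.+1 => (t, y)) @ x --> (t, x).
  exact: (@cvg_pair _ _ _ (nbhs x) (nbhs t) (nbhs x) _ _ _ (cst t) id (cvg_cst t) cvg_id).
have H2 : \forall y \near x, (`[0, T[%classic `*` closure Omega) (t, y) -> W (u t y) := cp _ H.
by apply: filterS H2 => y Hy cy; apply: Hy; split => //=; rewrite in_itv.
Qed.

(** The gradient of the i-th flow extends to the closure, and the Neumann condition makes the
    extension tangent. *)
Lemma flow_no_flux i t : 0 < t < T -> exists2 F : 'I_n.+1 -> 'rV[R]_n.+1 -> R,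
  no_flux Omega F (fun j => ddflow u D i j t) &
  forall j x, Omega x -> F j x = dflow u D i j t x.
Proof.
move=> tT; have /andP[t0 tT'] := tT.
have /choice[F HF] : forall j, exists F : 'rV[R]_n.+1 -> R,
    {within closure Omega, continuous F} /\ forall x, Omega x -> F x = dflow u D i j t x.
  by move=> j; have [F cF FE] := cub_slice tT (cub_dflow sol D_smooth i j); exists F.
exists F; last by move=> j x; exact: (HF j).2.
split.
- move=> j x Ox; apply: near_eq_is_derive (is_derive_dflow sol D_smooth i j tT Ox).
  by apply: filterS (open_nbhs_nbhs (conj oO Ox)) => y Oy; rewrite (HF j).2.
- move=> j; exact: (cub_bounded_continuous oO bO tT (cub_ddflow sol D_smooth i j)).
- by move=> j; exact: (HF j).1.
move=> x nu xnu.
have phiE y : closure Omega y -> d (u t y) 0 i * u t y 0 i = flow u D i t y.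
  by move=> cy; rewrite /flow D_d//; apply: (sol_ge0 sol) => //; rewrite ltW.
refine (neumann_flux (phi := fun y => d (u t y) 0 i * u t y 0 i) (F := F) xnu _ _ _
  (sol_neumann sol i tT xnu)) => /=.
- have cu := u_slice_continuous (t := t); rewrite (ltW t0) tT' in cu.
  have cflow : {within closure Omega, continuous (flow u D i t)}.
    move=> y; apply: cvgM.
      exact: (@continuous_comp _ _ _ (u t : subspace (closure Omega) -> _) (D i) y
        (cu isT y) (D_smooth i 0%N (u t y) I)).
    exact: (@continuous_comp _ _ _ (u t : subspace (closure Omega) -> _)
      (fun v : 'rV[R]_N => v 0 i) y (cu isT y) (@coord_continuous R _ _ 0 i (u t y))).
  by apply: subspace_eq_continuous cflow => y; rewrite inE => cy; exact: (esym (phiE y cy)).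
- move=> y Oy.
  have g1 : has_gradient (flow u D i t) y (fun j => dflow u D i j t y).
    apply: (has_gradient_C1 (dg := fun j => dflow u D i j t) oO Oy).
      by move=> z j Oz; exact: (is_derive_flow sol D_smooth i j tT Oz).
    move=> j; exact: (cub_bounded_continuous oO bO tT (cub_dflow sol D_smooth i j)).1.
  move=> e e0.
  have near0 : \forall v \near (0 : 'rV[R]_n.+1), Omega (y + v).
    have c0 : (fun v : 'rV[R]_n.+1 => y + v) @ (0 : 'rV[R]_n.+1) --> y.
      by rewrite -[X in _ --> X]addr0; exact: (@cvgD _ _ _ (nbhs (0 : 'rV[R]_n.+1)) _ (cst y) id y 0 (cvg_cst y) cvg_id).
    exact: (c0 _ (open_nbhs_nbhs (conj oO Oy))).
  move: near0 (g1 e e0); apply: filterS2 => v Oyv.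
  rewrite !phiE; [|exact: subset_closure..].
  by under [X in _ -> `|_ - X| <= _]eq_bigr do rewrite (HF _).2//.
- by move=> j; exact: (HF j).1.
Qed.

End flow_flux.

(** * Integration by parts against a scalar and the structure matrix *)

Section green_scalar.
Context {R : realType} {n : nat}.
Variables (Omega : set 'rV[R]_n.+1) (oO : open Omega) (bO : bounded_set Omega).
Hypothesis sO : smooth_boundary Omega.

(** The product rule div (psi F) = grad psi . F + psi div F turns the divergence theorem into an
    integration by parts without boundary term. *)
Lemma green_scalar F dF psi dpsi Psi : no_flux Omega F dF ->
  {within closure Omega, continuous Psi} -> (forall x, Omega x -> Psi x = psi x) ->
  (forall j x, Omega x -> is_derive x 'e_j psi (dpsi j x)) ->
  (forall j, bounded_continuous Omega (dpsi j)) ->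
  integral_on Omega (fun x => \sum_j (dpsi j x * F j x + psi x * dF j x)) = 0.
Proof.
move=> HF cPsi PsiE dP bdp.
have HPsi : C1_on Omega Psi dpsi.
  split => // j x Ox; apply: near_eq_is_derive (dP j x Ox).
  by apply: filterS (open_nbhs_nbhs (conj oO Ox)) => y Oy; rewrite PsiE.
have := green oO bO sO (no_fluxM oO bO HF HPsi).
apply: etrans; apply: eq_integral_on => x Ox; apply: eq_bigr => j _.
by rewrite PsiE.
Qed.

(** Lets a fixed time t enter an estimate in which another time s varies. *)
Lemma cub_freeze T g t : 0 < t < T -> continuous_up_to_boundary T Omega g ->
  continuous_up_to_boundary T Omega (fun _ x => g t x).
Proof.
move=> tT /(cub_slice tT)[G cG GE]; exists (fun p => G p.2); last first.
  by move=> s x _ Ox; exact: GE.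
apply/subspace_continuousP => -[s x] [/= sT cx] W GW.
have H : \forall y \near x, closure Omega y -> W (G y) := (subspace_continuousP _ _).1 cG x cx W GW.
have c2 : (fun p : R * 'rV[R]_n.+1 => p.2) @ (s, x) --> x by exact: cvg_snd.
have H2 : \forall p \near (s, x), closure Omega p.2 -> W (G p.2) := c2 _ H.
by apply: filterS H2 => p Hp [_ cp]; exact: Hp.
Qed.

End green_scalar.

Section structure.
Context {R : realType} {N : nat}.
Variables (d : 'rV[R]_N -> 'rV[R]_N) (D : 'I_N -> 'rV[R]_N -> R).
Hypotheses (D_smooth : forall i, smooth_on [set: 'rV[R]_N] (D i))
  (D_d : forall i v, orthant v -> D i v = d v 0 i).

(** The relative derivative only sees increments that stay in the orthant, among them all small
    positive ones: it agrees with the derivative of the smooth extension. *)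
Lemma derive_in_orthant i k v : orthant v ->
  derive_in (@orthant R N) (fun w => d w 0 i) v 'e_k = dD D i k v.
Proof.
move=> ov.
have op h : 0 <= h -> orthant (v + h *: 'e_k).
  move=> h0 j; rewrite !mxE addr_ge0 ?ov//.
  by rewrite eqxx /=; case: (_ == _); rewrite ?mulr1// mulr0.
have PF : ProperFilter (within [set h : R | orthant (v + h *: 'e_k)] 0^').
  split; last exact: within_filter.
  rewrite /within /= /dnbhs /within /= => /nbhs_ballP[e /= e0 He].
  have he : 0 < e / 2 by rewrite divr_gt0.
  apply: (He (e / 2)); last by apply: op; exact: ltW.
    by rewrite /ball/= sub0r normrN gtr0_norm// ltr_pdivrMr// ltr_pMr// ltr1n.
  by rewrite gt_eqF.
apply: cvg_lim => //.
have dq : (fun h : R => h^-1 * (D i (v + h *: 'e_k) - D i v)) @ 0^' --> dD D i k v.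
  have H : is_derive v 'e_k (D i) (dD D i k v).
    have := has_gradient_dir 'e_k (gradient_D D_smooth i v).
    congr is_derive; rewrite (bigD1 k)//= !mxE !eqxx mul1r big1 ?addr0// => l lk.
    by rewrite mxE (negbTE lk) andbF mul0r.
  have {}H : is_derive (0 : R) (1 : R) (fun s : R => D i (v + s *: 'e_k)) (dD D i k v).
    by apply: (is_derive_lineE (D i) v 'e_k 0 _).1; rewrite scale0r addr0.
  move/is_derive_quotP : H; rewrite scale0r addr0.
  by under eq_fun do rewrite add0r.
rewrite /diff_quotient_in.
have dq' : (fun h : R => h^-1 * (D i (v + h *: 'e_k) - D i v)) @
  within [set h : R | orthant (v + h *: 'e_k)] 0^' --> dD D i k v by exact: cvg_within_filter.
apply: cvg_trans dq'; apply: near_eq_cvg.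
by rewrite near_withinE; apply: nearW => h /= oh; rewrite !D_d.
Qed.

Lemma structure_matrixE v : orthant v -> structure_matrix d v =
  \matrix_(i, j) ((dD D i j v + dD D j i v) * (v 0 i * v 0 j)
     + ((i == j)%:R * D i v * v 0 j + (j == i)%:R * D j v * v 0 i)).
Proof.
by move=> ov; apply/matrixP => i j; rewrite !mxE !derive_in_orthant// !D_d.
Qed.

End structure.

Section inner_exhaustion.
Context {R : realType} {n : nat}.
Variables (Omega : set 'rV[R]_n) (oO : open Omega) (bO : bounded_set Omega).

(** The points at distance at least 1 / (k + 1) from the complement form compact sets that exhaust
    the domain. *)
Lemma inner_compact (th : R) : 0 < th -> exists2 K : set 'rV[R]_n,
  [/\ compact K, K `<=` Omega & open (Omega `\` K)] & volume (Omega `\` K) <= th.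
Proof.
move=> th0.
pose K (k : nat) : set 'rV[R]_n := [set x | ball x k.+1%:R^-1 `<=` Omega].
have k0 (k : nat) : 0 < k.+1%:R^-1 :> R by rewrite invr_gt0.
have KO k : K k `<=` Omega by move=> x; apply; exact: ballxx.
have KC k : ~` K k = \bigcup_(y in ~` Omega) ball y k.+1%:R^-1.
  apply/seteqP; split => x.
    by move=> /existsNP[y /not_implyP[xy nOy]]; exists y => //; exact: ball_sym.
  by move=> [y nOy yx] Kx; apply: nOy; apply: Kx; exact: ball_sym.
have oKC k : open (~` K k) by rewrite KC; apply: bigcup_open => y _; exact: ball_open.
have cK k : compact (K k).
  apply: (@subclosed_compact _ _ (closure Omega)).
  - by rewrite -openC.
  - exact: closure_compact.
  - by apply: subset_trans (KO k) _; exact: subset_closure.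
pose A k := @row_of R n @^-1` (Omega `\` K k).
have oA k : open (Omega `\` K k) by rewrite setDE; exact: openI.
have mA k : measurable (A k) by exact: measurable_row_open.
have : lebesgue_tuple n (A k) @[k --> \oo] --> lebesgue_tuple n (\bigcap_k A k).
  apply: nonincreasing_cvg_mu => //.
  - apply: le_lt_trans (volume_lty oO bO); apply: le_measure; rewrite ?inE//.
      exact: measurable_row_open.
    by move=> z [].
  - exact: bigcapT_measurable.
  - move=> k m km; apply/subsetPset => z [Oz nK]; split => // Kk; apply: nK => y By.
    by apply: Kk; apply: le_ball By; rewrite lef_pV2 ?posrE// ler_nat.
have -> : \bigcap_k A k = set0.
  apply/seteqP; split => // z Hz; have [Oz _] := Hz 0%N I.
  have /nbhs_ballP[e /= e0 He] : nbhs (row_of z) Omega by exact: open_nbhs_nbhs.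
  have := Hz (Num.truncn e^-1) I => -[_]; apply => y By; apply: He; apply: le_ball By.
  by rewrite -[leRHS]invrK lef_pV2 ?posrE ?invr_gt0// ltW// truncnS_gt.
rewrite measure0 => cv.
have : \forall k \near \oo, (lebesgue_tuple n (A k) < th%:E)%E.
  by apply: (cv _ (open_ereal_lt' _)); rewrite lte_fin.
move=> [k _ /(_ k (leqnn k)) /= Hk].
exists (K k); first by split.
have bD : bounded_set (Omega `\` K k).
  by move: bO => [N [Nr HN]]; exists N; split=> // s Ns x [Ox _]; exact: HN Ox.
by rewrite -lee_fin volumeE// ltW.
Qed.

End inner_exhaustion.

(** * The regularized gradient near the zero set *)

Section gradient_small.
Context {R : realType} {n N : nat}.
Variables (Omega : set 'rV[R]_n.+1) (oO : open Omega) (bO : bounded_set Omega).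
Variables (tau : 'rV[R]_N) (d f : 'rV[R]_N -> 'rV[R]_N) (u0 : 'rV[R]_n.+1 -> 'rV[R]_N).
Variables (T : R) (u : R -> 'rV[R]_n.+1 -> 'rV[R]_N).
Hypothesis sol : positive_classical_solution Omega tau d f u0 T u.

(** Fermat's rule at a minimum. *)
Lemma is_derive_min0 (phi : R -> R) (L : R) : is_derive (0 : R) (1 : R) phi L ->
  phi 0 = 0 -> (\forall s \near (0 : R), 0 <= phi s) -> L = 0.
Proof.
move=> /is_derive_quotP dq phi0 near0.
have pick (P : set R) (s : bool) : (\forall h \near (0 : R)^', P h) ->
    exists h : R, [/\ P h, 0 <= phi h & if s then 0 < h else h < 0].
  rewrite near_withinE => HP.
  have HPP : \forall h \near (0 : R), (h != 0 -> P h) /\ 0 <= phi h by move: HP near0; apply: filterS2.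
  have /nbhs_ballP[e /= e0 He] := HPP.
  have he : 0 < e / 2 by rewrite divr_gt0.
  have hlt : e / 2 < e by rewrite ltr_pdivrMr// ltr_pMr// ltr1n.
  case: s.
    exists (e / 2); have [|H1 H2] := He (e / 2).
      by rewrite /ball/= sub0r normrN gtr0_norm.
    by split => //; apply: H1; rewrite gt_eqF.
  exists (- (e / 2)); have [|H1 H2] := He (- (e / 2)).
    by rewrite /ball/= sub0r opprK gtr0_norm.
  by split => //; [apply: H1; rewrite lt_eqF// oppr_lt0|rewrite oppr_lt0].
have [L0|L0|//] := ltgtP L 0.
- have H : \forall h \near (0 : R)^', h^-1 * (phi (0 + h) - phi 0) < 0.
    by move: dq => /cvgr_lt; apply.
  have [h [hq hp h0]] := pick _ true H.
  by move: hq; rewrite /= add0r phi0 subr0 ltNge mulr_ge0// invr_ge0 ltW.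
- have H : \forall h \near (0 : R)^', 0 < h^-1 * (phi (0 + h) - phi 0).
    by move: dq => /cvgr_gt; apply.
  have [h [hq hp h0]] := pick _ false H.
  by move: hq; rewrite /= add0r phi0 subr0 ltNge mulr_le0_ge0// invr_le0 ltW.
Qed.

(** A zero of u_k inside the domain is a minimum, since u_k is nonnegative. *)
Lemma dx_u_eq0 k j t x : 0 < t < T -> Omega x -> comp_u u k t x = 0 -> dx_u u k j t x = 0.
Proof.
move=> tT Ox ux0.
have dl : is_derive (0 : R) (1 : R) (fun s : R => comp_u u k t (x + s *: 'e_j)) (dx_u u k j t x).
  apply: (is_derive_lineE (comp_u u k t) x 'e_j 0 _).1; rewrite scale0r addr0.
  exact: (is_derive_comp_u sol k j tT Ox).
apply: (is_derive_min0 dl); first by rewrite scale0r addr0.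
have cx0 : (fun s : R => x + s *: 'e_j) @ (0 : R) --> x.
  rewrite -[X in _ --> X]addr0 -[X in _ + X](scale0r 'e_j).
  by apply: cvgD; [exact: cvg_cst|apply: cvgZl; exact: cvg_id].
have H : \forall s \near (0 : R), Omega (x + s *: 'e_j) := cx0 _ (open_nbhs_nbhs (conj oO Ox)).
by apply: filterS H => s Os; exact: (u_orthant sol tT Os).
Qed.

(** This bounds the error in the diffusion estimate. As eta tends to 0 the factor tends to 0 where
    u_k > 0, while the gradient vanishes where u_k = 0. *)
Definition degenerate_gradient (eta : R) k j t x : R :=
  eta / (comp_u u k t x + eta) * `|dx_u u k j t x|.

Lemma cub_degenerate_gradient eta k j : 0 < eta ->
  continuous_up_to_boundary T Omega (degenerate_gradient eta k j).
Proof.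
move=> eta0.
have c1 : continuous (fun s : R => eta / (Num.max s 0 + eta)).
  move=> s; apply: cvgM; first exact: cvg_cst.
  apply: cvgV; first by rewrite gt_eqF// ltr_wpDl// le_max lexx orbT.
  apply: cvgD; last exact: cvg_cst.
  by apply: (@continuous_max _ _ (fun s : R => s) (cst 0)); [exact: cvg_id|exact: cst_continuous].
apply: (eq_cub _ (cubM (cub_comp c1 (cub_u sol k)) (cub_comp (@norm_continuous _ R^o) (cub_dx_u sol k j)))).
by move=> t x tT Ox; rewrite /degenerate_gradient max_l//; exact: (u_orthant sol tT Ox).
Qed.

(** Outside a compact part of the domain the volume is small. On the compact part, the gradient is
    small where u_k < e, uniformly in time, and the factor is at most eta / e where u_k >= e. *)
Lemma degenerate_gradient_small a b k j (th : R) : 0 < a -> b < T -> 0 < th ->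
  \forall eta \near (0 : R)^'+, forall t, a <= t <= b ->
    integral_on Omega (degenerate_gradient eta k j t) <= th.
Proof.
move=> a0 bT th0.
have tin t : a <= t <= b -> 0 < t < T.
  by move=> /andP[a1 b1]; rewrite (lt_le_trans a0 a1) (le_lt_trans b1 bT).
have [C C0 HC] := cub_bounded bO a0 bT (cub_dx_u sol k j).
have th1 : 0 < th / 2 / (C + 1) by apply: divr_gt0; [rewrite divr_gt0|exact: ltr_wpDl].
(* K is chosen so that its complement contributes at most th / 2 under the crude bound C. *)
have [K [cK KO oOK] vK] := inner_compact oO bO th1.
have cKK : compact (`[a, b]%classic `*` K : set (R * 'rV[R]_n.+1)).
  by apply: compact_setX => //; exact: segment_compact.
have cin g : continuous_up_to_boundary T Omega g ->
    {within `[a, b]%classic `*` K, continuous (fun p : R * 'rV[R]_n.+1 => g p.1 p.2)}.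
  move=> cg; apply: continuous_in_subspaceT => -[t x]; rewrite inE => -[/= + Kx].
  by rewrite in_itv/= => /tin tT; apply: (cub_continuous_at oO tT (KO _ Kx) cg).
have vp := volume_ge0 Omega.
have th2 : 0 < th / 2 / (volume Omega + 1) by apply: divr_gt0; [rewrite divr_gt0|exact: ltr_wpDl].
have vanish p : (`[a, b]%classic `*` K) p -> comp_u u k p.1 p.2 = 0 -> dx_u u k j p.1 p.2 = 0.
  by move=> [/= p1 Kp]; apply: dx_u_eq0; [apply: tin; move: p1; rewrite in_itv|exact: KO].
have [e e0 He] := compact_vanish cKK (cin _ (cub_dx_u sol k j)) (cin _ (cub_u sol k))
  vanish th2.
near=> eta => t tab.
have eta0 : 0 < eta by near: eta; exact: nbhs_right_gt.
have etae : eta <= e * (th / 2 / (volume Omega + 1)) / (C + 1).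
  by near: eta; apply: nbhs_right_le; apply: divr_gt0; [exact: mulr_gt0|exact: ltr_wpDl].
have tT := tin t tab.
have bc := cub_bounded_continuous oO bO tT (cub_degenerate_gradient k j eta0).
have uge x : Omega x -> 0 <= comp_u u k t x by move=> Ox; exact: (u_orthant sol tT Ox).
have frac x : Omega x -> 0 <= eta / (comp_u u k t x + eta) <= 1.
  move=> Ox; have y0 : 0 < comp_u u k t x + eta by rewrite ltr_wpDl// uge.
  by apply/andP; split; [apply: divr_ge0; exact: ltW|rewrite ler_pdivrMr// mul1r lerDr uge].
apply: (le_trans (ler_norm _)).
apply: (le_trans (norm_integral_on_le oO bO oOK (C := C) (e := th / 2 / (volume Omega + 1)) _ _ _ bc _ _)).
- by move=> x [].
- by [].
- exact: ltW.
- move=> x [Ox _]; rewrite /degenerate_gradient normrM normr_id.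
  have /andP[f0 f1] := frac x Ox; rewrite (ger0_norm f0) -[leRHS]mul1r ler_pM//.
  exact: HC.
- move=> x Ox nOK; have Kx : K x by apply: contrapT => nK; apply: nOK.
  rewrite /degenerate_gradient normrM normr_id.
  have /andP[f0 f1] := frac x Ox; rewrite (ger0_norm f0).
  have [ue|ue] := ltP (comp_u u k t x) e.
    apply: (@le_trans _ _ (1 * (th / 2 / (volume Omega + 1)))); last by rewrite mul1r.
    rewrite ler_pM// ltW//; apply: (He (t, x)) => /=.
      by split => //=; rewrite in_itv.
    by rewrite ger0_norm// uge.
  apply: (@le_trans _ _ (eta / e * C)).
    rewrite ler_pM//; last exact: HC.
    have y0 : 0 < comp_u u k t x + eta by rewrite ltr_wpDl// uge.
    rewrite ler_pM2l// lef_pV2 ?posrE//.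
    by rewrite (le_trans ue)// lerDl ltW.
  apply: (@le_trans _ _ (eta / e * (C + 1))).
    by apply: ler_wpM2l; [apply: divr_ge0; exact: ltW|rewrite lerDl].
  have C1 : 0 < C + 1 by exact: ltr_wpDl.
  rewrite mulrAC ler_pdivrMr// -ler_pdivlMr//.
  by apply: (le_trans etae); rewrite [e * _]mulrC.
- have h1 : C * volume (Omega `\` K) <= th / 2.
    apply: (le_trans (ler_wpM2l C0 vK)).
    have C1 : 0 < C + 1 by exact: ltr_wpDl.
    have t0 : 0 <= th / 2 by rewrite ltW// divr_gt0.
    by rewrite mulrCA ler_piMr// ler_pdivrMr// mul1r lerDl.
  have h2 : th / 2 / (volume Omega + 1) * volume Omega <= th / 2.
    have v1 : 0 < volume Omega + 1 by exact: ltr_wpDl.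
    have t0 : 0 <= th / 2 by rewrite ltW// divr_gt0.
    by rewrite mulrAC ler_pdivrMr// ler_wpM2l// lerDl.
  lra.
Unshelve. all: by end_near. Qed.

End gradient_small.

(** * Dissipation of the accumulated flux *)

Section flux_dissipation.
Context {R : realType} {n N : nat}.
Variables (Omega : set 'rV[R]_n.+1) (oO : open Omega) (bO : bounded_set Omega).
Hypothesis sO : smooth_boundary Omega.
Variables (tau : 'rV[R]_N) (d f : 'rV[R]_N -> 'rV[R]_N) (u0 : 'rV[R]_n.+1 -> 'rV[R]_N).
Variables (T : R) (u : R -> 'rV[R]_n.+1 -> 'rV[R]_N).
Hypothesis sol : positive_classical_solution Omega tau d f u0 T u.
Variable D : 'I_N -> 'rV[R]_N -> R.
Hypotheses (D_smooth : forall i, smooth_on [set: 'rV[R]_N] (D i))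
  (D_d : forall i v, orthant v -> D i v = d v 0 i).
Local Notation cub := (continuous_up_to_boundary T Omega).

(** One eta serves for all components, directions and times of a compact interval. *)
Lemma degenerate_gradient_choice a b (th : R) : 0 < a -> b < T -> 0 < th ->
  exists2 eta : R, 0 < eta <= 1 & forall k j t, a <= t <= b ->
    integral_on Omega (degenerate_gradient u eta k j t) <= th.
Proof.
move=> a0 bT th0.
have H : \forall eta \near (0 : R)^'+, forall k j t, a <= t <= b ->
    integral_on Omega (degenerate_gradient u eta k j t) <= th.
  apply: filter_forall => k; apply: filter_forall => j.
  exact: (degenerate_gradient_small oO bO sol k j a0 bT th0).
have H1 : \forall eta \near (0 : R)^'+, 0 < eta <= 1.
  near=> eta; apply/andP; split; near: eta; first exact: nbhs_right_gt.
  exact: nbhs_right_le.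
have H2 : \forall eta \near (0 : R)^'+, (forall k j t, a <= t <= b ->
    integral_on Omega (degenerate_gradient u eta k j t) <= th) /\ 0 < eta <= 1.
  by move: H H1; apply: filterS2 => eta.
have [eta [H3 H4]] : exists eta : R, (forall k j t, a <= t <= b ->
    integral_on Omega (degenerate_gradient u eta k j t) <= th) /\ 0 < eta <= 1.
  exact: (@filter_ex _ _ (at_right_proper_filter 0) _ H2).
by exists eta.
Unshelve. all: end_near. Qed.

Definition total_flow t x : R := \sum_i flow u D i t x.
Definition dtotal_flow j t x : R := \sum_i dflow u D i j t x.
Definition mass t x : R := \sum_i tau 0 i * comp_u u i t x.
Definition dt_mass t x : R := \sum_i tau 0 i * dt_u u i t x.

Lemma cub_total_flow : cub total_flow.
Proof. by apply: cub_sum => i; exact: (cub_flow sol D_smooth). Qed.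

Lemma cub_dtotal_flow j : cub (dtotal_flow j).
Proof. by apply: cub_sum => i; exact: (cub_dflow sol D_smooth). Qed.

Lemma cub_mass : cub mass.
Proof. by apply: cub_sum => i; apply: cubM; [exact: cub_cst|exact: (cub_u sol)]. Qed.

Lemma cub_dt_mass : cub dt_mass.
Proof. by apply: cub_sum => i; apply: cubM; [exact: cub_cst|exact: (cub_dt_u sol)]. Qed.

Hypothesis mass_le0 : forall v, orthant v -> \sum_i f v 0 i <= 0.

(** Summing the equations, the reactions only dissipate mass. *)
Lemma dt_mass_le t x : 0 < t < T -> Omega x ->
  dt_mass t x <= \sum_j \sum_i ddflow u D i j t x.
Proof.
move=> tT Ox; have := mass_le0 (u_orthant sol tT Ox).
under eq_bigr do rewrite (solution_equation oO sol D_smooth D_d _ tT Ox).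
by rewrite sumrB subr_le0 exchange_big.
Qed.

Hypothesis D_ge0 : forall i v, orthant v -> 0 <= D i v.

Lemma total_flow_ge0 t x : 0 < t < T -> Omega x -> 0 <= total_flow t x.
Proof.
move=> tT Ox; have ov := u_orthant sol tT Ox.
by apply: sumr_ge0 => i _; rewrite mulr_ge0 ?D_ge0//; exact: ov.
Qed.

(** Here W s is the integral of grad z from eps to s, with z the total flow. At fixed t, the integral
    of W s . grad z(t) + z(t) (v(s) - v(eps)) vanishes at s = eps. Its derivative in s is the integral
    of grad z(s) . grad z(t) + z(t) v_t(s), at most that of div (z(t) grad z(s)), which is 0. Hence
    it is nonpositive at s = t. This replaces the weak form of v(t) - v(eps) <= div W, without any
    differentiation of W in space. *)
Lemma flux_dissipation (W : 'I_n.+1 -> R -> 'rV[R]_n.+1 -> R) (a b eps t : R) :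
  0 < a -> b < T -> a < eps -> eps <= t -> t < b ->
  (forall j s x, a < s < b -> Omega x -> is_derive s (1 : R) ((W j)^~ x) (dtotal_flow j s x)) ->
  (forall j x, W j eps x = 0) ->
  (forall j s, a < s < b -> bounded_continuous Omega (W j s)) ->
  integral_on Omega (fun x => \sum_j W j t x * dtotal_flow j t x) <=
  - integral_on Omega (fun x => total_flow t x * (mass t x - mass eps x)).
Proof.
move=> a0 bT aeps epst tb dW W0 bW.
have ab s : a < s < b -> 0 < s < T.
  by move=> /andP[h1 h2]; rewrite (lt_trans a0 h1) (lt_trans h2 bT).
have tab : a < t < b by rewrite tb (lt_le_trans aeps epst).
have eab : a < eps < b by rewrite aeps (le_lt_trans epst tb).
have tT := ab t tab; have eT := ab eps eab.
have bc g s : a < s < b -> cub g -> bounded_continuous Omega (g s).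
  by move=> sab cg; exact: (cub_bounded_continuous oO bO (ab s sab) cg).
pose h s x := (\sum_j W j s x * dtotal_flow j t x) + total_flow t x * (mass s x - mass eps x).
pose dh s x := (\sum_j dtotal_flow j s x * dtotal_flow j t x) + total_flow t x * dt_mass s x.
have cdh : cub dh.
  apply: cubD.
    apply: cub_sum => j; apply: cubM; first exact: cub_dtotal_flow.
    exact: (cub_freeze tT (cub_dtotal_flow j)).
  by apply: cubM; [exact: (cub_freeze tT cub_total_flow)|exact: cub_dt_mass].
have [C C0 HC] := cub_bounded bO a0 bT cdh.
have b1 s : a < s < b -> bounded_continuous Omega (fun x => \sum_j W j s x * dtotal_flow j t x).
  move=> sab; apply: (@bounded_continuous_sum _ _ _ _ _ _ (fun j x => W j s x * dtotal_flow j t x)) => j _.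
  by apply: bounded_continuousM; [exact: bW|exact: bc (cub_dtotal_flow j)].
have b2 s : a < s < b -> bounded_continuous Omega (fun x => total_flow t x * (mass s x - mass eps x)).
  move=> sab; apply: bounded_continuousM; first exact: bc cub_total_flow.
  by apply: bounded_continuousB; exact: bc cub_mass.
have dI s : a < s < b -> is_derive s (1 : R) (fun s => integral_on Omega (h s)) (integral_on Omega (dh s)).
  apply: (is_derive_integral_on oO bO (C := C)) => //.
  - move=> r x rab Ox.
    have d1 : is_derive r (1 : R) (fun r => \sum_j W j r x * dtotal_flow j t x)
        (\sum_j dtotal_flow j r x * dtotal_flow j t x).
      apply: is_derive_sum_fun => j.
      have := is_deriveM_fun (dW j r x rab Ox) (is_derive_cst (dtotal_flow j t x) r (1 : R)).
      by rewrite mulr0 addr0.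
    have d2 : is_derive r (1 : R) (fun r => mass r x) (dt_mass r x).
      apply: is_derive_sum_fun => i.
      have := is_deriveM_fun (is_derive_cst (tau 0 i) r (1 : R)) (is_derive_dt_u sol i (ab r rab) Ox).
      by rewrite mul0r add0r.
    have d3 := is_deriveB_fun d2 (is_derive_cst (mass eps x) r (1 : R)).
    have := is_deriveD_fun d1 (is_deriveM_fun (is_derive_cst (total_flow t x) r (1 : R)) d3).
    by rewrite subr0 mul0r add0r.
  - by move=> r rab; apply: bounded_continuousD; [exact: b1|exact: b2].
  - by move=> r x /andP[ar rb]; apply: HC; rewrite !ltW.
have dI_le0 s : a < s < b -> integral_on Omega (dh s) <= 0.
  move=> sab; have sT := ab s sab.
  have /choice[F HF] : forall i, exists F : 'I_n.+1 -> 'rV[R]_n.+1 -> R,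
      no_flux Omega F (fun j => ddflow u D i j s) /\
      forall j x, Omega x -> F j x = dflow u D i j s x.
    by move=> i; have [F F1 F2] := flow_no_flux oO bO sol D_smooth D_d i sT; exists F.
  have nF := no_flux_sum (index_enum 'I_N) (fun i => (HF i).1).
  have [Psi cPsi PsiE] := cub_slice tT cub_total_flow.
  have dpsi j x : Omega x -> is_derive x 'e_j (total_flow t) (dtotal_flow j t x).
    by move=> Ox; apply: is_derive_sum_fun => i; exact: (is_derive_flow sol D_smooth i j tT Ox).
  have G := green_scalar oO bO sO nF cPsi PsiE dpsi (fun j => bc _ _ tab (cub_dtotal_flow j)).
  rewrite -G; apply: le_integral_on => //; first exact: bc cdh.
    pose g x := \sum_j (dtotal_flow j t x * dtotal_flow j s x +
      total_flow t x * \sum_i ddflow u D i j s x).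
    refine (eq_bounded_continuous oO (g := g) _ _).
      move=> x Ox; apply: eq_bigr => j _; congr (_ * _ + _).
      by apply: eq_bigr => i _; rewrite (HF i).2.
    apply: (@bounded_continuous_sum _ _ _ _ _ _ (fun j x => dtotal_flow j t x * dtotal_flow j s x +
      total_flow t x * \sum_i ddflow u D i j s x)) => j _.
    apply: bounded_continuousD; apply: bounded_continuousM.
    - exact: bc (cub_dtotal_flow j).
    - exact: bc (cub_dtotal_flow j).
    - exact: bc cub_total_flow.
    - apply: (@bounded_continuous_sum _ _ _ _ _ _ (fun i x => ddflow u D i j s x)) => i _.
      exact: bc (cub_ddflow sol D_smooth i j).
  move=> x Ox; rewrite big_split/= /dh -mulr_sumr lerD//.
    apply: ler_sum => j _; rewrite mulrC (_ : \sum_i F i j x = dtotal_flow j s x)//.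
    by apply: eq_bigr => i _; rewrite (HF i).2.
  by rewrite ler_wpM2l ?total_flow_ge0// dt_mass_le.
have h0 : integral_on Omega (h eps) = 0.
  rewrite -[RHS](mul0r (volume Omega)) -(integral_on_cst oO); apply: eq_integral_on => x Ox.
  by rewrite /h subrr mulr0 addr0 big1// => j _; rewrite W0 mul0r.
have inab s : eps <= s <= t -> a < s < b.
  by move=> /andP[h1 h2]; rewrite (lt_le_trans aeps h1) (le_lt_trans h2 tb).
have := @mean_value_ub R (fun s => integral_on Omega (h s)) (fun s => integral_on Omega (dh s)) _ _ epst
  (fun s hs => dI s (inab s hs)) 0 (fun s hs => dI_le0 s (inab s hs)).
rewrite mul0r h0 subr0 integral_onD//; [|exact: b1|exact: b2].
by rewrite -lerBrDr sub0r.
Qed.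

End flux_dissipation.

(** * Production of entropy *)

Section entropy.
Context {R : realType} {n N : nat}.
Variables (Omega : set 'rV[R]_n.+1) (oO : open Omega) (bO : bounded_set Omega).
Hypothesis sO : smooth_boundary Omega.
Variables (tau : 'rV[R]_N) (d f : 'rV[R]_N -> 'rV[R]_N) (u0 : 'rV[R]_n.+1 -> 'rV[R]_N).
Variables (T : R) (u : R -> 'rV[R]_n.+1 -> 'rV[R]_N).
Hypothesis sol : positive_classical_solution Omega tau d f u0 T u.
Variable D : 'I_N -> 'rV[R]_N -> R.
Hypotheses (D_smooth : forall i, smooth_on [set: 'rV[R]_N] (D i))
  (D_d : forall i v, orthant v -> D i v = d v 0 i).
Hypothesis mass_le0 : forall v, orthant v -> \sum_i f v 0 i <= 0.
Hypothesis D_ge0 : forall i v, orthant v -> 0 <= D i v.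
Hypothesis P_psd : forall v, orthant v -> positive_semidefinite (structure_matrix d v).
Variable Cf : R.
Hypotheses (Cf0 : 0 <= Cf)
  (f_ge : forall v i, orthant v -> - (Cf * (1 + enorm v ^+ 2) * v 0 i) <= f v 0 i).
Local Notation cub := (continuous_up_to_boundary T Omega).

Lemma is_derive_xlnx (x : R) : 0 < x -> is_derive x (1 : R) (fun s : R => s * ln s) (ln x + 1).
Proof.
move=> x0; have := is_deriveM_fun (is_derive_id x (1 : R)) (is_derive1_ln x0).
by rewrite mul1r mulfV// gt_eqF.
Qed.

Lemma cub_ln_shift eta i : 0 < eta -> cub (fun t x => ln (comp_u u i t x + eta)).
Proof.
move=> eta0.
have c1 : continuous (fun s : R => ln (Num.max s 0 + eta)).
  move=> s.
  have p0 : 0 < Num.max s 0 + eta by rewrite ltr_wpDl// le_max lexx orbT.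
  apply: (@continuous_comp _ _ _ (fun s : R => Num.max s 0 + eta) (@ln R)); last exact: continuous_ln.
  apply: cvgD; last exact: cvg_cst.
  by apply: (@continuous_max _ _ (fun s : R => s) (cst 0)); [exact: cvg_id|exact: cst_continuous].
apply: (eq_cub _ (cub_comp c1 (cub_u sol i))) => t x tT Ox.
by rewrite max_l//; exact: (u_orthant sol tT Ox).
Qed.

Lemma cub_inv_shift eta i : 0 < eta -> cub (fun t x => (comp_u u i t x + eta)^-1).
Proof.
move=> eta0.
have c1 : continuous (fun s : R => (Num.max s 0 + eta)^-1).
  move=> s; apply: cvgV; first by rewrite gt_eqF// ltr_wpDl// le_max lexx orbT.
  apply: cvgD; last exact: cvg_cst.
  by apply: (@continuous_max _ _ (fun s : R => s) (cst 0)); [exact: cvg_id|exact: cst_continuous].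
apply: (eq_cub _ (cub_comp c1 (cub_u sol i))) => t x tT Ox.
by rewrite max_l//; exact: (u_orthant sol tT Ox).
Qed.

(** The shift by eta keeps the logarithm smooth at the zeros of the solution. *)
Definition entropy (eta : R) t x : R :=
  \sum_i tau 0 i * ((comp_u u i t x + eta) * ln (comp_u u i t x + eta)).
Definition dt_entropy (eta : R) t x : R :=
  \sum_i tau 0 i * (dt_u u i t x * (ln (comp_u u i t x + eta) + 1)).
(** The divergence of (ln y_i + 1) grad (d_i(u) u_i). *)
Definition entropy_divergence (eta : R) i t x : R :=
  \sum_j (dx_u u i j t x / (comp_u u i t x + eta) * dflow u D i j t x +
    (ln (comp_u u i t x + eta) + 1) * ddflow u D i j t x).

Lemma cub_entropy eta : 0 < eta -> cub (entropy eta).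
Proof.
move=> eta0; apply: cub_sum => i; apply: cubM; first exact: cub_cst.
by apply: cubM; [apply: cubD; [exact: (cub_u sol)|exact: cub_cst]|exact: cub_ln_shift].
Qed.

Lemma cub_dt_entropy eta : 0 < eta -> cub (dt_entropy eta).
Proof.
move=> eta0; apply: cub_sum => i; apply: cubM; first exact: cub_cst.
apply: cubM; first exact: (cub_dt_u sol).
by apply: cubD; [exact: cub_ln_shift|exact: cub_cst].
Qed.

Lemma cub_entropy_divergence eta i : 0 < eta -> cub (entropy_divergence eta i).
Proof.
move=> eta0; apply: cub_sum => j; apply: cubD; apply: cubM.
- by apply: cubM; [exact: (cub_dx_u sol)|exact: cub_inv_shift].
- exact: (cub_dflow sol D_smooth).
- by apply: cubD; [exact: cub_ln_shift|exact: cub_cst].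
- exact: (cub_ddflow sol D_smooth).
Qed.

Lemma is_derive_entropy eta t x : 0 < eta -> 0 < t < T -> Omega x ->
  is_derive t (1 : R) (fun s => entropy eta s x) (dt_entropy eta t x).
Proof.
move=> eta0 tT Ox; apply: is_derive_sum_fun => i.
have y0 : 0 < comp_u u i t x + eta by rewrite ltr_wpDl//; exact: (u_orthant sol tT Ox).
have d1 := is_deriveD_fun (is_derive_dt_u sol i tT Ox) (is_derive_cst eta t (1 : R)).
have := is_deriveM_fun (is_derive_cst (tau 0 i) t (1 : R)) (is_derive_comp_real (f := fun s => comp_u u i s x + eta) (is_derive_xlnx y0) d1).
by rewrite mul0r add0r addr0.
Qed.

(** The logarithm extends to the boundary because y_i >= eta. *)
Lemma integral_entropy_divergence eta i t : 0 < eta -> 0 < t < T ->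
  integral_on Omega (entropy_divergence eta i t) = 0.
Proof.
move=> eta0 tT; have [F nF FE] := flow_no_flux oO bO sol D_smooth D_d i tT.
have [Psi cPsi PsiE] := cub_slice tT (cubD (cub_ln_shift i eta0) (cub_cst T Omega 1)).
have bdp j : bounded_continuous Omega (fun x => dx_u u i j t x / (comp_u u i t x + eta)).
  exact: (cub_bounded_continuous oO bO tT (cubM (cub_dx_u sol i j) (cub_inv_shift i eta0))).
have dpsi j x : Omega x -> is_derive x 'e_j (fun y => ln (comp_u u i t y + eta) + 1)
    (dx_u u i j t x / (comp_u u i t x + eta)).
  move=> Ox.
  have y0 : 0 < comp_u u i t x + eta by rewrite ltr_wpDl//; exact: (u_orthant sol tT Ox).
  have d1 := is_deriveD_fun (is_derive_comp_u sol i j tT Ox) (is_derive_cst (eta : R) x 'e_j).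
  have := is_deriveD_fun (is_derive_comp_real (f := fun y => comp_u u i t y + eta) (is_derive1_ln y0) d1) (is_derive_cst (1 : R) x 'e_j).
  by rewrite !addr0.
rewrite -(green_scalar oO bO sO nF cPsi PsiE dpsi bdp).
by apply: eq_integral_on => x Ox; apply: eq_bigr => j _; rewrite FE.
Qed.

(** The derivative of the entropy splits into the reaction part, bounded by the cubic term, the
    divergence, and the diffusion part, bounded by the regularized gradients. *)
Lemma dt_entropy_le eta CD Cp t x : 0 < eta <= 1 -> 0 < t < T -> Omega x ->
  0 <= CD -> 0 <= Cp -> (forall i k, `|dD D i k (u t x)| <= CD) ->
  (forall i j, `|dx_u u i j t x| <= Cp) ->
  dt_entropy eta t x <= N%:R * Cf * (1 + enorm (u t x)) ^+ 3 +
    (\sum_i entropy_divergence eta i t x +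
    CD * (N%:R * Cp) * \sum_j \sum_k degenerate_gradient u eta k j t x).
Proof.
move=> eta01 tT Ox CD0 Cp0 HCD HCp; have /andP[eta0 eta1] := eta01.
have ov := u_orthant sol tT Ox.
have fE i : tau 0 i * dt_u u i t x = f (u t x) 0 i + \sum_j ddflow u D i j t x.
  by rewrite (solution_equation oO sol D_smooth D_d i tT Ox) subrK.
have H1 := reaction_entropy_le ov Cf0 eta01 (mass_le0 ov) (fun i => f_ge i ov).
have psd : positive_semidefinite (\matrix_(i, j)
    ((dD D i j (u t x) + dD D j i (u t x)) * (u t x 0 i * u t x 0 j)
     + ((i == j)%:R * D i (u t x) * u t x 0 j + (j == i)%:R * D j (u t x) * u t x 0 i))).
  by rewrite -(structure_matrixE D_smooth D_d ov); exact: P_psd.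
have H2 j : - \sum_i dx_u u i j t x / (comp_u u i t x + eta) * dflow u D i j t x <=
    CD * (N%:R * Cp) * \sum_k degenerate_gradient u eta k j t x.
  have := diffusion_entropy_ge (fun i => dx_u u i j t x) ov eta0 CD0
    (fun i => D_ge0 i ov) HCD psd.
  rewrite lerNl => H; apply: (le_trans _ (le_trans H _)).
    rewrite lerN2; apply: ler_sum => i _; rewrite /dflow.
    by under eq_bigr do rewrite mulrC.
  rewrite -[X in _ <= X]mulrA ler_wpM2l//.
  apply: (@le_trans _ _ (\sum_(i < N) \sum_k Cp * degenerate_gradient u eta k j t x)).
    apply: ler_sum => i _; apply: ler_sum => k _; rewrite ler_wpM2r//.
    by rewrite mulr_ge0// divr_ge0 ?ltW// ltr_wpDl// ov.
  by rewrite sumr_const card_ord -mulr_sumr -[leLHS]mulr_natl mulrA.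
have -> : dt_entropy eta t x = \sum_i f (u t x) 0 i * (ln (u t x 0 i + eta) + 1) +
    (\sum_i entropy_divergence eta i t x +
     \sum_j - \sum_i dx_u u i j t x / (comp_u u i t x + eta) * dflow u D i j t x).
  have -> : \sum_j - \sum_i dx_u u i j t x / (comp_u u i t x + eta) * dflow u D i j t x =
    \sum_i - \sum_j dx_u u i j t x / (comp_u u i t x + eta) * dflow u D i j t x.
    by rewrite !sumrN exchange_big.
  rewrite -!big_split/=; apply: eq_bigr => i _.
  rewrite mulrA fE mulrDl; congr (_ + _); rewrite /entropy_divergence mulr_suml -sumrB.
  by apply: eq_bigr => j _; rewrite addrAC subrr add0r mulrC.
apply: lerD => //; rewrite lerD2l mulr_sumr; apply: ler_sum => j _; exact: H2.
Qed.

End entropy.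

(** * Growth of the entropy *)

Section entropy_growth.
Context {R : realType} {n N : nat}.
Variables (Omega : set 'rV[R]_n.+1) (oO : open Omega) (bO : bounded_set Omega).
Hypothesis sO : smooth_boundary Omega.
Variables (tau : 'rV[R]_N) (d f : 'rV[R]_N -> 'rV[R]_N) (u0 : 'rV[R]_n.+1 -> 'rV[R]_N).
Variables (T : R) (u : R -> 'rV[R]_n.+1 -> 'rV[R]_N).
Hypothesis sol : positive_classical_solution Omega tau d f u0 T u.
Variable D : 'I_N -> 'rV[R]_N -> R.
Hypotheses (D_smooth : forall i, smooth_on [set: 'rV[R]_N] (D i))
  (D_d : forall i v, orthant v -> D i v = d v 0 i).
Hypothesis mass_le0 : forall v, orthant v -> \sum_i f v 0 i <= 0.
Hypothesis D_ge0 : forall i v, orthant v -> 0 <= D i v.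
Hypothesis P_psd : forall v, orthant v -> positive_semidefinite (structure_matrix d v).
Variable Cf : R.
Hypotheses (Cf0 : 0 <= Cf)
  (f_ge : forall v i, orthant v -> - (Cf * (1 + enorm v ^+ 2) * v 0 i) <= f v 0 i).
Local Notation cub := (continuous_up_to_boundary T Omega).

Lemma cub_bounded_family (I : finType) (g : I -> R -> 'rV[R]_n.+1 -> R) a b :
  0 < a -> b < T -> (forall i, cub (g i)) ->
  exists2 C : R, 0 <= C & forall i t x, a <= t <= b -> Omega x -> `|g i t x| <= C.
Proof.
move=> a0 bT cg.
have cs : cub (fun t x => \sum_i `|g i t x|).
  by apply: cub_sum => i; exact: (cub_comp (@norm_continuous _ R^o) (cg i)).
have [C C0 HC] := cub_bounded bO a0 bT cs.
exists C => // i t x tab Ox; apply: le_trans (HC t x tab Ox); apply: le_trans (ler_norm _).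
by rewrite (bigD1 i)//= lerDl sumr_ge0.
Qed.

Lemma cub_enorm : cub (fun t x => enorm (u t x)).
Proof.
apply: (cub_comp (@sqrt_continuous R)); apply: cub_sum => i.
exact: (eq_cub _ (cubM (cub_u sol i) (cub_u sol i))).
Qed.

Variables (delta Cd tau0 M lambda Ca : R).
Hypotheses (tau0_gt0 : 0 < tau0) (tau0_le : forall i, tau0 <= tau 0 i).
Hypothesis growth : forall v, orthant v ->
  delta * enorm v ^+ 2 <= \sum_i d v 0 i * v 0 i /\
  \sum_i d v 0 i * v 0 i <= Cd * (1 + enorm v ^+ 2).
Hypotheses (lambda_gt0 : 0 < lambda) (Ca_ge0 : 0 <= Ca).
Hypothesis absorb : forall r z v : R, 0 <= r -> delta * r ^+ 2 <= z ->
  z <= Cd * (1 + r ^+ 2) -> tau0 * r <= v ->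
  N%:R * Cf * (1 + r) ^+ 3 - lambda * (z * (v - M)) <= Ca.

(** The integral of the divergence is 0, and the regularized gradients contribute at most 1 in total
    when K is small. *)
Lemma integral_dt_entropy_le eta K CD Cp t : 0 < eta <= 1 -> 0 < t < T -> 0 <= CD -> 0 <= Cp ->
  (forall i k x, Omega x -> `|dD D i k (u t x)| <= CD) ->
  (forall i j x, Omega x -> `|dx_u u i j t x| <= Cp) ->
  (forall k j, integral_on Omega (degenerate_gradient u eta k j t) <= K) ->
  CD * (N%:R * Cp) * (n.+1%:R * (N%:R * K)) <= 1 ->
  integral_on Omega (dt_entropy tau u eta t) <=
    integral_on Omega (fun x => N%:R * Cf * (1 + enorm (u t x)) ^+ 3) + 1.
Proof.
move=> eta01 tT CD0 Cp0 HCD HCp HK K1; have /andP[eta0 _] := eta01.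
have bc g : cub g -> bounded_continuous Omega (g t) by exact: (cub_bounded_continuous oO bO tT).
have b1 : bounded_continuous Omega (fun x => N%:R * Cf * (1 + enorm (u t x)) ^+ 3).
  have c : cub (fun t x => N%:R * Cf * (1 + enorm (u t x)) ^+ 3).
    apply: cubM; first exact: cub_cst.
    have c1 := cubD (cub_cst T Omega 1) cub_enorm.
    exact: (eq_cub _ (cubM c1 (cubM c1 c1))).
  exact: (bc _ c).
have bdiv i : bounded_continuous Omega (entropy_divergence u D eta i t).
  exact: (bc _ (cub_entropy_divergence sol D_smooth i eta0)).
have bdeg k j : bounded_continuous Omega (degenerate_gradient u eta k j t).
  exact: (bc _ (cub_degenerate_gradient sol k j eta0)).
have bsdeg j : bounded_continuous Omega (fun x => \sum_k degenerate_gradient u eta k j t x).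
  by apply: (@bounded_continuous_sum _ _ _ _ _ _ (fun k x => degenerate_gradient u eta k j t x)).
have bssdeg : bounded_continuous Omega (fun x => \sum_j \sum_k degenerate_gradient u eta k j t x).
  by apply: (@bounded_continuous_sum _ _ _ _ _ _ (fun j x => \sum_k degenerate_gradient u eta k j t x)).
have bsdiv : bounded_continuous Omega (fun x => \sum_i entropy_divergence u D eta i t x).
  by apply: (@bounded_continuous_sum _ _ _ _ _ _ (fun i x => entropy_divergence u D eta i t x)).
have b3 : bounded_continuous Omega
    (fun x => CD * (N%:R * Cp) * \sum_j \sum_k degenerate_gradient u eta k j t x).
  by apply: bounded_continuousM => //; exact: bounded_continuous_cst.
have b2 := bounded_continuousD bsdiv b3.
apply: (le_trans (le_integral_on oO bO (bc _ (cub_dt_entropy sol eta0)) (bounded_continuousD b1 b2) _)).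
  move=> x Ox; apply: (dt_entropy_le oO sol D_smooth D_d mass_le0 D_ge0 P_psd Cf0 f_ge) => //.
  - by move=> i k; exact: HCD.
  - by move=> i j; exact: HCp.
rewrite !integral_onD// lerD2l integral_on_sum// big1 ?add0r; last first.
  by move=> i _; exact: (integral_entropy_divergence oO bO sO sol D_smooth D_d i eta0 tT).
rewrite integral_onZ// (le_trans _ K1)// ler_wpM2l//; first by rewrite !mulr_ge0.
rewrite integral_on_sum// mulr_natl -[X in _ *+ X]card_ord -sumr_const; apply: ler_sum => j _.
rewrite integral_on_sum// mulr_natl -[X in _ *+ X]card_ord -sumr_const; apply: ler_sum => k _.
exact: HK.
Qed.

(** The functional Y = entropy + lambda / 2 |W|^2, integrated over the domain, has a bounded
    derivative: the cubic term of the entropy production is absorbed by lambda z (v - v(eps)), which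
    the accumulated flux W supplies. At t = eps the flux is 0, and afterwards it only adds to Y. *)
Lemma entropy_growth eps t1 : 0 < eps -> eps <= t1 -> t1 < T ->
  (forall x, Omega x -> mass tau u eps x <= M) ->
  exists2 eta : R, 0 < eta <= 1 &
    integral_on Omega (entropy tau u eta t1) <=
    integral_on Omega (entropy tau u eta eps) + (Ca * volume Omega + 1) * T.
Proof.
move=> eps0 epst1 t1T HM.
(* Open margins around [eps, t1], where time derivatives under the integral are taken. *)
pose a := eps / 2; pose b := (t1 + T) / 2.
have a0 : 0 < a by rewrite divr_gt0.
have aeps : a < eps by rewrite /a; lra.
have t1b : t1 < b by rewrite /b; lra.
have bT : b < T by rewrite /b; lra.
have [CD CD0 HCD] := cub_bounded_family (I := ('I_N * 'I_N)%type) a0 bT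
  (fun p => cub_dD sol D_smooth p.1 p.2).
have [Cp Cp0 HCp] := cub_bounded_family (I := ('I_N * 'I_n.+1)%type) a0 bT
  (fun p => cub_dx_u sol p.1 p.2).
pose K0 := CD * (N%:R * Cp) * (n.+1%:R * N%:R).
have K00 : 0 <= K0 by rewrite !mulr_ge0.
have th0 : 0 < (K0 + 1)^-1 by rewrite invr_gt0 ltr_wpDl.
have [eta eta01 Heta] := degenerate_gradient_choice oO bO sol a0 bT th0.
exists eta => //; have /andP[eta0 eta1] := eta01.
have eab : a < eps < b by rewrite aeps (le_lt_trans epst1 t1b).
have ab s : a < s < b -> 0 < s < T.
  by move=> /andP[h1 h2]; rewrite (lt_trans a0 h1) (lt_trans h2 bT).
have bc g s : a < s < b -> cub g -> bounded_continuous Omega (g s).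
  by move=> sab cg; exact: (cub_bounded_continuous oO bO (ab s sab) cg).
have inab s : eps <= s <= t1 -> a < s < b.
  by move=> /andP[h1 h2]; rewrite (lt_le_trans aeps h1) (le_lt_trans h2 t1b).
have cdz j := cub_dtotal_flow sol D_smooth j.
have /choice[W HW] := fun j => cub_antiderivative oO bO a0 bT eab (cdz j).
have dW j s x : a < s < b -> Omega x ->
    is_derive s (1 : R) ((W j)^~ x) (dtotal_flow u D j s x).
  by have [H _ _ _] := HW j; exact: H.
have W0 j x : W j eps x = 0 by have [_ H _ _] := HW j.
have bW j s : a < s < b -> bounded_continuous Omega (W j s).
  by have [_ _ H _] := HW j; exact: H.
have /choice[CW HCW] : forall j, exists C : R, 0 <= C /\
    forall s x, a < s < b -> Omega x -> `|W j s x| <= C.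
  by move=> j; have [_ _ _ [C C0 HC]] := HW j; exists C.
have [Cz Cz0 HCz] := cub_bounded_family a0 bT cdz.
have [Ce Ce0 HCe] := cub_bounded bO a0 bT (cub_dt_entropy sol eta0).
pose sq s x := \sum_j W j s x * W j s x.
pose wz s x := \sum_j W j s x * dtotal_flow u D j s x.
pose h s x := entropy tau u eta s x + lambda / 2 * sq s x.
pose dh s x := dt_entropy tau u eta s x + lambda * wz s x.
have bsq s : a < s < b -> bounded_continuous Omega (sq s).
  move=> sab; apply: (@bounded_continuous_sum _ _ _ _ _ _ (fun j x => W j s x * W j s x)) => j _.
  by apply: bounded_continuousM; exact: bW.
have bwz s : a < s < b -> bounded_continuous Omega (wz s).
  move=> sab; apply: (@bounded_continuous_sum _ _ _ _ _ _ (fun j x => W j s x * dtotal_flow u D j s x)) => j _.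
  by apply: bounded_continuousM; [exact: bW|exact: bc (cdz j)].
have bsq' s : a < s < b -> bounded_continuous Omega (fun x => lambda / 2 * sq s x).
  by move=> sab; apply: bounded_continuousM; [exact: bounded_continuous_cst|exact: bsq].
have bwz' s : a < s < b -> bounded_continuous Omega (fun x => lambda * wz s x).
  by move=> sab; apply: bounded_continuousM; [exact: bounded_continuous_cst|exact: bwz].
have be s : a < s < b -> bounded_continuous Omega (entropy tau u eta s).
  by move=> sab; exact: bc (cub_entropy sol eta0).
have bde s : a < s < b -> bounded_continuous Omega (dt_entropy tau u eta s).
  by move=> sab; exact: bc (cub_dt_entropy sol eta0).
have dI s : a < s < b -> is_derive s (1 : R) (fun s => integral_on Omega (h s)) (integral_on Omega (dh s)).
  apply: (is_derive_integral_on oO bO (C := Ce + lambda * \sum_j CW j * Cz)) => //.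
  - move=> r x rab Ox.
    have d1 : is_derive r (1 : R) (fun r => sq r x)
        (\sum_j (dtotal_flow u D j r x * W j r x + W j r x * dtotal_flow u D j r x)).
      by apply: is_derive_sum_fun => j; exact: (is_deriveM_fun (dW j r x rab Ox) (dW j r x rab Ox)).
    have := is_deriveD_fun (is_derive_entropy sol eta0 (ab r rab) Ox)
      (is_deriveM_fun (is_derive_cst (lambda / 2) r (1 : R)) d1).
    congr is_derive; rewrite mul0r add0r; congr (_ + _); rewrite big_split/=.
    under eq_bigr do rewrite mulrC.
    by rewrite /wz; field.
  - by move=> r rab; apply: bounded_continuousD; [exact: be|exact: bsq'].
  - rewrite addr_ge0// mulr_ge0 ?(ltW lambda_gt0)//; apply: sumr_ge0 => j _.
    by rewrite mulr_ge0//; case: (HCW j).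
  - move=> r x rab Ox; have /andP[ar rb] := rab.
    have rab' : a <= r <= b by rewrite !ltW.
    apply: (le_trans (ler_normD _ _)); apply: lerD; first exact: HCe.
    rewrite normrM (gtr0_norm lambda_gt0) ler_wpM2l ?(ltW lambda_gt0)//.
    apply: (le_trans (ler_norm_sum _ _ _)); apply: ler_sum => j _.
    by rewrite normrM ler_pM//; [exact: (HCW j).2|exact: HCz].
have dI_le s : eps <= s <= t1 -> integral_on Omega (dh s) <= Ca * volume Omega + 1.
  move=> st; have sab := inab s st; have sT := ab s sab; have /andP[es st1] := st.
  have sab' : a <= s <= b by have /andP[h1 h2] := sab; rewrite !ltW.
  have zv : bounded_continuous Omega (fun x => total_flow u D s x * (mass tau u s x - mass tau u eps x)).
    apply: bounded_continuousM; first exact: bc (cub_total_flow sol D_smooth).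
    by apply: bounded_continuousB; exact: bc (cub_mass sol).
  rewrite integral_onD//; [|exact: bde|exact: bwz'].
  rewrite integral_onZ//; last exact: bwz.
  have H1 := @integral_dt_entropy_le eta (K0 + 1)^-1 CD Cp s eta01 sT CD0 Cp0
    (fun i k x Ox => HCD (i, k) s x sab' Ox) (fun i j x Ox => HCp (i, j) s x sab' Ox)
    (fun k j => Heta k j s sab').
  have K1 : CD * (N%:R * Cp) * (n.+1%:R * (N%:R * (K0 + 1)^-1)) <= 1.
    have -> : CD * (N%:R * Cp) * (n.+1%:R * (N%:R * (K0 + 1)^-1)) = K0 / (K0 + 1).
      by rewrite /K0 !mulrA.
    by rewrite ler_pdivrMr ?ltr_wpDl// mul1r lerDl.
  have {}H1 := H1 K1.
  have H2 := flux_dissipation oO bO sO sol D_smooth D_d mass_le0 D_ge0 a0 bT aeps es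
    (le_lt_trans st1 t1b) dW W0 bW.
  have b1 : bounded_continuous Omega (fun x => N%:R * Cf * (1 + enorm (u s x)) ^+ 3).
    have c : cub (fun t x => N%:R * Cf * (1 + enorm (u t x)) ^+ 3).
      apply: cubM; first exact: cub_cst.
      have c1 := cubD (cub_cst T Omega 1) cub_enorm.
      exact: (eq_cub _ (cubM c1 (cubM c1 c1))).
    exact: bc c.
  have bz : bounded_continuous Omega
      (fun x => lambda * (total_flow u D s x * (mass tau u s x - mass tau u eps x))).
    by apply: bounded_continuousM => //; exact: bounded_continuous_cst.
  have H3 : integral_on Omega (fun x => N%:R * Cf * (1 + enorm (u s x)) ^+ 3 -
      lambda * (total_flow u D s x * (mass tau u s x - mass tau u eps x))) <= Ca * volume Omega.
    rewrite -(integral_on_cst oO); apply: le_integral_on => //.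
    - exact: bounded_continuousB.
    - exact: bounded_continuous_cst.
    move=> x Ox; have ov := u_orthant sol sT Ox.
    have z0 := total_flow_ge0 sol D_ge0 sT Ox.
    have zE : total_flow u D s x = \sum_i d (u s x) 0 i * u s x 0 i.
      by apply: eq_bigr => i _; rewrite /flow D_d.
    apply: le_trans (absorb (enorm_ge0 (u s x)) (z := total_flow u D s x) (v := mass tau u s x) _ _ _).
    - rewrite lerD2l lerN2 ler_wpM2l ?(ltW lambda_gt0)// ler_wpM2l// lerB//.
      exact: HM.
    - by rewrite zE; have [] := growth ov.
    - by rewrite zE; have [] := growth ov.
    - apply: (@le_trans _ _ (tau0 * \sum_i u s x 0 i)).
        by rewrite ler_wpM2l ?(ltW tau0_gt0)// enorm_le_sum.
      by rewrite mulr_sumr; apply: ler_sum => i _; rewrite ler_wpM2r.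
  rewrite integral_onB// (integral_onZ oO bO lambda zv) in H3.
  have H4 : lambda * integral_on Omega (wz s) <=
      lambda * - integral_on Omega (fun x => total_flow u D s x * (mass tau u s x - mass tau u eps x)).
    by rewrite ler_wpM2l ?(ltW lambda_gt0).
  apply: (le_trans (lerD H1 H4)); rewrite mulrN addrAC lerD2r; exact: H3.
have := @mean_value_ub R (fun s => integral_on Omega (h s)) (fun s => integral_on Omega (dh s)) _ _ epst1
  (fun s hs => dI s (inab s hs)) (Ca * volume Omega + 1) dI_le.
have t1ab : a < t1 < b by rewrite t1b (lt_le_trans aeps).
have he : integral_on Omega (h eps) = integral_on Omega (entropy tau u eta eps).
  apply: eq_integral_on => x _; rewrite /h /sq big1 ?mulr0 ?addr0// => j _.
  by rewrite W0 mul0r.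
have ht : integral_on Omega (entropy tau u eta t1) <= integral_on Omega (h t1).
  apply: le_integral_on => //; first exact: be.
    by apply: bounded_continuousD; [exact: be|exact: bsq'].
  move=> x _; rewrite lerDl mulr_ge0 ?divr_ge0 ?(ltW lambda_gt0)//.
  by apply: sumr_ge0 => j _; rewrite -expr2 sqr_ge0.
have cge : 0 <= Ca * volume Omega + 1 by rewrite addr_ge0// mulr_ge0// volume_ge0.
have ct : (Ca * volume Omega + 1) * (t1 - eps) <= (Ca * volume Omega + 1) * T.
  by rewrite ler_wpM2l//; lra.
rewrite he; lra.
Qed.

End entropy_growth.

(** * From the entropy to the Luxemburg norm *)

Section LlogL.
Context {R : realType}.

Lemma xlnx_ge (x : R) : 0 < x -> -1 <= x * ln x.
Proof.
move=> x0; have ix0 : 0 < x^-1 by rewrite invr_gt0.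
have : ln x^-1 <= x^-1 by exact: ln_le_id.
rewrite lnV ?posrE// lerNl -(ler_pM2l x0) mulrN mulfV ?gt_eqF//.
Qed.

(** Since ln (1 + s) - ln (s + eta) <= (1 - eta) / (s + eta), replacing 1 + s by s + eta costs at most
    1; the other unit pays for - eta ln (s + eta). *)
Lemma LlogL_young_le (s eta : R) : 0 <= s -> 0 < eta <= 1 ->
  LlogL_young s <= (s + eta) * ln (s + eta) + 2.
Proof.
move=> s0 /andP[eta0 eta1]; have y0 : 0 < s + eta by rewrite ltr_wpDl.
have s1 : 0 < 1 + s by rewrite ltr_pwDl.
have h1 : s * (ln (1 + s) - ln (s + eta)) <= 1.
  have l0 : ln (1 + s) - ln (s + eta) <= (1 + s) / (s + eta) - 1.
    rewrite -ln_div ?posrE// -[X in ln X](subrK 1) addrC.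
    rewrite addrC [X in ln X]addrC; apply: le_ln1Dx.
    by rewrite ltrBrDr addNr divr_gt0.
  apply: (le_trans (ler_wpM2l s0 l0)).
  rewrite -(ler_pM2r y0) mul1r.
  have -> : s * ((1 + s) / (s + eta) - 1) * (s + eta) = s * (1 - eta).
    by field; rewrite gt_eqF.
  nra.
have h2 : - (eta * ln (s + eta)) <= 1.
  have : ln (s + eta)^-1 <= (s + eta)^-1 by apply: ln_le_id; rewrite invr_gt0.
  rewrite lnV ?posrE// => l; rewrite -mulrN.
  apply: (le_trans (ler_wpM2l (ltW eta0) l)).
  by rewrite ler_pdivrMr// mul1r lerDr.
rewrite /LlogL_young; nra.
Qed.

Lemma LlogL_young_ge0 (s : R) : 0 <= s -> 0 <= LlogL_young s.
Proof. by move=> s0; rewrite mulr_ge0// ln_ge0// lerDl. Qed.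

Lemma LlogL_young_scale (s l : R) : 0 <= s -> 1 <= l ->
  LlogL_young (s / l) <= LlogL_young s / l.
Proof.
move=> s0 l1; have l0 : 0 < l by exact: lt_le_trans l1.
have sl : s / l <= s by rewrite ler_pdivrMr// ler_peMr.
have sl0 : 0 <= s / l by rewrite divr_ge0// ltW.
rewrite /LlogL_young -[leRHS]mulrAC ler_wpM2l// ler_ln ?posrE ?ltr_pwDl//.
by rewrite lerD2l.
Qed.

Lemma continuous_LlogL_young_abs (l : R) : 0 < l ->
  continuous (fun s : R => LlogL_young (`|s| / l)).
Proof.
move=> l0 s.
have c1 : {for s, continuous (fun s : R => `|s| / l)}.
  by apply: cvgM; [exact: (@norm_continuous _ R^o)|exact: cvg_cst].
apply: cvgM; first exact: c1.
apply: (@continuous_comp _ _ _ (fun s : R => 1 + `|s| / l) (@ln R)).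
  by apply: cvgD; [exact: cvg_cst|exact: c1].
by apply: continuous_ln; rewrite ltr_pwDl// divr_ge0// ltW.
Qed.

Variables (n : nat) (Omega : set 'rV[R]_n) (oO : open Omega) (bO : bounded_set Omega).

(** For l >= 1 the Young function satisfies Phi (s / l) <= Phi s / l, so l = C + 1 is admissible in
    the Luxemburg infimum. *)
Lemma LlogL_norm_le (g : 'rV[R]_n -> R) (C : R) : {within closure Omega, continuous g} ->
  0 <= C -> integral_on Omega (fun x => LlogL_young `|g x|) <= C ->
  (LlogL_norm Omega g <= (C + 1)%:E)%E.
Proof.
move=> cg C0 gC.
have C1 : 0 < C + 1 by exact: ltr_wpDl.
have bd l : 0 < l -> bounded_continuous Omega (fun x => LlogL_young (`|g x| / l)).
  move=> l0; have cw := within_continuous_comp _ _ _ (in1W (continuous_LlogL_young_abs l0)) cg.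
  exact: (bounded_continuous_closure oO bO cw).
apply: ereal_inf_lbound; exists (C + 1) => //; split => //.
have ig := integrable_bounded_continuous oO bO (bd _ C1).
have -> : integral_rV Omega (fun x => (LlogL_young (`|g x| / (C + 1)))%:E) =
    (integral_on Omega (fun x => LlogL_young (`|g x| / (C + 1))))%:E.
  rewrite /integral_on /Rintegral fineK//.
  by apply: integrable_fin_num => //; exact: measurable_row_open.
rewrite lee_fin.
have b1 : bounded_continuous Omega (fun x => LlogL_young `|g x|).
  apply: (eq_bounded_continuous oO _ (bd 1 ltr01)) => x _.
  by rewrite divr1.
apply: (@le_trans _ _ (integral_on Omega (fun x => (C + 1)^-1 * LlogL_young `|g x|))).
  apply: le_integral_on => //; first exact: bd.
    by apply: bounded_continuousM => //; exact: bounded_continuous_cst.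
  by move=> x _; rewrite [leRHS]mulrC; apply: LlogL_young_scale => //; rewrite lerDr.
rewrite integral_onZ// ler_pdivrMl// mulr1 (le_trans gC)// lerDl//.
Qed.

End LlogL.

Section initial_time.
Context {R : realType} {n N : nat}.
Variables (Omega : set 'rV[R]_n.+1) (oO : open Omega) (bO : bounded_set Omega).
Variables (tau : 'rV[R]_N) (d f : 'rV[R]_N -> 'rV[R]_N) (u0 : 'rV[R]_n.+1 -> 'rV[R]_N).
Variables (T : R) (u : R -> 'rV[R]_n.+1 -> 'rV[R]_N).
Hypothesis sol : positive_classical_solution Omega tau d f u0 T u.

(** By compactness of the closure, u is uniformly close to its initial value for small times. This
    bounds the entropy at time eps by a constant that only depends on u0. *)
Lemma near_initial (t1 : R) : 0 < t1 < T ->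
  exists2 eps : R, 0 < eps <= t1 &
    forall x i, Omega x -> u eps x 0 i <= u0 x 0 i + 1.
Proof.
move=> /andP[t10 t1T]; have T0 := lt_trans t10 t1T.
have cov := (compact_near_coveringP (closure Omega)).1 (closure_compact bO).
(* At each x of the closure, u s x' and u 0 x' are both within 1 / 2 of u 0 x for (s, x') near (0, x). *)
pose P (s : R) (x : 'rV[R]_n.+1) := closure Omega x -> 0 <= s < T ->
  forall i, u s x 0 i <= u 0 x 0 i + 1.
have loc x : closure Omega x -> \forall x' \near x & s \near (0 : R), P s x'.
  move=> cx.
  have Qx : (`[0, T[%classic `*` closure Omega) (0, x) by split => //=; rewrite in_itv/= lexx.
  have B0 : nbhs (u 0 x) (ball (u 0 x) (1 / 2)) by apply: nbhsx_ballx; rewrite divr_gt0.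
  have H : \forall p \near ((0 : R), x), (`[0, T[%classic `*` closure Omega) p ->
      ball (u 0 x) (1 / 2) (u p.1 p.2) :=
    (subspace_continuousP _ _).1 (sol_continuous sol) _ Qx _ B0.
  have [[A B] /= [A0 Bx] AB] := H.
  exists (B, A) => //= -[x' s] [/= Bx' As] cx' sT i.
  have close r : A r -> 0 <= r < T -> `|u 0 x 0 i - u r x' 0 i| < 1 / 2.
    move=> Ar rT; have := AB (r, x') (conj Ar Bx').
    have Qr : (`[0, T[%classic `*` closure Omega) (r, x') by split => //=; rewrite in_itv.
    move=> /(_ Qr); rewrite -ball_normE /=; apply: le_lt_trans.
    have -> : u 0 x 0 i - u r x' 0 i = (u 0 x - u r x') 0 i by rewrite !mxE.
    exact: rV_coord_le.
  have := close s As sT; have := close 0 (nbhs_singleton A0); rewrite lexx T0 => /(_ isT).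
  by rewrite !ltr_norml => /andP[h1 h2] /andP[h3 h4]; lra.
have [e /= e0 He] := (nbhs_ballP _ _).1 (cov R (nbhs (0 : R)) P _ loc).
pose eps := Num.min (e / 2) t1.
have eps0 : 0 < eps by rewrite lt_min t10 divr_gt0.
have epst1 : eps <= t1 by rewrite ge_min lexx orbT.
have epse : eps <= e / 2 by rewrite ge_min lexx.
exists eps; first by rewrite eps0.
move=> x i Ox; rewrite -(sol_initial sol Ox).
have cx := subset_closure Ox.
have Be : ball 0 e eps by rewrite /ball/= sub0r normrN gtr0_norm//; lra.
apply: (He eps Be x cx cx); rewrite ltW//=; exact: le_lt_trans t1T.
Qed.

End initial_time.

(** * The a priori bound *)

Section LlogL_bound.
Context {R : realType} {n N : nat}.
Variables (Omega : set 'rV[R]_n.+1) (oO : open Omega) (bO : bounded_set Omega).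
Hypothesis sO : smooth_boundary Omega.
Variables (tau : 'rV[R]_N) (tau_gt0 : forall i, 0 < tau 0 i).
Variables (u0 : 'rV[R]_n.+1 -> 'rV[R]_N) (u0_regular : {within closure Omega, continuous u0}).
Variables (d : 'rV[R]_N -> 'rV[R]_N) (d_smooth : forall i, smooth_on_orthant (fun u => d u 0 i)).
Hypothesis d_ge0 : forall u i, orthant u -> 0 <= d u 0 i.
Hypothesis P_psd : forall u, orthant u -> positive_semidefinite (structure_matrix d u).
Variables (delta Cd : R) (delta_gt0 : 0 < delta) (Cd_gt0 : 0 < Cd).
Hypothesis d_linear_growth : forall u, orthant u ->
  delta * enorm u ^+ 2 <= \sum_i d u 0 i * u 0 i /\
  \sum_i d u 0 i * u 0 i <= Cd * (1 + enorm u ^+ 2).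
Variables (f : 'rV[R]_N -> 'rV[R]_N) (Cf : R) (Cf_ge0 : 0 <= Cf).
Hypothesis f_mass_dissipation : forall u, orthant u -> \sum_i f u 0 i <= 0.
Hypothesis f_ge : forall v i, orthant v -> - (Cf * (1 + enorm v ^+ 2) * v 0 i) <= f v 0 i.
Variables (T : R) (T_gt0 : 0 < T).

(** The harmonic bound avoids taking a minimum over a possibly empty family. *)
Lemma lower_weight : exists2 w : R, 0 < w & forall i, w <= tau 0 i.
Proof.
have s0 : 0 <= \sum_i (tau 0 i)^-1 by apply: sumr_ge0 => i _; rewrite invr_ge0 ltW.
exists (1 + \sum_i (tau 0 i)^-1)^-1; first by rewrite invr_gt0 ltr_pwDl.
move=> i; rewrite -[leRHS]invrK lef_pV2 ?posrE ?invr_gt0 ?ltr_pwDl//.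
rewrite (bigD1 i)//= addrCA lerDl addr_ge0//.
by apply: sumr_ge0 => j _; rewrite invr_ge0 ltW.
Qed.

Lemma initial_bound : exists2 M : R, 0 <= M & forall x i, Omega x -> u0 x 0 i <= M.
Proof.
have cn : {within closure Omega, continuous (fun x => `|u0 x|)}.
  exact: (within_continuous_comp _ _ _ (in1W (@norm_continuous _ _)) u0_regular).
have [M M0 HM] := compact_normr_le (closure_compact bO) cn.
exists M => // x i Ox; apply: (le_trans (ler_norm _)); apply: (le_trans (rV_coord_le _ _)).
by have := HM x (subset_closure Ox); rewrite normr_id.
Qed.

(** The entropy at t is compared with the entropy at a time eps <= t where u <= max u0 + 1. Neither
    eps nor eta enters the constant. *)
Lemma LlogL_bound : exists C : R, forall u,
  positive_classical_solution Omega tau d f u0 T u ->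
  forall t, 0 <= t < T -> (LlogL_norm_rV Omega (u t) <= C%:E)%E.
Proof.
have [w w0 wtau] := lower_weight.
have [M0 M00 HM0] := initial_bound.
have /choice[D HD] : forall i, exists G : 'rV[R]_N -> R,
    smooth_on [set: 'rV[R]_N] G /\ forall v, orthant v -> G v = d v 0 i.
  by move=> i; have [G G1 G2] := d_smooth i; exists G.
have D_smooth i := (HD i).1.
have D_d i := (HD i).2.
have D_ge0 i v : orthant v -> 0 <= D i v by move=> ov; rewrite D_d// d_ge0.
pose S := \sum_i tau 0 i.
have S0 : 0 <= S by apply: sumr_ge0 => i _; exact: ltW.
have A0 : 0 <= N%:R * Cf by rewrite mulr_ge0.
have MM0 : 0 <= S * (M0 + 1) by rewrite mulr_ge0// addr_ge0.
have [lambda lambda0 [Ca Ca0 absorb]] := cubic_absorption A0 delta_gt0 Cd_gt0 w0 MM0.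
have V0 : 0 <= volume Omega := volume_ge0 Omega.
pose B := S * (M0 + 2) ^+ 2 * volume Omega + (Ca * volume Omega + 1) * T.
have B0 : 0 <= B.
  by rewrite addr_ge0// !mulr_ge0 ?exprn_ge0 ?addr_ge0 ?mulr_ge0// ltW.
pose C1 := w^-1 * (B + 2 * S * volume Omega) + M0 ^+ 2 * volume Omega.
have C10 : 0 <= C1.
  rewrite addr_ge0 ?mulr_ge0 ?exprn_ge0// ?invr_ge0 ?(ltW w0)//.
  by rewrite addr_ge0// !mulr_ge0.
exists (N%:R * (C1 + 1)) => u sol.
have bphi i t : 0 <= t < T -> {within closure Omega, continuous (fun x => u t x 0 i)}.
  by move=> tT; exact: (within_continuous_comp _ _ _ (in1W (@coord_continuous R _ _ 0 i)) (u_slice_continuous sol tT)).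
have byoung i t : 0 <= t < T -> bounded_continuous Omega (fun x => LlogL_young `|u t x 0 i|).
  move=> tT; have c1 := within_continuous_comp _ _ _ (in1W (continuous_LlogL_young_abs ltr01)) (bphi i t tT).
  apply: (eq_bounded_continuous oO _ (bounded_continuous_closure oO bO c1)) => x _.
  by rewrite /= divr1.
have ge0 t x i : 0 <= t < T -> Omega x -> 0 <= u t x 0 i.
  by move=> tT Ox; apply: (sol_ge0 sol) => //; exact: subset_closure.
suff main i t : 0 <= t < T -> integral_on Omega (fun x => LlogL_young `|u t x 0 i|) <= C1.
  move=> t tT; rewrite /LlogL_norm_rV.
  apply: (@le_trans _ _ (\sum_(i < N) (C1 + 1)%:E)%E).
    by apply: lee_sum => i _; apply: LlogL_norm_le => //; [exact: bphi|exact: main].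
  by rewrite sumEFin sumr_const card_ord mulr_natl.
move=> tT; have /andP[t0 tT'] := tT; move: t0; rewrite le_eqVlt => /orP[/eqP te|t0].
  apply: (@le_trans _ _ (M0 ^+ 2 * volume Omega)); last first.
    by rewrite lerDr mulr_ge0 ?invr_ge0 ?(ltW w0)// addr_ge0// !mulr_ge0.
  rewrite -(integral_on_cst oO); apply: le_integral_on => //; first exact: byoung.
    exact: bounded_continuous_cst.
  move=> x Ox; rewrite -te (sol_initial sol Ox).
  have v0 : 0 <= u0 x 0 i by rewrite -(sol_initial sol Ox); apply: ge0 => //; rewrite lexx.
  rewrite ger0_norm// /LlogL_young expr2 ler_pM ?ln_ge0 ?lerDl ?HM0//.
  by apply: (le_trans (le_ln1Dx _)); [exact: lt_le_trans v0|exact: HM0].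
have tT2 : 0 < t < T by rewrite t0.
have [eps /andP[eps0 epst] Heps] := near_initial bO sol tT2.
have eT : 0 < eps < T by rewrite eps0 (le_lt_trans epst).
have HM x : Omega x -> mass tau u eps x <= S * (M0 + 1).
  move=> Ox; rewrite mulr_suml; apply: ler_sum => k _; rewrite ler_wpM2l ?(ltW (tau_gt0 k))//.
  by apply: (le_trans (Heps x k Ox)); rewrite lerD2r HM0.
have [eta eta01 G] := entropy_growth oO bO sO sol D_smooth D_d f_mass_dissipation D_ge0 P_psd
  Cf_ge0 f_ge w0 wtau d_linear_growth lambda0 Ca0 absorb eps0 epst tT' HM.
have /andP[eta0 eta1] := eta01.
have bent s : 0 < s < T -> bounded_continuous Omega (entropy tau u eta s).
  by move=> sT; exact: (cub_bounded_continuous oO bO sT (cub_entropy sol eta0)).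
have Ge : integral_on Omega (entropy tau u eta eps) <= S * (M0 + 2) ^+ 2 * volume Omega.
  rewrite -(integral_on_cst oO); apply: le_integral_on => //; first exact: bent.
    exact: bounded_continuous_cst.
  move=> x Ox; rewrite mulr_suml; apply: ler_sum => k _; rewrite ler_wpM2l ?(ltW (tau_gt0 k))//.
  have v0 : 0 <= u eps x 0 k by apply: ge0 => //; rewrite (ltW eps0) (le_lt_trans epst).
  have y0 : 0 < comp_u u k eps x + eta by rewrite ltr_wpDl.
  have yM : comp_u u k eps x + eta <= M0 + 2.
    by have := Heps x k Ox; have := HM0 x k Ox; rewrite /comp_u; lra.
  apply: (le_trans (ler_wpM2l (ltW y0) (ln_le_id y0))).
  by rewrite expr2 ler_pM// ltW.
have GB := le_trans G (lerD Ge (lexx _)).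
rewrite -/B in GB.
apply: (@le_trans _ _ (w^-1 * (B + 2 * S * volume Omega))); last first.
  by rewrite lerDl mulr_ge0// exprn_ge0.
have b2 : bounded_continuous Omega (fun x => entropy tau u eta t x + 2 * S).
  by apply: bounded_continuousD; [exact: bent|exact: bounded_continuous_cst].
rewrite ler_pdivlMl// -integral_onZ//; last exact: byoung.
apply: (@le_trans _ _ (integral_on Omega (fun x => entropy tau u eta t x + 2 * S))); last first.
  rewrite integral_onD//; [|exact: bent|exact: bounded_continuous_cst].
  by rewrite (integral_on_cst oO) lerD2r.
apply: le_integral_on => //.
  by apply: bounded_continuousM; [exact: bounded_continuous_cst|exact: byoung].
move=> x Ox; rewrite /entropy mulr_sumr -big_split/=.
have y0 k : 0 < u t x 0 k + eta by rewrite ltr_wpDl// ge0.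
have term k : 0 <= (u t x 0 k + eta) * ln (u t x 0 k + eta) + 2.
  by have := xlnx_ge (y0 k); lra.
apply: (@le_trans _ _ (tau 0 i * ((u t x 0 i + eta) * ln (u t x 0 i + eta) + 2))).
  rewrite ger0_norm ?ge0// ler_pM ?(ltW w0)//; last exact: LlogL_young_le (ge0 _ _ _ tT Ox) eta01.
  by apply: LlogL_young_ge0; exact: ge0.
rewrite (bigD1 i)//= /comp_u -[leLHS]addr0 mulrDr [2 * _]mulrC lerD2l.
apply: sumr_ge0 => k _; rewrite [2 * _]mulrC -mulrDr mulr_ge0 ?term//.
exact: ltW.
Qed.

End LlogL_bound.

Theorem theorem2 (R : realType) (n N : nat) (n_gt0 : (0 < n)%N)
  (Omega : set 'rV[R]_n)
  (Omega_domain : bounded_domain Omega) (Omega_smooth : smooth_boundary Omega)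
  (tau : 'rV[R]_N) (tau_gt0 : forall i, 0 < tau 0 i)
  (u0 : 'rV[R]_n -> 'rV[R]_N)
  (u0_regular : {within closure Omega, continuous u0})
  (u0_ge0 : forall x i, Omega x -> 0 <= u0 x 0 i)
  (u0_neq0 : exists2 x, Omega x & u0 x != 0)
  (d : 'rV[R]_N -> 'rV[R]_N)
  (d_smooth : forall i, smooth_on_orthant (fun u => d u 0 i))
  (c0 : R) (c0_gt0 : 0 < c0)
  (d_ge_c0 : forall u i, orthant u -> c0 <= d u 0 i)
  (P_psd : forall u, orthant u -> positive_semidefinite (structure_matrix d u))
  (delta Cd : R) (delta_gt0 : 0 < delta) (Cd_gt0 : 0 < Cd)
  (d_linear_growth : forall u, orthant u ->
     delta * enorm u ^+ 2 <= \sum_i d u 0 i * u 0 i /\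
     \sum_i d u 0 i * u 0 i <= Cd * (1 + enorm u ^+ 2))
  (f : 'rV[R]_N -> 'rV[R]_N)
  (f_lipschitz : [locally [lipschitz f u | u in @orthant R N]])
  (f_quasi_positive : forall u i, orthant u ->
     0 <= f (\row_j (if j == i then 0 else u 0 j)) 0 i)
  (f_mass_dissipation : forall u, orthant u -> \sum_i f u 0 i <= 0)
  (Cf : R) (Cf_gt0 : 0 < Cf)
  (f_cubic_growth : forall u i, orthant u ->
     `|f u 0 i| <= Cf * (1 + enorm u ^+ 3))
  (f_derivative_bound : forall u i l, orthant u ->
     is_derive_in (@orthant R N) (fun v => f v 0 i) u 'e_i l ->
     - (Cf * (1 + enorm u ^+ 2)) <= l)
  (T : R) (T_gt0 : 0 < T) :
  exists C_T : R, forall u : R -> 'rV[R]_n -> 'rV[R]_N,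
    positive_classical_solution Omega tau d f u0 T u ->
    (ereal_sup [set LlogL_norm_rV Omega (u t) | t in `[0%R, T[%classic]
       <= C_T%:E)%E.
Proof.
destruct n as [|m]; first by [].
have [oO _ _ bO] := Omega_domain.
have d_ge0 v i : orthant v -> 0 <= d v 0 i.
  by move=> ov; apply: le_trans (d_ge_c0 v i ov); exact: ltW.
have f_ge := reaction_lower_bound Cf_gt0 f_lipschitz f_quasi_positive f_derivative_bound.
have [C HC] := LlogL_bound oO bO Omega_smooth tau_gt0 u0_regular d_smooth d_ge0 P_psd
  delta_gt0 Cd_gt0 d_linear_growth (ltW Cf_gt0) f_mass_dissipation f_ge T_gt0.
exists C => u sol; apply: ge_ereal_sup => _ [t /= tT <-].
by apply: HC => //; move: tT; rewrite in_itv.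
Qed.
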